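(* Let $p, q, r$ be pairwise distinct primes and let $n = p^2qr$. Then every (nonempty) spectral set $S \subseteq \mathbb{Z}_n$ is a tile of $\mathbb{Z}_n$.
   Context: $\mathbb{Z}_n$ denotes the cyclic group of order $n$ (integers modulo $n$). Its characters are $\chi_k(x) = e^{2\pi i k x/n}$ for $k \in \mathbb{Z}_n$. A nonempty subset $S \subseteq \mathbb{Z}_n$ is called spectral if the vector space of complex-valued functions on $S$ is spanned by pairwise orthogonal functions that are restrictions to $S$ of characters of $\mathbb{Z}_n$. Equivalently, there is a set $\Lambda \subseteq \mathbb{Z}_n$ with $|\Lambda| = |S|$ such that $\sum_{s \in S} \chi_{k-l}(s) = 0$ for all $k \neq l$ in $\Lambda$. A subset $S \subseteq \mathbb{Z}_n$ is called a tile if there is a $T \subseteq \mathbb{Z}_n$ such that $S + T = \mathbb{Z}_n$ and $|S||T| = n$, i.e. every element of $\mathbb{Z}_n$ can be written uniquely as $s+t$ with $s \in S$, $t \in T$. *)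

(* Defs.v *)
From mathcomp Require Import all_boot all_order all_algebra.
From mathcomp Require Import reals trigo.
From mathcomp Require Import complex.

Set Implicit Arguments.
Unset Strict Implicit.
Unset Printing Implicit Defensive.

Import Order.TTheory GRing.Theory Num.Theory.

Local Open Scope ring_scope.
Local Open Scope complex_scope.

(* n is meant to be at least 2 below: 'Z_0 and 'Z_1 both denote Z/2. *)

(* exp (2 i pi k x / n), through its real and imaginary parts; k and x are
   read through their representatives in [0, n[. *)
Definition chi (R : realType) (n : nat) (k x : 'Z_n) : R[i] :=
  let t : R := 2%:R * pi * (k : nat)%:R * (x : nat)%:R / n%:R in
  cos t +i* sin t.

Section Spectral.
Variables (R : realType) (n : nat) (S : {set 'Z_n}).

Definition fun_on : Type := {ffun {x : 'Z_n | x \in S} -> R[i]^o}.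

Definition inner (f g : fun_on) : R[i] := \sum_x f x * (g x)^*.

Definition chi_on (k : 'Z_n) : fun_on := [ffun x => chi R k (val x)].

(* The index set L may be taken without repetition: two distinct indices
   whose characters agree on a nonempty S are not orthogonal on S. *)
Definition spectral : Prop :=
  S != set0 /\
  exists L : {set 'Z_n},
    {in L &, forall k l, k != l -> inner (chi_on k) (chi_on l) = 0} /\
    <<[seq chi_on k | k in L]>>%VS = fullv.

End Spectral.

Definition tile (n : nat) (S : {set 'Z_n}) : Prop :=
  exists T : {set 'Z_n},
    [set s + t | s in S, t in T] = [set: 'Z_n] /\ (#|S| * #|T| = n)%N.

(* Main.v *)
(** Write s in Z_n through x = s mod p, the next base-p digit t of s mod p^2,
    y = s mod q and z = s mod r, so that a set becomes a 0/1 grid. For a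
    divisor d > 1 of n, the sum of the values on S of a character of order d
    vanishes or not independently of the character (cyclotomic polynomials are
    irreducible), and by Fourier inversion on Z_d it vanishes iff alternating
    sums of the residue counts of S over "cuboids" vanish: a marginal of the
    grid is constant (one prime), or of the form u(i) + v(j) (two primes), or
    satisfies the three-dimensional analogue (three primes). Spectrality of S
    with spectrum L says: if two points of L differ by an element of order d,
    then d vanishes on S; unitarity of the character table makes this
    symmetric in S and L.

    If a prime l does not divide |S| = |L|, then l vanishes on neither set, so
    neither contains a difference of order l (nor p^2 if l = p). A function
    u(i) + v(j) >= 0 with v not constant is positive on a whole line j = j0,
    and one that vanishes on a line is constant in one variable; together with
    counting, these two remarks decide, according to which of p, q, r divide
    |S|, that |S| divides n and that S has no difference in common with a
    product T of subgroups and digit sets, which is then a tiling complement.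
*)

Require Import Defs.
From mathcomp Require Import all_boot all_order all_algebra all_field.
From mathcomp Require Import zify ring.
From mathcomp Require Import boolp reals trigo.
From mathcomp Require Import complex.

Set Implicit Arguments.
Unset Strict Implicit.
Unset Printing Implicit Defensive.

(** The obstacle is the square p^2. For l = q or r not dividing |S|, V_l fails outright; but when p
    divides |S|, this decides neither [Vp] nor [Vp2], and only both together force p^2 to divide
    |S|. Most of the work goes into the cases where p divides |S|. Two mechanisms alternate. If V_d
    holds for d = d' l but V_d' fails, a marginal contains a full line; the N conditions turn this
    line into an injection between coordinate ranges, that is, an inequality between two primes, or
    into two points at a forbidden difference. If a layer of one set is empty, V_d there would
    descend to a smaller order; where divisibility excludes that order, V_d fails and the other set
    gains N_d. Information travels in this way between the set and its spectrum, and any size bound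
    for one holds for the other. *)

Lemma sum_gt0P (I : finType) (F : I -> nat) :
  reflect (exists i, 0 < F i) (0 < \sum_i F i).
Proof.
apply: (iffP idP) => [|[i Fi]]; last by rewrite (bigD1 i) //=; lia.
rewrite lt0n sum_nat_eq0 => /forallPn[i Fi]; exists i; rewrite lt0n.
exact: Fi.
Qed.

Lemma leq_sum_term (I : finType) (F : I -> nat) i : F i <= \sum_i F i.
Proof. by rewrite (bigD1 i) //= leq_addr. Qed.

Lemma sum_const_ord n (F : 'I_n -> nat) c :
  (forall i, F i = c) -> \sum_i F i = n * c.
Proof. by move=> Fc;
  rewrite (eq_bigr _ (fun i _ => Fc i)) sum_nat_const card_ord. Qed.

Lemma sum_leq_ord n (F : 'I_n -> nat) c :
  (forall i, F i <= c) -> \sum_i F i <= n * c.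
Proof.
by move=> Fc; rewrite -[n in n * c]card_ord -sum_nat_const leq_sum.
Qed.

Lemma sum_geq_ord n (F : 'I_n -> nat) c :
  (forall i, c <= F i) -> n * c <= \sum_i F i.
Proof.
by move=> Fc; rewrite -[n in n * c]card_ord -sum_nat_const leq_sum.
Qed.

Lemma sum_bool_leq (I K : finType) (b : I -> bool) (g : I -> K) :
  (forall i j, b i -> b j -> g i = g j -> i = j) -> \sum_i b i <= #|K|.
Proof.
move=> inj; rewrite -big_mkcond sum1dep_card -(card_in_imset (f := g)).
  exact: max_card.
by move=> i j; rewrite !inE; apply: inj.
Qed.

Lemma sum_bool_leq1 (I : finType) (b : I -> bool) :
  (forall i j, b i -> b j -> i = j) -> \sum_i b i <= 1.
Proof.
by move=> inj; rewrite -card_unit (sum_bool_leq (g := fun=> tt)) // => *;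
  apply: inj.
Qed.

Lemma leq_of_relation m n (P : 'I_m -> 'I_n -> Prop) :
  (forall i, exists j, P i j) -> (forall i i' j, P i j -> P i' j -> i = i') ->
  m <= n.
Proof.
move=> /fin_all_exists[f Pf] inj; rewrite -[m]card_ord -[n]card_ord.
by apply: (leq_card f) => i i' e; apply: (inj _ _ (f i)) => //; rewrite e.
Qed.

(** * Functions of the form u(i) + v(j) and their three-variable analogue *)

Definition rect2 (I J : Type) (f : I -> J -> nat) :=
  forall i i' j j', f i j + f i' j' = f i j' + f i' j.

(** The solutions are the sums of three functions of two variables each. Corners with an even number
    of primes stand on the left, which keeps the alternating sum free of subtraction in nat. *)
Definition rect3 (I J K : Type) (f : I -> J -> K -> nat) :=
  forall i i' j j' k k',
    f i j k + f i j' k' + f i' j k' + f i' j' k =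
    f i' j' k' + f i' j k + f i j' k + f i j k'.

Section Rect.
Variables (m n : nat) (f : 'I_m -> 'I_n -> nat).
Hypothesis fR : rect2 f.

Lemma rect2_tr : rect2 (fun j i => f i j).
Proof. by move=> j j' i i'; have := fR i i' j j'; lia. Qed.

(** Two columns differ by the same amount in every row, so a column that is minimal in one row is
    minimal in all. *)
Lemma rect2_min (j : 'I_n) : exists j0, forall i j, f i j0 <= f i j.
Proof.
case: (posnP m) => [m0|m_gt0]; first by exists j => i; have := ltn_ord i; lia.
pose i0 := Ordinal m_gt0.
case: (arg_minnP (f i0) (erefl : xpredT j)) => j0 _ min; exists j0 => i j'.
by have := fR i i0 j0 j'; have := min j' isT; lia.
Qed.

(** The excess over the minimal column does not depend on the row. Modulo m only n times the minimal
    column sum survives: divisibility of the total, together with a size bound, will make that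
    column vanish. *)
Lemma rect2_sum i0 j0 : (forall i j, f i j0 <= f i j) ->
  \sum_i \sum_j f i j = n * (\sum_i f i j0) + m * \sum_j (f i0 j - f i0 j0).
Proof.
move=> min.
have E i : \sum_j f i j = n * f i j0 + \sum_j (f i0 j - f i0 j0).
  have <- : \sum_(j < n) f i j0 = n * f i j0 by exact: sum_const_ord.
  rewrite -big_split /=.
  by apply: eq_bigr => j _; have := fR i i0 j j0; have := min i0 j; lia.
rewrite (eq_bigr _ (fun i _ => E i)) big_split /= -big_distrr /=.
by congr (_ + _); apply: sum_const_ord.
Qed.

Lemma rect2_row_gt (i : 'I_m) j j' : f i j <> f i j' ->
  exists j0, forall i, 0 < f i j0.
Proof.
move=> ne; have [lt|lt|//] := ltngtP (f i j) (f i j').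
  by exists j' => i'; have := fR i i' j j'; lia.
by exists j => i'; have := fR i i' j j'; lia.
Qed.

Lemma rect2_col0 j0 : (forall i, f i j0 = 0) -> forall i i' j, f i j = f i' j.
Proof. by move=> f0 i i' j; have := fR i i' j j0; rewrite !f0; lia. Qed.

(** If u and v both varied, u(i) + v(j) would have range at least 2. *)
Lemma rect2_bool : (forall i j, f i j <= 1) ->
  (forall i j j', f i j = f i j') \/ (forall i i' j, f i j = f i' j).
Proof.
move=> f1; have [|nc] := lem (forall i j j', f i j = f i j'); first by left.
right=> i i' j; apply: contrapT => ne; apply: nc => k l l'.
have := fR i i' j l; have := fR i i' j l'; have := fR i k l l'.
have := f1 i j; have := f1 i l; have := f1 i l'.
by have := f1 i' j; have := f1 i' l; have := f1 i' l'; lia.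
Qed.

End Rect.

Lemma rect2_col_gt m n (f : 'I_m -> 'I_n -> nat) i i' j : rect2 f ->
  f i j <> f i' j -> exists i0, forall j, 0 < f i0 j.
Proof. by move=> /rect2_tr fR ne; have [i0 H] := rect2_row_gt fR ne;
  exists i0. Qed.

(** By [rect3] the rectangle defect of the slice x does not depend on x; the m equal defects add up
    to that of the summed function, which is 0. *)
Lemma rect3_slice m n k (f : 'I_m -> 'I_n -> 'I_k -> nat) : rect3 f ->
  rect2 (fun y z => \sum_x f x y z) -> forall x, rect2 (f x).
Proof.
move=> f3 f2 x y y' z z'.
pose L x := f x y z + f x y' z'; pose R x := f x y z' + f x y' z.
have E x' : L x + R x' = L x' + R x.
  by have := f3 x x' y y' z z'; rewrite /L /R; lia.
have S : \sum_x L x = \sum_x R x by rewrite /L /R !big_split; apply: f2.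
rewrite -/(L x) -/(R x); clearbody L R.
have : \sum_x' (L x + R x') = \sum_x' (L x' + R x) by apply: eq_bigr.
rewrite !big_split /=.
have -> : \sum_(x' < m) L x = m * L x by exact: sum_const_ord.
have -> : \sum_(x' < m) R x = m * R x by exact: sum_const_ord.
have m_gt0 : 0 < m by have := ltn_ord x; lia.
rewrite -S addnC => /addnI/eqP; rewrite eqn_mul2l => /orP[|/eqP//]; lia.
Qed.

Lemma rect3_slice0 m n k (f : 'I_m -> 'I_n -> 'I_k -> nat) x0 : rect3 f ->
  (forall y z, f x0 y z = 0) -> forall x, rect2 (f x).
Proof.
by move=> f3 f0 x y y' z z'; have := f3 x x0 y y' z z'; rewrite !f0; lia.
Qed.

(** * Sets as grids, and their marginals *)

Section Grid.
Variables p q r : nat.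

Definition grid := 'I_p -> 'I_p -> 'I_q -> 'I_r -> bool.

Implicit Types a b : grid.

Definition fxyz a x y z := \sum_t a x t y z.
Definition ftz a x t z := \sum_y a x t y z.
Definition fty a x t y := \sum_z a x t y z.
Definition fxz a x z := \sum_t ftz a x t z.
Definition fxy a x y := \sum_t fty a x t y.
Definition fyz a y z := \sum_x fxyz a x y z.
Definition ft a x t := \sum_y fty a x t y.
Definition fx a x := \sum_t ft a x t.
Definition fy a y := \sum_z fyz a y z.
Definition fz a z := \sum_y fyz a y z.
Definition size_grid a := \sum_x fx a x.

(** [V_d a] is the cuboid form of: the characters of order d sum to 0 on a. *)
Definition Vp a := forall x x', fx a x = fx a x'.
Definition Vp2 a := forall x t t', ft a x t = ft a x t'.
Definition Vq a := forall y y', fy a y = fy a y'.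
Definition Vr a := forall z z', fz a z = fz a z'.
Definition Vpq a := rect2 (fxy a).
Definition Vpr a := rect2 (fxz a).
Definition Vqr a := rect2 (fyz a).
Definition Vp2q a := forall x, rect2 (fty a x).
Definition Vp2r a := forall x, rect2 (ftz a x).
Definition Vpqr a := rect3 (fxyz a).
Definition Vp2qr a := forall x, rect3 (a x : 'I_p -> 'I_q -> 'I_r -> nat).

(** [N_d a]: no two points of a differ by an element of order d. *)
Definition Np a := forall x t t' y z,
  a x t y z -> a x t' y z -> t = t'.
Definition Np2 a := forall x x' t t' y z,
  a x t y z -> a x' t' y z -> x = x'.
Definition Nq a := forall x t y y' z, a x t y z -> a x t y' z -> y = y'.
Definition Nr a := forall x t y z z', a x t y z -> a x t y z' -> z = z'.
Definition Npq a := forall x t t' y y' z,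
  a x t y z -> a x t' y' z -> t = t' \/ y = y'.
Definition Npr a := forall x t t' y z z',
  a x t y z -> a x t' y z' -> t = t' \/ z = z'.
Definition Nqr a := forall x t y y' z z',
  a x t y z -> a x t y' z' -> y = y' \/ z = z'.
Definition Np2q a := forall x x' t t' y y' z,
  a x t y z -> a x' t' y' z -> x = x' \/ y = y'.
Definition Np2r a := forall x x' t t' y z z',
  a x t y z -> a x' t' y z' -> x = x' \/ z = z'.
Definition Npqr a := forall x t t' y y' z z',
  a x t y z -> a x t' y' z' -> [\/ t = t', y = y' | z = z'].
Definition Np2qr a := forall x x' t t' y y' z z',
  a x t y z -> a x' t' y' z' -> [\/ x = x', y = y' | z = z'].

(** The base-p digits are exchanged between the two sides: a character of order p reads only x,
    while a difference of order p changes only t. *)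
Record dual a b : Prop := Dual {
  dual_p : Vp b \/ Np a;
  dual_p2 : Vp2 b \/ Np2 a;
  dual_q : Vq b \/ Nq a;
  dual_r : Vr b \/ Nr a;
  dual_pq : Vpq b \/ Npq a;
  dual_pr : Vpr b \/ Npr a;
  dual_qr : Vqr b \/ Nqr a;
  dual_p2q : Vp2q b \/ Np2q a;
  dual_p2r : Vp2r b \/ Np2r a;
  dual_pqr : Vpqr b \/ Npqr a;
  dual_p2qr : Vp2qr b \/ Np2qr a }.

(** The complement T of a standard tiling has all (c_i = true) or a single
    (c_i = false) value of each of the coordinates x, t, y, z; [same_p] holds
    when the p-part of a difference has the order of that of a difference of
    two elements of T. *)
Definition same_p (c1 c2 : bool) (x x' t t' : 'I_p) :=
  match c1, c2 with
  | true, true => true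
  | true, false => (x != x') || (t == t')
  | false, true => x == x'
  | false, false => (x == x') && (t == t')
  end.

(** The test goes by orders of differences, which is stronger than asking that differences of [a]
    and of T have only 0 in common, but is the form in which the N conditions deliver it. *)
Definition std_tile a := exists c1 c2 c3 c4 : bool,
  size_grid a * (p ^ (c1 + c2) * q ^ c3 * r ^ c4) = p ^ 2 * q * r /\
  forall x x' t t' y y' z z', a x t y z -> a x' t' y' z' ->
    same_p c1 c2 x x' t t' -> c3 || (y == y') -> c4 || (z == z') ->
    [/\ x = x', t = t', y = y' & z = z'].

Section Basics.
Variable a : grid.

Lemma ftE x t : ft a x t = \sum_z ftz a x t z.
Proof. by rewrite /ft /fty exchange_big. Qed.

Lemma fxzE x z : fxz a x z = \sum_y fxyz a x y z.
Proof. by rewrite /fxz /ftz exchange_big. Qed.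

Lemma fxyE x y : fxy a x y = \sum_z fxyz a x y z.
Proof. by rewrite /fxy /fty exchange_big. Qed.

Lemma fx_xz x : fx a x = \sum_z fxz a x z.
Proof. by rewrite /fxz exchange_big; apply: eq_bigr => t _; rewrite ftE. Qed.

Lemma fx_xy x : fx a x = \sum_y fxy a x y.
Proof. by rewrite /fx /ft exchange_big. Qed.

Lemma fx_xyz x : fx a x = \sum_y \sum_z fxyz a x y z.
Proof. by rewrite fx_xy; under eq_bigr do rewrite fxyE. Qed.

Lemma fz_xz z : fz a z = \sum_x fxz a x z.
Proof.
by rewrite /fz /fyz exchange_big; apply: eq_bigr => x _; rewrite fxzE.
Qed.

Lemma fy_xy y : fy a y = \sum_x fxy a x y.
Proof.
by rewrite /fy /fyz exchange_big; apply: eq_bigr => x _; rewrite fxyE.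
Qed.

Lemma size_xz : size_grid a = \sum_x \sum_z fxz a x z.
Proof. by apply: eq_bigr => x _; rewrite fx_xz. Qed.

Lemma size_xy : size_grid a = \sum_x \sum_y fxy a x y.
Proof. by apply: eq_bigr => x _; rewrite fx_xy. Qed.

Lemma size_y : size_grid a = \sum_y fy a y.
Proof.
by rewrite size_xy exchange_big /=; apply: eq_bigr => y _; rewrite fy_xy.
Qed.

Lemma size_yz : size_grid a = \sum_y \sum_z fyz a y z.
Proof. exact: size_y. Qed.

Lemma size_z : size_grid a = \sum_z fz a z.
Proof. by rewrite size_yz exchange_big. Qed.

Lemma fxyz_gt0P x y z : reflect (exists t, a x t y z) (0 < fxyz a x y z).
Proof.
apply: (iffP (sum_gt0P _)) => -[t]; first by case E: (a x t y z) => // _;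
  exists t.
by exists t; rewrite p0.
Qed.

Lemma ftz_gt0P x t z : reflect (exists y, a x t y z) (0 < ftz a x t z).
Proof.
apply: (iffP (sum_gt0P _)) => -[y]; first by case E: (a x t y z) => // _;
  exists y.
by exists y; rewrite p0.
Qed.

Lemma fty_gt0P x t y : reflect (exists z, a x t y z) (0 < fty a x t y).
Proof.
apply: (iffP (sum_gt0P _)) => -[z]; first by case E: (a x t y z) => // _;
  exists z.
by exists z; rewrite p0.
Qed.

Lemma fxz_gt0P x z : reflect (exists t y, a x t y z) (0 < fxz a x z).
Proof.
apply: (iffP (sum_gt0P _)) => -[t]; first by move/ftz_gt0P; exists t.
by move/ftz_gt0P; exists t.
Qed.

Lemma fxy_gt0P x y : reflect (exists t z, a x t y z) (0 < fxy a x y).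
Proof.
apply: (iffP (sum_gt0P _)) => -[t]; first by move/fty_gt0P; exists t.
by move/fty_gt0P; exists t.
Qed.

Lemma fyz_gt0P y z : reflect (exists x t, a x t y z) (0 < fyz a y z).
Proof.
apply: (iffP (sum_gt0P _)) => -[x]; first by move/fxyz_gt0P; exists x.
by move/fxyz_gt0P; exists x.
Qed.

Lemma ft_gt0P x t : reflect (exists y z, a x t y z) (0 < ft a x t).
Proof.
apply: (iffP (sum_gt0P _)) => -[y]; first by move/fty_gt0P; exists y.
by move/fty_gt0P; exists y.
Qed.

Lemma fx_gt0P x : reflect (exists t y z, a x t y z) (0 < fx a x).
Proof.
apply: (iffP (sum_gt0P _)) => -[t]; first by move/ft_gt0P; exists t.
by move/ft_gt0P; exists t.
Qed.

Lemma size_gt0P : reflect (exists x t y z, a x t y z) (0 < size_grid a).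
Proof.
apply: (iffP (sum_gt0P _)) => -[x]; first by move/fx_gt0P; exists x.
by move/fx_gt0P; exists x.
Qed.

Lemma size_leq (K : finType) (g : 'I_p -> 'I_p -> 'I_q -> 'I_r -> K) :
  (forall x x' t t' y y' z z', a x t y z -> a x' t' y' z' ->
     g x t y z = g x' t' y' z' -> [/\ x = x', t = t', y = y' & z = z']) ->
  size_grid a <= #|K|.
Proof.
move=> inj; rewrite /size_grid /fx /ft /fty !pair_bigA /=.
pose h (u : 'I_p * 'I_p * 'I_q * 'I_r) := g u.1.1.1 u.1.1.2 u.1.2 u.2.
apply: (sum_bool_leq (g := h)) => -[[[x t] y] z] [[[x' t'] y'] z'] /= au au' e.
by have [-> -> -> ->] := inj _ _ _ _ _ _ _ _ au au' e.
Qed.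

Lemma fx_leq x (K : finType) (g : 'I_p -> 'I_q -> 'I_r -> K) :
  (forall t t' y y' z z', a x t y z -> a x t' y' z' ->
     g t y z = g t' y' z' -> [/\ t = t', y = y' & z = z']) ->
  fx a x <= #|K|.
Proof.
move=> inj; rewrite /fx /ft /fty !pair_bigA /=.
pose h (u : 'I_p * 'I_q * 'I_r) := g u.1.1 u.1.2 u.2.
apply: (sum_bool_leq (g := h)) => -[[t y] z] [[t' y'] z'] /= au au' e.
by have [-> -> ->] := inj _ _ _ _ _ _ au au' e.
Qed.

Lemma ft_leq x t (K : finType) (g : 'I_q -> 'I_r -> K) :
  (forall y y' z z', a x t y z -> a x t y' z' ->
     g y z = g y' z' -> y = y' /\ z = z') ->
  ft a x t <= #|K|.
Proof.
move=> inj; rewrite /ft /fty !pair_bigA /=.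
apply: (sum_bool_leq (g := fun u => g u.1 u.2)) => -[y z] [y' z'] /= au au' e.
by have [-> ->] := inj _ _ _ _ au au' e.
Qed.

Lemma fty_leq1 x t y : Nr a -> fty a x t y <= 1.
Proof. by move=> nr; apply: sum_bool_leq1 => z z'; apply: nr. Qed.

Lemma ft_leq_q x t : Nr a -> ft a x t <= q.
Proof. by move=> nr; rewrite -[q]muln1; apply: sum_leq_ord => y;
  apply: fty_leq1. Qed.

Lemma Vp_size x : Vp a -> size_grid a = p * fx a x.
Proof. by move=> v; apply: sum_const_ord => x'; apply: v. Qed.

Lemma Vp2_fx x t : Vp2 a -> fx a x = p * ft a x t.
Proof. by move=> v; apply: sum_const_ord => t'; apply: v. Qed.

Lemma Vq_size y : Vq a -> size_grid a = q * fy a y.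
Proof. by move=> v; rewrite size_y; apply: sum_const_ord => y'; apply: v. Qed.

Lemma Vr_size z : Vr a -> size_grid a = r * fz a z.
Proof. by move=> v; rewrite size_z; apply: sum_const_ord => z'; apply: v. Qed.

End Basics.
End Grid.

(** * Symmetry exchanging q and r *)

Definition swap_grid p q r (a : grid p q r) : grid p r q :=
  fun x t z y => a x t y z.

Section Swap.
Variables (p q r : nat).

Lemma ft_swap (a : grid p q r) x t : ft (swap_grid a) x t = ft a x t.
Proof. by rewrite (ftE a). Qed.

Lemma fx_swap (a : grid p q r) x : fx (swap_grid a) x = fx a x.
Proof. by apply: eq_bigr => t _; rewrite ft_swap. Qed.

Lemma size_swap (a : grid p q r) : size_grid (swap_grid a) = size_grid a.
Proof. by apply: eq_bigr => x _; rewrite fx_swap. Qed.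

Lemma Vp2_swap (a : grid p q r) : Vp2 (swap_grid a) -> Vp2 a.
Proof. by move=> v x t t'; have := v x t t'; rewrite !ft_swap. Qed.

Lemma Vp_swap (a : grid p q r) : Vp (swap_grid a) -> Vp a.
Proof. by move=> v x x'; have := v x x'; rewrite !fx_swap. Qed.

Lemma dual_swap (a b : grid p q r) :
  dual a b -> dual (swap_grid a) (swap_grid b).
Proof.
case=> dp dp2 dq dr dpq dpr dqr dp2q dp2r dpqr dp2qr; split.
- case: dp => H; [left=> x x'; rewrite !fx_swap|right=> x t t' y z]; exact: H.
- case: dp2 => H; [left=> x t t'; rewrite !ft_swap|right=> x x' t t' y z];
    exact: H.
- case: dr => H; [by left|right=> x t y y' z; exact: H].
- case: dq => H; [by left|right=> x t y y' z; exact: H].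
- case: dpr => H; [by left|right=> x t t' y y' z; exact: H].
- case: dpq => H; [by left|right=> x t t' y y' z; exact: H].
- case: dqr => H; [left; exact: rect2_tr|right].
  by move=> x t y y' z z' h h'; case: (H _ _ _ _ _ _ h h'); tauto.
- case: dp2r => H; [by left|right=> x x' t t' y y' z; exact: H].
- case: dp2q => H; [by left|right=> x x' t t' y y' z; exact: H].
- case: dpqr => H; [left|right].
    move=> x x' y y' z z'; have := H x x' z z' y y'.
    by rewrite /fxyz /swap_grid; lia.
  move=> x t t' y y' z z' h h'.
  by case: (H _ _ _ _ _ _ _ h h') => e;
    [constructor 1|constructor 3|constructor 2].
- case: dp2qr => H; [left|right].
    by move=> x t t' y y' z z'; have := H x t t' z z' y y';
      rewrite /swap_grid; lia.
  move=> x x' t t' y y' z z' h h'.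
  by case: (H _ _ _ _ _ _ _ _ h h') => e;
    [constructor 1|constructor 3|constructor 2].
Qed.

Lemma std_tile_swap (a : grid p q r) : std_tile (swap_grid a) -> std_tile a.
Proof.
case=> c1 [c2 [c3 [c4 [E H]]]]; exists c1, c2, c4, c3; split.
  by move: E; rewrite size_swap => E; rewrite mulnAC [RHS]mulnAC -E; lia.
move=> x x' t t' y y' z z' h h' sp sy sz.
by have [] := H x x' t t' z z' y y' h h' sp sz sy.
Qed.

End Swap.

(** * Full lines and empty layers *)

(** Unequal row sums need two rows that differ somewhere; the larger of them exceeds the other by a
    positive constant, hence is positive throughout. *)
Lemma rect2_row_line m n (f : 'I_m -> 'I_n -> nat) : rect2 f ->
  ~ (forall i i', \sum_j f i j = \sum_j f i' j) ->
  exists i, forall j, 0 < f i j.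
Proof.
move=> fR nc; apply: contrapT => nE; apply: nc => i i'.
apply: eq_bigr => j _; apply: contrapT => ne; apply: nE.
exact: rect2_col_gt fR ne.
Qed.

Lemma rect2_col_line m n (f : 'I_m -> 'I_n -> nat) : rect2 f ->
  ~ (forall j j', \sum_i f i j = \sum_i f i j') ->
  exists j, forall i, 0 < f i j.
Proof. by move=> /rect2_tr fR; apply: rect2_row_line. Qed.

Section Tools.
Variables p q r : nat.
Implicit Type a : grid p q r.

Definition missing_x a x0 := forall t y z, a x0 t y z = false.
Definition missing_z a z0 := forall x t y, a x t y z0 = false.

Lemma missing_z_yz a z0 : (forall y, fyz a y z0 = 0) -> missing_z a z0.
Proof.
move=> f0 x t y; apply/negP => h; have : 0 < fyz a y z0 by apply/fyz_gt0P;
  exists x, t.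
by rewrite f0.
Qed.

Lemma missing_z_xz a z0 x : missing_z a z0 -> fxz a x z0 = 0.
Proof. by move=> m; apply/eqP; rewrite -leqn0 leqNgt;
  apply/fxz_gt0P => -[t [y]]; rewrite m. Qed.

Lemma missing_x_xz a x0 z : missing_x a x0 -> fxz a x0 z = 0.
Proof. by move=> m; apply/eqP; rewrite -leqn0 leqNgt;
  apply/fxz_gt0P => -[t [y]]; rewrite m. Qed.

Lemma missing_x_xy a x0 y : missing_x a x0 -> fxy a x0 y = 0.
Proof. by move=> m; apply/eqP; rewrite -leqn0 leqNgt;
  apply/fxy_gt0P => -[t [z]]; rewrite m. Qed.

(** The empty layer is a zero column of u(x) + v(z), which leaves no dependence on x. The same
    device lowers [Vp2r] and [Vqr] below. *)
Lemma missing_z_pr a z0 : missing_z a z0 -> Vpr a ->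
  forall x x' z, fxz a x z = fxz a x' z.
Proof. by move=> mz v; apply: (rect2_col0 v (j0 := z0)) => x;
  apply: missing_z_xz. Qed.

Lemma fxz_const_Vp a : (forall x x' z, fxz a x z = fxz a x' z) -> Vp a.
Proof. by move=> c x x'; rewrite !fx_xz; apply: eq_bigr => z _. Qed.

Lemma missing_z_p2r a z0 : missing_z a z0 -> Vp2r a ->
  forall x t t' z, ftz a x t z = ftz a x t' z.
Proof.
move=> mz v x; apply: (rect2_col0 (v x) (j0 := z0)) => t.
by apply/eqP; rewrite -leqn0 leqNgt; apply/ftz_gt0P => -[y]; rewrite mz.
Qed.

Lemma ftz_const_Vp2 a : (forall x t t' z, ftz a x t z = ftz a x t' z) -> Vp2 a.
Proof. by move=> c x t t'; rewrite !ftE; apply: eq_bigr => z _. Qed.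

Lemma missing_z_qr a z0 : missing_z a z0 -> Vqr a -> Vq a.
Proof.
move=> mz v y y'; apply: eq_bigr => z _.
apply: (rect2_col0 v (j0 := z0)) => {}y.
by apply/eqP; rewrite -leqn0 leqNgt; apply/fyz_gt0P => -[x [t]]; rewrite mz.
Qed.

Lemma missing_x_pr a x0 : missing_x a x0 -> Vpr a -> Vr a.
Proof.
move=> mx v z z'; rewrite !fz_xz; apply: eq_bigr => x _.
by have := v x x0 z z'; rewrite !(missing_x_xz _ mx); lia.
Qed.

Lemma missing_x_pq a x0 : missing_x a x0 -> Vpq a -> Vq a.
Proof.
move=> mx v y y'; rewrite !fy_xy; apply: eq_bigr => x _.
by have := v x x0 y y'; rewrite !(missing_x_xy _ mx); lia.
Qed.

Lemma missing_x_p a x0 : missing_x a x0 -> Vp a -> size_grid a = 0.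
Proof.
move=> mx v; rewrite (Vp_size x0 v) fx_xz big1 ?muln0 // => z _.
exact: missing_x_xz.
Qed.

Lemma missing_x_pqr a x0 : missing_x a x0 -> Vpqr a ->
  forall x, rect2 (fxyz a x).
Proof.
move=> mx v; apply: (rect3_slice0 v (x0 := x0)) => y z.
by apply: big1 => t _; rewrite mx.
Qed.

Lemma Vpr_line_x a :
  Vpr a -> ~ Vp a -> exists x, forall z, exists t y, a x t y z.
Proof.
move=> v nv; have [|x H] := rect2_row_line v.
  by move=> c; apply: nv => x x'; rewrite !fx_xz.
by exists x => z; apply/fxz_gt0P.
Qed.

Lemma Vpr_line_z a :
  Vpr a -> ~ Vr a -> exists z, forall x, exists t y, a x t y z.
Proof.
move=> v nv; have [|z H] := rect2_col_line v.
  by move=> c; apply: nv => z z'; rewrite !fz_xz.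
by exists z => x; apply/fxz_gt0P.
Qed.

Lemma Vqr_line_y a :
  Vqr a -> ~ Vq a -> exists y, forall z, exists x t, a x t y z.
Proof.
move=> v nv; have [//|y H] := rect2_row_line v.
by exists y => z; apply/fyz_gt0P.
Qed.

Lemma Vqr_line_z a :
  Vqr a -> ~ Vr a -> exists z, forall y, exists x t, a x t y z.
Proof.
move=> v nv; have [//|z H] := rect2_col_line v.
by exists z => y; apply/fyz_gt0P.
Qed.

Lemma Vp2r_line_t a : Vp2r a -> ~ Vp2 a ->
  exists x t, forall z, exists y, a x t y z.
Proof.
move=> v nv; apply: contrapT => nE; apply: nv; apply: ftz_const_Vp2 => x t t' z.
apply: contrapT => ne; apply: nE.
by have [t0 H] := rect2_col_gt (v x) ne; exists x, t0 => z'; apply/ftz_gt0P.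
Qed.

(** Two different rows t, t' of a class would make one of them positive at all r values of z,
    against the bound on [ft]. *)
Lemma Vp2r_const a : Vp2r a -> (forall x t, ft a x t < r) ->
  forall x t t' z, ftz a x t z = ftz a x t' z.
Proof.
move=> v small x t t' z; apply: contrapT => ne.
have [t0 H] := rect2_col_gt (v x) ne.
by have := small x t0; rewrite ftE; have := sum_geq_ord H; lia.
Qed.

(** By [Vpr] the excess c of row x over row x' is the same for all z, so the two classes differ in
    size by r c. [Vp2] makes both sizes multiples of p, and p is prime to r. *)
Lemma Vp2_Vpr_dvd a x x' z : prime p -> prime r -> p != r ->
  Vp2 a -> Vpr a -> fxz a x' z <= fxz a x z ->
  p %| fxz a x z - fxz a x' z.
Proof.
move=> pp pr pr_ne v2 v le; set c := _ - _.
have E z' : fxz a x z' = fxz a x' z' + c by have := v x x' z z'; lia.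
have : fx a x = fx a x' + r * c.
  have <- : \sum_(z' < r) c = r * c by exact: sum_const_ord.
  by rewrite !fx_xz -big_split; apply: eq_bigr => z' _; rewrite E.
rewrite (Vp2_fx x x v2) (Vp2_fx x' x v2) => e.
have : p %| p * ft a x' x + r * c by rewrite -e dvdn_mulr.
rewrite dvdn_addr; last exact: dvdn_mulr.
by rewrite Gauss_dvdr // prime_coprime // dvdn_prime2.
Qed.

(** Rows that differ do so by a positive multiple of p, so the larger one has all entries at least
    p. Its class has at least p r points, spread evenly over the p digits t. *)
Lemma Vp2_Vpr_large a : prime p -> prime r -> p != r ->
  Vp2 a -> Vpr a -> ~ Vp a ->
  exists x, (forall z, p <= fxz a x z) /\ (forall t, r <= ft a x t).
Proof.
move=> pp pr pr_ne v2 v nv; apply: contrapT => nE; apply: nv => x0 x0'.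
apply: fxz_const_Vp => {x0 x0'} x x' z.
wlog lt : x x' / fxz a x' z < fxz a x z.
  by move=> W; case: (ltngtP (fxz a x' z) (fxz a x z)) => // [/W|/W ->//].
case: nE; exists x.
have dv := Vp2_Vpr_dvd pp pr pr_ne v2 v (ltnW lt).
have c_p : p <= fxz a x z - fxz a x' z by apply: dvdn_leq => //; lia.
have H z' : p <= fxz a x z' by have := v x x' z z'; lia.
split=> // t; have := sum_geq_ord H; rewrite -fx_xz (Vp2_fx x t v2) mulnC.
by rewrite leq_pmul2l // prime_gt0.
Qed.

Lemma Vp2_Vpr_Vp a : prime p -> prime r -> p != r ->
  Vp2 a -> Vpr a -> (forall x t, ft a x t < r) -> Vp a.
Proof.
move=> pp pr pr_ne v2 v small; apply: contrapT => nv.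
have [x [_ H]] := Vp2_Vpr_large pp pr pr_ne v2 v nv.
by have := H x; have := small x x; lia.
Qed.

End Tools.

Lemma ord_other n (i : 'I_n) : 1 < n -> exists j : 'I_n, j <> i.
Proof.
move=> n_gt1; have n_gt0 : 0 < n by lia.
case: (posnP i) => i0; [exists (Ordinal n_gt1)|exists (Ordinal n_gt0)].
  by move/(congr1 val) => /=; lia.
by move/(congr1 val) => /=; lia.
Qed.

Lemma sum_lt_ord n (F : 'I_n -> nat) : \sum_i F i < n -> exists i, F i = 0.
Proof.
move=> lt; apply: contrapT => nE.
have F1 i : 1 <= F i by rewrite lt0n; apply/eqP => Fi; apply: nE; exists i.
by have := sum_geq_ord F1; lia.
Qed.

Lemma sum_leq1_inj (I : finType) (F : I -> nat) i j :
  \sum_k F k <= 1 -> 0 < F i -> 0 < F j -> i = j.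
Proof.
move=> le Fi Fj; apply/eqP/negP => /negP ne; move: le.
by rewrite (bigD1 i) //= (bigD1 j) 1?eq_sym //=; lia.
Qed.

Lemma sum_eq_ord n (F : 'I_n -> nat) c :
  \sum_i F i = n * c -> (forall i, F i <= c) -> forall i, F i = c.
Proof.
move=> E le i; apply/eqP; rewrite eqn_leq le /= leqNgt; apply/negP => lt.
have : \sum_i F i < \sum_(i < n) c.
  rewrite (bigD1 i) //= [ltnRHS](bigD1 i) //= -addSn leq_add //.
  by apply: leq_sum => j _; apply: le.
by have -> : \sum_(i < n) c = n * c by [exact: sum_const_ord]; rewrite E ltnn.
Qed.

Lemma dvdn_eq d m : 0 < m -> m <= d -> d %| m -> m = d.
Proof. by move=> m_gt0 le dv; apply/eqP; rewrite eqn_leq le dvdn_leq. Qed.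


Lemma rect2_rows_eq m n (f : 'I_m -> 'I_n -> nat) i i' : 0 < n -> rect2 f ->
  \sum_j f i j = \sum_j f i' j -> forall j, f i j = f i' j.
Proof.
move=> n_gt0 fR e j.
have : n * f i j + \sum_k f i' k = n * f i' j + \sum_k f i k.
  have C (c : nat) : n * c = \sum_(k < n) c by rewrite (sum_const_ord (c := c)).
  by rewrite !C -!big_split; apply: eq_bigr => k _; have := fR i i' j k;
    rewrite /=; lia.
by rewrite e => /addIn/eqP; rewrite eqn_mul2l => /orP[|/eqP//]; lia.
Qed.

(** In p = r S + p E, with S the sum of the minimal column, p divides S; since r > 1, S >= p is too
    large, so the minimal column is zero. *)
Lemma Vpr_Vp_small p q r (a : grid p q r) : prime p -> prime r -> p != r ->
  size_grid a = p -> Vpr a -> Vp a.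
Proof.
move=> p_pr r_pr pr E v.
have [z0 M] := rect2_min v (Ordinal (prime_gt0 r_pr)).
pose i0 := Ordinal (prime_gt0 p_pr).
have := rect2_sum v i0 M; rewrite -size_xz E => ES.
have p_S : p %| \sum_x fxz a x z0.
  have : p %| r * \sum_x fxz a x z0.
    by rewrite -(dvdn_addl (n :=
      p * \sum_z (fxz a i0 z - fxz a i0 z0))) -?ES ?dvdn_mulr.
  by rewrite Gauss_dvdr // prime_coprime // dvdn_prime2.
have S0 : \sum_x fxz a x z0 = 0.
  apply/eqP; rewrite -leqn0 leqNgt; apply/negP => S_gt0.
  have : p <= \sum_x fxz a x z0 by apply: dvdn_leq.
  by have := prime_gt1 p_pr; have := prime_gt1 r_pr; nia.
apply: fxz_const_Vp; apply: (rect2_col0 v (j0 := z0)) => x.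
by apply/eqP; rewrite -leqn0 -S0 (leq_sum_term (fun x => fxz a x z0)).
Qed.



(** * From vanishing marginals to tilings *)

Section Facts.
Variables p q r : nat.
Hypotheses (p_pr : prime p) (q_pr : prime q) (r_pr : prime r).
Hypotheses (pq : p != q) (pr : p != r) (qr : q != r).
Implicit Types a b : grid p q r.

Let p_gt1 : 1 < p. Proof. exact: prime_gt1. Qed.
Let q_gt1 : 1 < q. Proof. exact: prime_gt1. Qed.
Let r_gt1 : 1 < r. Proof. exact: prime_gt1. Qed.
Let i0 : 'I_p := Ordinal (prime_gt0 p_pr).
Let j0 : 'I_q := Ordinal (prime_gt0 q_pr).
Let k0 : 'I_r := Ordinal (prime_gt0 r_pr).

Lemma Vp_dvd a : Vp a -> p %| size_grid a.
Proof. by move=> v; rewrite (Vp_size i0 v) dvdn_mulr. Qed.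

Lemma Vp2_dvd a : Vp2 a -> p %| size_grid a.
Proof. by move=> v; apply: dvdn_sum => x _;
  rewrite (Vp2_fx x i0 v) dvdn_mulr. Qed.

Lemma Vp_Vp2_size a x t : Vp a -> Vp2 a -> size_grid a = p ^ 2 * ft a x t.
Proof. by move=> v v2; rewrite (Vp_size x v) (Vp2_fx x t v2) mulnA. Qed.

Lemma Vp_Vp2_dvd a : Vp a -> Vp2 a -> p ^ 2 %| size_grid a.
Proof. by move=> v v2; rewrite (Vp_Vp2_size i0 i0 v v2) dvdn_mulr. Qed.

Lemma Vq_dvd a : Vq a -> q %| size_grid a.
Proof. by move=> v; rewrite (Vq_size j0 v) dvdn_mulr. Qed.

Lemma Vr_dvd a : Vr a -> r %| size_grid a.
Proof. by move=> v; rewrite (Vr_size k0 v) dvdn_mulr. Qed.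

Lemma not_Vp a : ~~ (p %| size_grid a) -> ~ Vp a.
Proof. by move=> /negP nd v; apply/nd/Vp_dvd. Qed.

Lemma not_Vp2 a : ~~ (p %| size_grid a) -> ~ Vp2 a.
Proof. by move=> /negP nd v; apply/nd/Vp2_dvd. Qed.

Lemma not_Vq a : ~~ (q %| size_grid a) -> ~ Vq a.
Proof. by move=> /negP nd v; apply/nd/Vq_dvd. Qed.

Lemma not_Vr a : ~~ (r %| size_grid a) -> ~ Vr a.
Proof. by move=> /negP nd v; apply/nd/Vr_dvd. Qed.

Lemma dual_Np a b : dual a b -> ~~ (p %| size_grid b) -> Np a.
Proof. by move=> d n; case: (dual_p d) => // v; case: (not_Vp n v). Qed.

Lemma dual_Np2 a b : dual a b -> ~~ (p %| size_grid b) -> Np2 a.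
Proof. by move=> d n; case: (dual_p2 d) => // v; case: (not_Vp2 n v). Qed.

Lemma dual_Nq a b : dual a b -> ~~ (q %| size_grid b) -> Nq a.
Proof. by move=> d n; case: (dual_q d) => // v; case: (not_Vq n v). Qed.

Lemma dual_Nr a b : dual a b -> ~~ (r %| size_grid b) -> Nr a.
Proof. by move=> d n; case: (dual_r d) => // v; case: (not_Vr n v). Qed.

(** The five orders are exactly those of the nonzero differences with equal y. *)
Lemma N_inj_y a : Np a -> Np2 a -> Nr a -> Npr a -> Np2r a ->
  forall x x' t t' y z z', a x t y z -> a x' t' y z' ->
  [/\ x = x', t = t' & z = z'].
Proof.
move=> np np2 nr npr np2r x x' t t' y z z' h h'.
have ex : x = x' by case: (np2r _ _ _ _ _ _ _ h h') => // e; subst z';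
  exact: np2 h h'.
subst x'; have et : t = t' by case: (npr _ _ _ _ _ _ h h') => // e; subst z';
  exact: np h h'.
by subst t'; split=> //; exact: nr h h'.
Qed.

Lemma N_inj_z a : Np a -> Np2 a -> Nq a -> Npq a -> Np2q a ->
  forall x x' t t' y y' z, a x t y z -> a x' t' y' z ->
  [/\ x = x', t = t' & y = y'].
Proof.
move=> np np2 nq npq np2q x x' t t' y y' z h h'.
have ex : x = x' by case: (np2q _ _ _ _ _ _ _ h h') => // e; subst y';
  exact: np2 h h'.
subst x'; have et : t = t' by case: (npq _ _ _ _ _ _ h h') => // e; subst y';
  exact: np h h'.
by subst t'; split=> //; exact: nq h h'.
Qed.

(** A box with two faces in the empty layers keeps two terms only, so [fxyz] does not depend on
    x. *)
Lemma Vpqr_missing_yz a y0 z0 : Vpqr a ->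
  (forall x t z, a x t y0 z = false) -> missing_z a z0 -> Vp a.
Proof.
move=> v my mz x x'; rewrite !fx_xyz.
apply: eq_bigr => y _; apply: eq_bigr => z _.
have fz0 x1 y1 : fxyz a x1 y1 z0 = 0 by apply: big1 => t _; rewrite mz.
have fy0 x1 z1 : fxyz a x1 y0 z1 = 0 by apply: big1 => t _; rewrite my.
by have := v x x' y y0 z z0; rewrite !fz0 !fy0; lia.
Qed.

Lemma Vp2qr_missing_yz a y0 z0 : Vp2qr a ->
  (forall x t z, a x t y0 z = false) -> missing_z a z0 ->
  forall x t t' y z, a x t y z = a x t' y z.
Proof.
move=> v my mz x t t' y z; have := v x t t' y y0 z z0; rewrite !my !mz.
by case: (a x t y z); case: (a x t' y z).
Qed.

(** * Size prime to p, q and r *)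

(** The size turns out to be 1: every order is excluded as a difference. Most exclusions of
    composite orders rest on earlier ones, so their sequence matters; the first one uses q < r. *)
Lemma case_none_lt a b : q < r -> dual a b -> dual b a ->
  size_grid a = size_grid b -> 0 < size_grid a ->
  ~~ (p %| size_grid a) -> ~~ (q %| size_grid a) -> ~~ (r %| size_grid a) ->
  std_tile a.
Proof.
move=> lt_qr dab dba eab m_gt0 p_n q_n r_n.
have p_n' := p_n; have q_n' := q_n; have r_n' := r_n.
rewrite eab in p_n' q_n' r_n'.
pose good (u : grid p q r) :=
  [/\ Np u, Np2 u, Nq u & Nr u] /\ [/\ ~ Vp u, ~ Vp2 u, ~ Vq u & ~ Vr u].
have ga : good a.
  split; last by split;
    [apply: not_Vp|apply: not_Vp2|apply: not_Vq|apply: not_Vr].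
  by split;
    [apply: dual_Np dab _|apply: dual_Np2 dab _|apply: dual_Nq dab _|apply:
      dual_Nr dab _].
have gb : good b.
  split; last by split;
    [apply: not_Vp|apply: not_Vp2|apply: not_Vq|apply: not_Vr].
  by split;
    [apply: dual_Np dba _|apply: dual_Np2 dba _|apply: dual_Nq dba _|apply:
      dual_Nr dba _].
(* A full line in z inside one fibre (x, t) has distinct y by [Nr], which would give r <= q. *)
have s1 u : good u -> ~ Vp2r u.
  move=> [[_ _ _ nr] [_ nv2 _ _]] v.
  have [x [t H]] := Vp2r_line_t v nv2.
  have := leq_of_relation H (fun z z' y => nr x t y z z').
  by rewrite leqNgt lt_qr.
have [p2ra p2rb] : Np2r a /\ Np2r b.
  by split; [case: (dual_p2r dab)|case: (dual_p2r dba)] => // /s1; case.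
have s2 u : good u -> Np2r u -> ~ Vpq u.
  move=> [[_ np2 _ _] [_ _ nvq _]] p2r v.
  have [y H] := @Vpr_line_z p r q (swap_grid u) v nvq.
  have [x ne] := ord_other i0 p_gt1.
  have [t [z h]] := H x; have [t' [z' h']] := H i0.
  case: (p2r _ _ _ _ _ _ _ h h') => // e; subst z'.
  exact: ne (np2 _ _ _ _ _ _ h h').
have [npqa npqb] : Npq a /\ Npq b.
  by split;
    [case: (dual_pq dab) => // /(s2 _ gb)|case: (dual_pq dba) =>
      // /(s2 _ ga)]; case.
(* The two grids interact here: a full line in y gives q <= p, while two points of a full line in z
   force [Vpr] on the dual grid, whose full line in x gives p <= q. *)
have s3 u v : good u -> good v -> dual u v -> Np2r u -> Npq u -> ~ Vqr u.
  move=> [[_ _ nq nr] [_ _ nvq nvr]] [[_ np2 _ _] [_ _ _ nvr']] duv p2r npq w.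
  have [z H] := Vqr_line_z w nvr.
  have le_qp := leq_of_relation H (fun y y' x => _).
  have {}le_qp : q <= p.
    apply: le_qp => y y' x [t h] [t' h'].
    case: (npq _ _ _ _ _ _ h h') => // e; subst t'; exact: nq h h'.
  have [y L] := Vqr_line_y w nvq.
  have [z1 ne] := ord_other k0 r_gt1.
  have [x [t h]] := L z1; have [x' [t' h']] := L k0.
  case: (p2r _ _ _ _ _ _ _ h h') => // e; subst x'.
  case: (dual_pr duv) => [vpr|npr]; last first.
    by case: (npr _ _ _ _ _ _ h h') => // e; subst t';
      apply/ne/(nr _ _ _ _ _ h h').
  have [z' L'] := Vpr_line_z vpr nvr'.
  have : p <= q.
    apply: (leq_of_relation (P := fun x y => exists t, v x t y z')).
      by move=> x1; have [t1 [y1 h1]] := L' x1; exists y1, t1.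
    by move=> x1 x2 y1 [t1 h1] [t2 h2]; exact: np2 h1 h2.
  by move: pq; lia.
have [nqra nqrb] : Nqr a /\ Nqr b.
  by split; [case: (dual_qr dab) => // /(s3 _ _ gb ga dba p2rb npqb)
            |case: (dual_qr dba) => // /(s3 _ _ ga gb dab p2ra npqa)]; case.
have s4 u : good u -> Nqr u -> ~ Vp2q u.
  move=> [[_ _ nq _] [_ nv2 _ _]] nqr v.
  have [|x [t H]] := @Vp2r_line_t p r q (swap_grid u) v _.
    by move=> /Vp2_swap.
  have [z h] := H j0.
  have [y ne] := ord_other j0 q_gt1.
  have [z' h'] := H y.
  case: (nqr _ _ _ _ _ _ h h') => e; first by case: ne.
  by subst z'; case: ne; exact: nq h' h.
have [np2qa np2qb] : Np2q a /\ Np2q b.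
  by split;
    [case: (dual_p2q dab) => // /(s4 _ gb)|case: (dual_p2q dba) =>
      // /(s4 _ ga)]; case.
have s5 u : good u -> Np2q u -> ~ Vpr u.
  move=> [[np np2 _ _] [_ _ _ nvr]] np2q v.
  have [z H] := Vpr_line_z v nvr.
  have [x ne] := ord_other i0 p_gt1.
  have [t [y h]] := H x; have [t' [y' h']] := H i0.
  case: (np2q _ _ _ _ _ _ _ h h') => e //; subst y'.
  exact: ne (np2 _ _ _ _ _ _ h h').
have [npra nprb] : Npr a /\ Npr b.
  by split;
    [case: (dual_pr dab) => // /(s5 _ gb)|case: (dual_pr dba) =>
      // /(s5 _ ga)]; case.
have [[npa np2a nq_a nr_a] _] := ga; have [[npb _ _ _] [nvp _ _ _]] := gb.
have inj_y := N_inj_y npa np2a nr_a npra p2ra.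
have inj_z := N_inj_z npa np2a nq_a npqa np2qa.
have le_q : size_grid a <= q.
  rewrite -[leqRHS]card_ord; apply: (size_leq (g := fun x t y z => y)).
  by move=> x x' t t' y y' z z' h h' e; subst y';
    have [-> -> ->] := inj_y _ _ _ _ _ _ _ h h'.
(* Equality would make q divide the size. So some y and, as q < r, some z do not occur in [b]. *)
have lt_q : size_grid a < q.
  by rewrite ltn_neqAle le_q andbT; apply: contraNneq q_n => ->.
have [y0 my] : exists y0, forall x t z, b x t y0 z = false.
  have [|y0 fy0] := @sum_lt_ord _ (fy b); first by rewrite -size_y -eab.
  exists y0 => x t z; apply/negP => h.
  have : 0 < fyz b y0 z by apply/fyz_gt0P; exists x, t.
  by have := leq_sum_term (fyz b y0) z; rewrite -/(fy b y0) fy0; lia.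
have [z0 mz] : exists z0, missing_z b z0.
  have [|z0 fz0] := @sum_lt_ord _ (fz b);
    first by rewrite -size_z -eab (ltn_trans lt_q).
  exists z0; apply: missing_z_yz => y.
  by have := leq_sum_term (fun y => fyz b y z0) y; rewrite -/(fz b z0) fz0; lia.
have nv : ~ Vp2qr b.
  move=> v; have [x [t [y [z h]]]] : exists x t y z, b x t y z.
    by apply/size_gt0P; rewrite -eab.
  have [t' ne] := ord_other t p_gt1.
  have h' := h; rewrite (Vp2qr_missing_yz v my mz x t t') in h'.
  by apply: ne; apply: npb h' h.
have np2qra : Np2qr a by case: (dual_p2qr dab).
have npqra : Npqr a.
  by case: (dual_pqr dab) => // v; case: nvp; apply: Vpqr_missing_yz v my mz.
have one x x' t t' y y' z z' : a x t y z -> a x' t' y' z' ->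
    [/\ x = x', t = t', y = y' & z = z'].
  move=> h h'.
  have Y : y = y' -> [/\ x = x', t = t', y = y' & z = z'].
    by move=> e; subst y'; have [] := inj_y _ _ _ _ _ _ _ h h'.
  have Z : z = z' -> [/\ x = x', t = t', y = y' & z = z'].
    by move=> e; subst z'; have [] := inj_z _ _ _ _ _ _ _ h h'.
  case: (np2qra _ _ _ _ _ _ _ _ h h') => e; [|exact: Y|exact: Z].
  subst x'; case: (npqra _ _ _ _ _ _ _ h h') => e; [|exact: Y|exact: Z].
  by subst t'; case: (nqra _ _ _ _ _ _ h h') => e; [exact: Y|exact: Z].
have : size_grid a <= 1.
  rewrite -[leqRHS]card_unit; apply: (size_leq (g := fun _ _ _ _ => tt)) => *;
    exact: one.
move=> le1; exists true, true, true, true; split; last by move=> *; apply: one.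
by have/eqP-> : size_grid a == 1; [rewrite eqn_leq le1|rewrite mul1n !expn1].
Qed.

(** * Size divisible by q but not by p and r *)

Definition inj_y a := forall x x' t t' y z z', a x t y z -> a x' t' y z' ->
  [/\ x = x', t = t' & z = z'].

Lemma inj_y_size a : inj_y a -> size_grid a <= q.
Proof.
move=> inj; rewrite -[leqRHS]card_ord;
  apply: (size_leq (g := fun x t y z => y)).
move=> x x' t t' y y' z z' h h' e; subst y'.
by have [-> -> ->] := inj _ _ _ _ _ _ _ h h'.
Qed.

Lemma inj_y_tile a :
  inj_y a -> 0 < size_grid a -> q %| size_grid a -> std_tile a.
Proof.
move=> inj a_gt0 dv; have le := inj_y_size inj.
have E : size_grid a = q by apply/eqP; rewrite eqn_leq le dvdn_leq.
exists true, true, false, true; split;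
  first by rewrite E expn0 expn1 muln1 mulnA (mulnC q).
move=> x x' t t' y y' z z' h h' _ /eqP e _; subst y'.
by have [-> -> ->] := inj _ _ _ _ _ _ _ h h'.
Qed.

Lemma Vq_inj_y a : Vq a -> size_grid a = q -> inj_y a.
Proof.
move=> v E x x' t t' y z z' h h'.
have fy1 : fy a y <= 1.
  by move: E; rewrite (Vq_size y v) => E; have := prime_gt0 q_pr; nia.
have fyz_gt0 x1 t1 z1 : a x1 t1 y z1 -> 0 < fyz a y z1.
  by move=> h1; apply/fyz_gt0P; exists x1, t1.
have ez : z = z' by apply: (sum_leq1_inj fy1);
  [exact: fyz_gt0 h|exact: fyz_gt0 h'].
subst z'; have fyz1 : fyz a y z <= 1.
  exact: leq_trans (leq_sum_term (fyz a y) z) fy1.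
have ex : x = x'.
  by apply: (sum_leq1_inj fyz1); apply/fxyz_gt0P; [exists t|exists t'].
subst x'; have fxyz1 : fxyz a x y z <= 1.
  exact: leq_trans (leq_sum_term (fun x => fxyz a x y z) x) fyz1.
by have -> : t = t' by apply: (sum_leq1_inj fxyz1); rewrite ?h ?h'.
Qed.

(** With S the total of one minimal row t0 per class x, the size is p S plus a multiple of q. So q
    divides S, and a size below p q leaves S = 0; a zero row removes the dependence on y. *)
Lemma Vp2q_rows a : Vp2q a -> size_grid a < p * q -> q %| size_grid a ->
  forall x t y y', fty a x t y = fty a x t y'.
Proof.
move=> v lt dv.
have M x : exists t0, forall y t, fty a x t0 y <= fty a x t y.
  exact: (rect2_min (rect2_tr (v x)) i0).
case: (fin_all_exists M) => t0 {}M.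
pose S x := \sum_y fty a x (t0 x) y.
have E x : fx a x = p * S x + q * \sum_t (fty a x t j0 - fty a x (t0 x) j0).
  by rewrite /fx /ft exchange_big; apply: (rect2_sum (rect2_tr (v x)) j0 (M x)).
have ES : size_grid a = p * \sum_x S x +
    q * \sum_x \sum_t (fty a x t j0 - fty a x (t0 x) j0).
  by rewrite !big_distrr -big_split; apply: eq_bigr => x _; apply: E.
have dvS : q %| \sum_x S x.
  move: dv; rewrite ES dvdn_addl; last exact: dvdn_mulr.
  by rewrite Gauss_dvdr // prime_coprime // dvdn_prime2 // eq_sym.
have S0 : \sum_x S x = 0.
  apply/eqP; apply: contraLR lt => nz; rewrite -leqNgt ES.
  have : q <= \sum_x S x by apply: dvdn_leq => //; rewrite lt0n.
  by move=> le; apply: leq_trans (leq_addr _ _); rewrite leq_mul2l le orbT.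
move=> x t y y'; have := v x t (t0 x) y y'.
have Z y1 : fty a x (t0 x) y1 = 0.
  apply/eqP;
    rewrite -leqn0 -S0 (leq_trans (leq_sum_term (fty a x (t0 x)) y1)) //.
  exact: leq_sum_term.
by rewrite !Z; lia.
Qed.

(** The size is r times the minimal column sum plus a multiple of q, so q divides that sum; a
    nonzero one would push the size up to q r. *)
Lemma Vqr_missing_z a : Vqr a -> size_grid a < q * r -> q %| size_grid a ->
  exists z0, missing_z a z0.
Proof.
move=> v lt dv; have [z0 M] := rect2_min v k0; exists z0.
have ES := rect2_sum v j0 M; rewrite -size_yz in ES.
have dvS : q %| \sum_y fyz a y z0.
  move: dv; rewrite ES dvdn_addl; last exact: dvdn_mulr.
  by rewrite Gauss_dvdr // prime_coprime // dvdn_prime2.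
have S0 : \sum_y fyz a y z0 = 0.
  apply/eqP; apply: contraLR lt => nz; rewrite -leqNgt ES.
  have : q <= \sum_y fyz a y z0 by apply: dvdn_leq => //; rewrite lt0n.
  by move=> le; rewrite mulnC; apply: leq_trans (leq_addr _ _);
    rewrite leq_mul2l le orbT.
apply: missing_z_yz => y; apply/eqP.
by rewrite -leqn0 -S0 (leq_sum_term (fun y => fyz a y z0)).
Qed.

(** A full line of [b] in one fibre (x, t) excludes [Nqr b]; hence [Vqr a] and, by size, an empty
    layer of [a]. This layer yields N conditions on [b] that bound the common size by q, and the
    bound returns to [a]. *)
Lemma case_q_aux a b : dual a b -> dual b a ->
  size_grid a = size_grid b -> 0 < size_grid a ->
  ~~ (p %| size_grid a) -> q %| size_grid a -> ~~ (r %| size_grid a) ->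
  Vp2r b -> inj_y a.
Proof.
move=> dab dba eab m_gt0 p_n q_d r_n v.
have [p_n' q_d' r_n'] :
  [/\ ~~ (p %| size_grid b), q %| size_grid b & ~~ (r %| size_grid b)].
  by rewrite -eab.
have [[npa np2a] nra] :=
  (dual_Np dab p_n', dual_Np2 dab p_n', dual_Nr dab r_n').
have [[npb np2b] nrb] := (dual_Np dba p_n, dual_Np2 dba p_n, dual_Nr dba r_n).
have le_qr : size_grid a <= q * r.
  rewrite -[q in q * r]card_ord -[r in _ * r]card_ord -card_prod.
  apply: (size_leq (g := fun x t y z => (y, z))).
  move=> x x' t t' y y' z z' h h' [ey ez]; subst y' z'.
  have ex := np2a _ _ _ _ _ _ h h'; subst x'.
  by have -> := npa _ _ _ _ _ h h'.
have lt_qr : size_grid a < q * r.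
  by rewrite ltn_neqAle le_qr andbT; apply: contraNneq r_n => ->;
    apply: dvdn_mull.
have [x [t H]] := Vp2r_line_t v (not_Vp2 p_n').
have vqr : Vqr a.
  case: (dual_qr dba) => // nqr.
  have [z1 ne] := ord_other k0 r_gt1.
  have [y h] := H z1; have [y' h'] := H k0.
  case: (nqr _ _ _ _ _ _ h h') => // e; subst y'.
  by case: ne; exact: nrb h h'.
have [z0 mz] := Vqr_missing_z vqr lt_qr q_d.
have np2rb : Np2r b.
  case: (dual_p2r dba) => // w; case: (not_Vp2 p_n).
  exact: ftz_const_Vp2 (missing_z_p2r mz w).
have nprb : Npr b.
  case: (dual_pr dba) => // w; case: (not_Vp p_n).
  exact: fxz_const_Vp (missing_z_pr mz w).
apply: Vq_inj_y; first exact: missing_z_qr mz vqr.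
apply/eqP;
  rewrite eqn_leq {1}eab (inj_y_size (N_inj_y npb np2b nrb nprb np2rb)).
exact: dvdn_leq.
Qed.

Lemma case_q a b : dual a b -> dual b a ->
  size_grid a = size_grid b -> 0 < size_grid a ->
  ~~ (p %| size_grid a) -> q %| size_grid a -> ~~ (r %| size_grid a) ->
  std_tile a.
Proof.
move=> dab dba eab m_gt0 p_n q_d r_n.
have m_gt0' : 0 < size_grid b by rewrite -eab.
have [p_n' q_d' r_n'] :
  [/\ ~~ (p %| size_grid b), q %| size_grid b & ~~ (r %| size_grid b)].
  by rewrite -eab.
have [[npa np2a] nra] :=
  (dual_Np dab p_n', dual_Np2 dab p_n', dual_Nr dab r_n').
have [[npb np2b] nrb] := (dual_Np dba p_n, dual_Np2 dba p_n, dual_Nr dba r_n).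
have fin : inj_y a -> std_tile a by move=> inj; apply: inj_y_tile.
case: (dual_p2r dab) => [v|p2ra]; first by apply/fin/(case_q_aux dab dba).
have p2rb : Np2r b.
  case: (dual_p2r dba) => [v|//] x x' t t' y z z' h h'; left.
  by have [] := case_q_aux dba dab (esym eab) m_gt0' p_n' q_d' r_n' v h h'.
case: (dual_pr dab) => [v|npra]; last exact/fin/N_inj_y.
have [z H] := Vpr_line_z v (not_Vr r_n').
have vp2q : Vp2q a.
  case: (dual_p2q dba) => // np2q.
  have [x ne] := ord_other i0 p_gt1.
  have [t [y h]] := H x; have [t' [y' h']] := H i0.
  case: (np2q _ _ _ _ _ _ _ h h') => // e; subst y'.
  by case: ne; exact: np2b h h'.
have same_x x x' t t' y z1 z1' : a x t y z1 -> a x' t' y z1' -> x = x'.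
  move=> h h'; case: (p2ra _ _ _ _ _ _ _ h h') => // e; subst z1'.
  exact: np2a h h'.
have le_pq : size_grid a <= p * q.
  rewrite -[p in p * q]card_ord -[q in _ * q]card_ord -card_prod.
  apply: (size_leq (g := fun x t y z => (t, y))).
  move=> x x' t t' y y' z1 z1' h h' [et ey]; subst t' y'.
  have ex := same_x _ _ _ _ _ _ _ h h'; subst x'.
  by have -> := nra _ _ _ _ _ h h'.
have lt_pq : size_grid a < p * q.
  by rewrite ltn_neqAle le_pq andbT; apply: contraNneq p_n => ->;
    apply: dvdn_mulr.
have rows := Vp2q_rows vp2q lt_pq q_d.
have vq : Vq a.
  by move=> y y'; rewrite !fy_xy; apply: eq_bigr => x _; apply: eq_bigr => t _.
have [x0 [t0 [y0 [z0 h0]]]] : exists x t y z, a x t y z by apply/size_gt0P.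
have [x1 ne] := ord_other x0 p_gt1.
(* The fibre (x0, t0) is constant in y, so it meets every y; as y determines x, no class but x0
   occurs. *)
have mx : missing_x a x1.
  move=> t y z1; apply/negP => h.
  have : 0 < fty a x0 t0 y by rewrite (rows _ _ _ y0); apply/fty_gt0P;
    exists z0.
  by case/fty_gt0P => z2 h2; apply/ne/(same_x _ _ _ _ _ _ _ h h2).
have nprb : Npr b.
  by case: (dual_pr dba) => // w; case: (not_Vr r_n); apply: missing_x_pr mx w.
apply/fin/Vq_inj_y => //.
apply/eqP; rewrite eqn_leq {1}eab (inj_y_size (N_inj_y npb np2b nrb nprb p2rb)).
exact: dvdn_leq.
Qed.

(** * Size divisible by q and r *)

(** [Vp b] and [Vp2 b] together make [a] everything. Otherwise [Np a] or [Np2 a] holds: one base-p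
    digit is determined by the other coordinates, the size is p q r, and T runs through that
    digit. *)
Lemma case_pqr a b : dual a b ->
  size_grid a = size_grid b -> 0 < size_grid a ->
  p %| size_grid a -> q %| size_grid a -> r %| size_grid a -> std_tile a.
Proof.
move=> dab eab m_gt0 p_d q_d r_d.
have qr_d :
  q * r %| size_grid a by rewrite Gauss_dvd ?q_d ?r_d // prime_coprime //
    dvdn_prime2.
have pqr_d : p * (q * r) %| size_grid a.
  rewrite Gauss_dvd ?p_d ?qr_d // coprimeMr !prime_coprime // !dvdn_prime2 //.
  by rewrite pq pr.
have [[vp vp2]|nv] := lem (Vp b /\ Vp2 b).
  have d : p ^ 2 * (q * r) %| size_grid a.
    rewrite Gauss_dvd ?qr_d ?andbT; first by rewrite eab; apply: Vp_Vp2_dvd.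
    by rewrite coprimeXl // coprimeMr !prime_coprime // !dvdn_prime2 // pq pr.
  have E : size_grid a = p ^ 2 * (q * r).
    apply: dvdn_eq => //.
    have -> : p ^ 2 * (q * r) = #|{: ('I_p * 'I_p) * ('I_q * 'I_r)}|.
      by rewrite !card_prod !card_ord mulnn.
    apply: (size_leq (g := fun x t y z => ((x, t), (y, z)))).
    by move=> x x' t t' y y' z z' _ _ [-> -> -> ->].
  exists false, false, false, false; split; first by rewrite E !muln1 mulnA.
  by move=> x x' t t' y y' z z' _ _ /= /andP[/eqP-> /eqP->] /eqP-> /eqP->.
have [np|np2] : Np a \/ Np2 a.
    case: (dual_p dab) => [vp|]; last by left.
    by case: (dual_p2 dab) => [vp2|]; [case: nv|right].
- have inj x t t' y z : a x t y z -> a x t' y z -> t = t' := @np x t t' y z.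
  have E : size_grid a = p * (q * r).
    apply: dvdn_eq => //.
    have -> : p * (q * r) = #|{: 'I_p * ('I_q * 'I_r)}| by rewrite !card_prod
      !card_ord.
    apply: (size_leq (g := fun x t y z => (x, (y, z)))).
    move=> x x' t t' y y' z z' h h' [? ? ?]; subst x' y' z'.
    by have -> := inj _ _ _ _ _ h h'.
  exists false, true, false, false; split.
    by rewrite E !muln1 expn1 mulnA [LHS]mulnC !mulnA.
  move=> x x' t t' y y' z z' h h' /= /eqP ? /eqP ? /eqP ?; subst x' y' z'.
  by have -> := inj _ _ _ _ _ h h'.
have inj x x' t t' y z : a x t y z -> a x' t' y z -> x = x' :=
  @np2 x x' t t' y z.
have E : size_grid a = p * (q * r).
  apply: dvdn_eq => //.
  have -> : p * (q * r) = #|{: 'I_p * ('I_q * 'I_r)}| by rewrite !card_prod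
    !card_ord.
  apply: (size_leq (g := fun x t y z => (t, (y, z)))).
  move=> x x' t t' y y' z z' h h' [? ? ?]; subst t' y' z'.
  by have -> := inj _ _ _ _ _ _ h h'.
exists true, false, false, false; split.
  by rewrite E !muln1 expn1 mulnA [LHS]mulnC !mulnA.
move=> x x' t t' y y' z z' h h' /= s /eqP ? /eqP ?; subst y' z'.
have ex := inj _ _ _ _ _ _ h h'; subst x'.
by move: s; rewrite eqxx => /eqP->.
Qed.

Lemma case_qr a b : dual a b ->
  size_grid a = size_grid b -> 0 < size_grid a ->
  ~~ (p %| size_grid a) -> q %| size_grid a -> r %| size_grid a -> std_tile a.
Proof.
move=> dab eab m_gt0 p_n q_d r_d; have p_n' := p_n; rewrite eab in p_n'.
have [np np2] := (dual_Np dab p_n', dual_Np2 dab p_n').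
have inj x x' t t' y z : a x t y z -> a x' t' y z -> x = x' /\ t = t'.
  move=> h h'; have ex := np2 _ _ _ _ _ _ h h'; subst x'; split=> //.
  exact: np h h'.
have E : size_grid a = q * r.
  apply: dvdn_eq => //;
    last by rewrite Gauss_dvd ?q_d ?r_d // prime_coprime // dvdn_prime2.
  have -> : q * r = #|{: 'I_q * 'I_r}| by rewrite card_prod !card_ord.
  apply: (size_leq (g := fun x t y z => (y, z))).
  move=> x x' t t' y y' z z' h h' [? ?]; subst y' z'.
  by have [-> ->] := inj _ _ _ _ _ _ h h'.
exists true, true, false, false; split; first by rewrite E !muln1 mulnC mulnA.
move=> x x' t t' y y' z z' h h' /= _ /eqP ? /eqP ?; subst y' z'.
by have [-> ->] := inj _ _ _ _ _ _ h h'.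
Qed.

(** On a class x, the difference of the slices t and t' has the form
    u(y) + v(z); its sums over y do not depend on z, so it depends on y only,
    which is impossible for slices having at most one z for each y unless it
    is 0. *)
Lemma Vp2r_Vp2qr_const a : Vp2r a -> Vp2qr a -> Nr a ->
  forall x t t' y z, a x t y z = a x t' y z.
Proof.
move=> v w nr x t t' y z.
have E t1 t2 z' : a x t1 y z + a x t2 y z' = a x t2 y z + a x t1 y z'.
  have S : q * (a x t1 y z + a x t2 y z') + (ftz a x t1 z' + ftz a x t2 z) =
           q * (a x t2 y z + a x t1 y z') + (ftz a x t2 z' + ftz a x t1 z).
    have C (c : nat) : q * c = \sum_(y' < q) c by rewrite (sum_const_ord (c :=
      c)).
    rewrite !C -!big_split; apply: eq_bigr => y' _.
    move: (w x t1 t2 y y' z z') => /=;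
      do 8!move: (nat_of_bool (a _ _ _ _)) => ?; lia.
  have e : ftz a x t1 z' + ftz a x t2 z = ftz a x t2 z' + ftz a x t1 z.
    by rewrite (v x t1 t2 z' z) addnC.
  move: S; rewrite e => /addIn/eqP; rewrite eqn_mul2l => /orP[|/eqP//].
  by have := prime_gt0 q_pr; lia.
have [z' ne] := ord_other z r_gt1.
have := E t t' z'; case h: (a x t y z); case h': (a x t' y z) => //=.
  case k: (a x t y z'); first by case: ne; apply: nr k h.
  by case: (a x t' y z').
case k: (a x t' y z'); first by case: ne; apply: nr k h'.
by case: (a x t y z').
Qed.

(** * Size divisible by p and q but not by r *)

(** Some fibre (x, t) has a full line in z, with distinct y by [Nr]; two of its points differ by an
    element of order q r. With [Vp2qr] the fibres of a class would coincide, giving [Vp2]. *)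
Lemma Vp2r_line_facts a : Vp2r a -> ~ Vp2 a -> Nr a ->
  [/\ r <= q, ~ Nqr a & ~ Vp2qr a].
Proof.
move=> v nv nr; have [x [t H]] := Vp2r_line_t v nv; split.
- exact: leq_of_relation H (fun z z' y => nr x t y z z').
- move=> nqr; have [z ne] := ord_other k0 r_gt1.
  have [y h] := H z; have [y' h'] := H k0.
  case: (nqr _ _ _ _ _ _ h h') => // e; subst y'.
  by case: ne; exact: nr h h'.
- move=> w; apply/nv/ftz_const_Vp2 => x1 t1 t2 z; apply: eq_bigr => y _.
  by rewrite (Vp2r_Vp2qr_const v w nr x1 t1 t2).
Qed.

(** The class given by [Vp2_Vpr_large] has at least r points in each fibre, against at most q by
    [Nr]. It also meets every z, and under [Nqr] distinct z need distinct t. *)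
Lemma Vp2_Vpr_leq a : Vp2 a -> Vpr a -> ~ Vp a -> Nr a ->
  r <= q /\ (Nqr a -> r <= p).
Proof.
move=> v2 v nv nr; have [x [H1 H2]] := Vp2_Vpr_large p_pr r_pr pr v2 v nv;
  split.
  exact: leq_trans (H2 i0) (ft_leq_q _ _ nr).
move=> nqr; apply: (leq_of_relation (P := fun z t => exists y, a x t y z)).
  by move=> z; apply/fxz_gt0P; apply: leq_trans (H1 z); apply: prime_gt0.
move=> z z' t [y h] [y' h']; case: (nqr _ _ _ _ _ _ h h') => // e; subst y'.
exact: nr h h'.
Qed.

Lemma fyz_leq_Np2 a y z : Np2 a -> fyz a y z <= p.
Proof.
move=> np2; rewrite /fyz /fxyz pair_bigA -[leqRHS]card_ord.
apply: (sum_bool_leq (g := snd)) => -[x t] [x' t'] /= h h' e; subst t'.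
by rewrite (np2 _ _ _ _ _ _ h h').
Qed.

Lemma fyz_leq_Np a y z : Np a -> fyz a y z <= p.
Proof.
move=> np; rewrite /fyz /fxyz pair_bigA -[leqRHS]card_ord.
apply: (sum_bool_leq (g := fst)) => -[x t] [x' t'] /= h h' e; subst x'.
by rewrite (np _ _ _ _ _ h h').
Qed.

Lemma ord_other2 n (i i' : 'I_n) : 2 < n -> exists j : 'I_n, j <> i /\ j <> i'.
Proof.
move=> n_gt2; apply: contrapT => nE.
have : #|[set: 'I_n]| <= #|[set i; i']|.
  apply: subset_leq_card; apply/subsetP => j _; rewrite !inE; apply/orP.
  have [|ne] := eqVneq j i; [by left|right; apply/eqP; apply: contrapT => ne'].
  by apply: nE; exists j; split=> //; apply/eqP.
by rewrite cardsT card_ord cards2; case: (_ != _); lia.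
Qed.

(** Without differences of order p^2 q r, every point with y <> y1 is forced
    to have z = z2, so that |a| = q v + r u with u + v <= p. *)
Lemma Np2qr_single_pair a x1 x2 t1 t2 y1 z1 z2 :
  Np2 a -> Np2qr a -> Vqr a -> r < q -> p * q <= size_grid a ->
  (forall y, exists x t, a x t y z2) -> a x1 t1 y1 z1 -> a x2 t2 y1 z2 ->
  x1 <> x2 -> z1 <> z2 -> False.
Proof.
move=> np2 np2qr v lt_rq le H h1 h2 nex nez.
(* This provides a third value of y, where the point with z = z2 has x = x1 and so excludes points
   with x = x2, z = z1 elsewhere. *)
have q_gt2 : 2 < q by lia.
have F x t y z : a x t y z -> y <> y1 -> x = x1 /\ z = z2 \/ x = x2 /\ z = z1.
  move=> h ne; have [e1|//|e1] := np2qr _ _ _ _ _ _ _ _ h h1;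
    have [e2|//|e2] := np2qr _ _ _ _ _ _ _ _ h h2; auto.
    by case: nex; rewrite -e1.
  by case: nez; rewrite -e1.
have only_z2 x t y z : a x t y z -> y <> y1 -> z = z2.
  move=> h ne; case: (F _ _ _ _ h ne) => -[ex ez] //; subst x z.
  have [y3 [ne1 ne3]] := ord_other2 y1 y q_gt2.
  have [x [t3 h3]] := H y3.
  case: (F _ _ _ _ h3 ne1) => -[ex ez]; last by case: nez.
  subst x; case: (np2qr _ _ _ _ _ _ _ _ h3 h) => e; first by case: nex.
    by case: ne3.
  by case: nez.
have f0 y z : y <> y1 -> z <> z2 -> fyz a y z = 0.
  move=> ney nez'; apply/eqP; rewrite -leqn0 leqNgt;
    apply/fyz_gt0P => -[x [t h]].
  by apply: nez'; apply: only_z2 h ney.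
have [y2 ne2] := ord_other y1 q_gt1.
have M y z : fyz a y z1 <= fyz a y z.
  have [->|/eqP ney] := eqVneq y y1; last by rewrite (f0 y z1).
  by have := v y1 y2 z z1; rewrite (f0 y2 z1) //; lia.
have := rect2_sum v y2 M; rewrite -size_yz.
have -> : \sum_y fyz a y z1 = fyz a y1 z1.
  rewrite (bigD1 y1) //= big1 ?addn0 // => y /eqP ney; exact: f0.
have -> : \sum_z (fyz a y2 z - fyz a y2 z1) = fyz a y2 z2.
  rewrite (bigD1 z2) //= big1 ?addn0 => [|z /eqP nez'];
    first by rewrite (f0 y2 z1) ?subn0.
  by rewrite (f0 y2 z) // sub0n.
have up : 0 < fyz a y1 z1 by apply/fyz_gt0P; exists x1, t1.
have := fyz_leq_Np2 y1 z2 np2.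
have := v y1 y2 z1 z2; rewrite (f0 y2 z1) // addn0 => e; rewrite -e => le_p eS.
move: le; rewrite eS leqNgt => /negP; apply.
(* Strict because r < q and u > 0: r u + q v < q (u + v) <= p q. *)
apply: (@leq_trans (q * fyz a y1 z1 + q * fyz a y2 z2)).
  by rewrite ltn_add2r ltn_mul2r up.
by rewrite -mulnDr mulnC leq_mul2r le_p orbT.
Qed.

(** Take two points with equal y, different x and different z. A point of a full line z = z0 at
    another y shares x or z with each of them, hence x with one and z with the other: z0 is one of
    their z, and [Np2qr_single_pair] applies. *)
Lemma Np2qr_Np2r a : Np2 a -> Np2qr a -> Vqr a -> ~ Vr a -> r < q ->
  p * q <= size_grid a -> Np2r a.
Proof.
move=> np2 np2qr v nvr lt_rq le x1 x2 t1 t2 y1 z1 z2 h1 h2.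
apply: contrapT => /not_orP[nex nez].
have [z0 H] := Vqr_line_z v nvr.
have [y ne] := ord_other y1 q_gt1.
have [x [t h]] := H y.
have [e1|//|e1] := np2qr _ _ _ _ _ _ _ _ h h1;
  have [e2|//|e2] := np2qr _ _ _ _ _ _ _ _ h h2.
- by case: nex; rewrite -e1.
- by subst z0; case: (Np2qr_single_pair np2 np2qr v lt_rq le H h1 h2 nex nez).
- subst z0; apply: (Np2qr_single_pair np2 np2qr v lt_rq le H h2 h1).
    by move=> e; apply: nex.
  by move=> e; apply: nez.
- by case: nez; rewrite -e1.
Qed.

(** A 0/1 array u(t) + v(y) depends on one variable only; if that is t, the equal row sums of [Vp2]
    make it constant. *)
Lemma fty_const a : Vp2 a -> Vp2q a -> Nr a ->
  forall x t t' y, fty a x t y = fty a x t' y.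
Proof.
move=> v2 v nr x t t' y.
have [rows|cols] := rect2_bool (v x) (fun t y => fty_leq1 x t y nr);
  last exact: cols.
have E t1 : ft a x t1 = q * fty a x t1 y by apply: sum_const_ord => y1;
  apply: rows.
by have := v2 x t t'; rewrite !E => /eqP; rewrite eqn_mul2l => /orP[|/eqP//];
  have := q_gt1; lia.
Qed.

(** If [Vp a], each class has q points, and [Vp2q a] with 0/1 entries puts them in one fibre. If
    not, [Np b] gives p q <= q r, so p < r; then the size p q < q r leaves a layer z of [a] empty,
    and [Vpr a] brings [Vp a] back. *)
Lemma case_pq_narrow a b : dual a b -> dual b a -> Nr a -> Nr b ->
  ~ Vr a -> ~ Vr b -> size_grid a = size_grid b -> size_grid a = p * q ->
  r < q -> Np a -> Np2 b -> Np2r b -> Vp2 b -> Vpr b -> ~ Vp b -> Npr a.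
Proof.
move=> dab dba nra nrb nva nvb eab E lt_rq npa np2b np2rb v2b vprb nvpb.
have same_x x x' t t' y z1 z1' : b x t y z1 -> b x' t' y z1' -> x = x'.
  move=> h h'; case: (np2rb _ _ _ _ _ _ _ h h') => // e; subst z1'.
  exact: np2b h h'.
have vp2q : Vp2q a.
  case: (dual_p2q dba) => // np2q.
  have [z H] := Vpr_line_z vprb nvb.
  have [x ne] := ord_other i0 p_gt1.
  have [t [y h]] := H x; have [t' [y' h']] := H i0.
  case: (np2q _ _ _ _ _ _ _ h h') => // e; subst y'.
  by case: ne; exact: same_x h h'.
have [vp|nvp] := lem (Vp a).
  have fxq x : fx a x = q.
    have := E; rewrite (Vp_size x vp) => /eqP;
      rewrite eqn_mul2l => /orP[|/eqP//].
    by have := prime_gt0 p_pr; lia.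
  move=> x t t' y z z' h h'; left.
  have [rows|cols] := rect2_bool (vp2q x) (fun t y => fty_leq1 x t y nra).
    have E1 : \sum_t fty a x t y = 1.
      have := fxq x; rewrite /fx.
      have Et t1 : ft a x t1 = q * fty a x t1 y by apply: sum_const_ord => y1;
        apply: rows.
      rewrite (eq_bigr _ (fun t _ => Et t)) -big_distrr /= -[RHS]muln1 => /eqP.
      by rewrite eqn_mul2l => /orP[|/eqP//]; have := prime_gt0 q_pr; lia.
    apply: (sum_leq1_inj (F := fun t => fty a x t y)); first by rewrite E1.
      by apply/fty_gt0P; exists z.
    by apply/fty_gt0P; exists z'.
  have Et t1 : ft a x t1 = ft a x t by apply: eq_bigr => y1 _; apply: cols.
  have := fxq x; rewrite /fx (sum_const_ord Et) => e.
  have : p %| q by rewrite -e dvdn_mulr.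
  by rewrite dvdn_prime2 // (negPf pq).
have npb : Np b by case: (dual_p dba).
have le_pr : p <= r.
  have : size_grid b <= q * r.
    have -> : q * r = #|{: 'I_q * 'I_r}| by rewrite card_prod !card_ord.
    apply: (size_leq (g := fun x t y z => (y, z))).
    move=> x x' t t' y y' z z' h h' [? ?]; subst y' z'.
    have ex := same_x _ _ _ _ _ _ _ h h'; subst x'.
    by have -> := npb _ _ _ _ _ h h'.
  by rewrite -eab E mulnC leq_mul2l => /orP[|//]; have := prime_gt0 q_pr; lia.
have lt_pr : p < r by rewrite ltn_neqAle pr.
have vqr : Vqr a.
  case: (dual_qr dba) => // nqr.
  by have [_ /(_ nqr)] := Vp2_Vpr_leq v2b vprb nvpb nrb; lia.
have vpr : Vpr a.
  case: (dual_pr dba) => // nprb.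
  have := inj_y_size (N_inj_y npb np2b nrb nprb np2rb).
  rewrite -eab E -[leqRHS]mul1n leq_mul2r => /orP[]; last by have := p_gt1; lia.
  by have := prime_gt0 q_pr; lia.
have [z0 mz] : exists z0, missing_z a z0.
  apply: Vqr_missing_z => //; last by rewrite E dvdn_mull.
  by rewrite E mulnC ltn_mul2l lt_pr prime_gt0.
by case: nvp; apply: fxz_const_Vp (missing_z_pr mz vpr).
Qed.

(** In [a] the counts over (y, z) are at most p, and divisibility by p forces each of them to be p.
    All z are then equally frequent, that is, [Vr a]. *)
Lemma case_pq_wide a b : dual b a -> Nr a -> Nr b ->
  ~ Vr a -> ~ Vr b -> 0 < size_grid a ->
  Np a -> Vp2 a -> Vpr a -> ~ Vp a -> Np b -> Vp2 b -> Vpr b -> ~ Vp b ->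
  dual a b -> False.
Proof.
move=> dba nra nrb nvra nvrb a_gt0 npa v2a va nva npb v2b vb nvb dab.
have step (u : grid p q r) :
  Np u -> Vp2 u -> Vpr u -> ~ Vp u -> ~ Vr u -> ~ Np2q u.
  move=> np v2 v nv nvr np2q.
  have [z H] := Vpr_line_z v nvr.
  have [x [H1 _]] := Vp2_Vpr_large p_pr r_pr pr v2 v nv.
  have [x1 ne] := ord_other x p_gt1.
  have [t1 [y1 h1]] := H x1.
  have only t y : u x t y z -> y = y1.
    by move=> h; case: (np2q _ _ _ _ _ _ _ h h1) => // e; case: ne.
  have : fxz u x z <= 1.
    rewrite /fxz /ftz pair_bigA; apply: sum_bool_leq1 => -[t y] [t' y'] /= h h'.
    have e := only _ _ h; have e' := only _ _ h'; subst y y'.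
    by rewrite (np _ _ _ _ _ h h').
  by have := H1 z; have := p_gt1; lia.
have v2qa : Vp2q a by case: (dual_p2q dba) => // /(step _ npb v2b vb nvb nvrb).
have v2qb : Vp2q b by case: (dual_p2q dab) => // /(step _ npa v2a va nva nvra).
(* In a class the fibres t have the same counts over y, so one point yields p points with equal x
   and y, whose z are distinct by [Np]. *)
have lt_pr : p < r.
  rewrite ltn_neqAle pr /=.
  have [x [t [y [z h]]]] : exists x t y z, a x t y z by apply/size_gt0P.
  apply: (leq_of_relation (P := fun t z => a x t y z)) => [t'|t1 t2 z'].
    by apply/fty_gt0P; rewrite (fty_const v2a v2qa nra _ _ t); apply/fty_gt0P;
      exists z.
  exact: npa.
have vqr : Vqr a.
  case: (dual_qr dba) => // nqr.
  by have [_ /(_ nqr)] := Vp2_Vpr_leq v2b vb nvb nrb; lia.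
have p_fy y : p %| fy a y.
  rewrite fy_xy; apply: dvdn_sum => x _.
  by rewrite /fxy (sum_const_ord (c := fty a x i0 y)) ?dvdn_mulr // => t;
    apply: fty_const.
have [y0 M] := rect2_min (rect2_tr vqr) j0.
(* An excess c over the minimal row satisfies p | r c, so c >= p; entries being at most p, the
   minimal row is zero, and then [Vr a] holds. *)
have same y z : fyz a y z = fyz a y0 z.
  apply: contrapT => ne; apply: nvra.
  pose c := fyz a y z - fyz a y0 z.
  have c_gt0 : 0 < c by rewrite /c subn_gt0 ltn_neqAle M andbT;
    apply/eqP => e; apply: ne.
  have Ec z' : fyz a y z' = fyz a y0 z' + c.
    by have := vqr y y0 z z'; have := M z y; rewrite /c; lia.
  have p_c : p %| c.
    have : p %| fy a y0 + r * c.
      have <- : \sum_(z' < r) c = r * c by exact: sum_const_ord.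
      by rewrite -big_split; rewrite -(eq_bigr _ (fun z' _ => Ec z'));
        apply: p_fy.
    rewrite dvdn_addr; last exact: p_fy.
    by rewrite Gauss_dvdr // prime_coprime // dvdn_prime2.
  have le_pc : p <= c by apply: dvdn_leq.
  have f0 z' : fyz a y0 z' = 0 by have := fyz_leq_Np y z' npa; rewrite Ec; lia.
  move=> z1 z2; apply: eq_bigr => y1 _.
  by have := vqr y1 y0 z1 z2; rewrite !f0; lia.
have Ez z : fz a z = q * fyz a y0 z by apply: sum_const_ord => y; apply: same.
have p_f z : p %| fyz a y0 z.
  have : p %| fz a z.
    rewrite fz_xz.
    have [x0 M0] : exists x0, forall x, fxz a x0 z <= fxz a x z.
      by have [x0 H] := rect2_min (rect2_tr va) i0; exists x0 => x; apply: H.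
    have -> : \sum_x fxz a x z = \sum_x (fxz a x z - fxz a x0 z) + p * fxz a
      x0 z.
      have <- : \sum_(x < p) fxz a x0 z = p * fxz a x0 z by exact:
        sum_const_ord.
      by rewrite -big_split; apply: eq_bigr => x _; rewrite /= subnK.
    rewrite dvdn_addl; last exact: dvdn_mulr.
    by apply: dvdn_sum => x _; apply: Vp2_Vpr_dvd.
  by rewrite Ez Gauss_dvdr // prime_coprime // dvdn_prime2.
have f_p z : fyz a y0 z = p.
  apply: dvdn_eq => //; last exact: fyz_leq_Np.
  rewrite lt0n; apply/eqP => f0; apply: nva.
  apply: fxz_const_Vp; apply: (missing_z_pr (z0 := z)) => //.
  by apply: missing_z_yz => y; rewrite same.
by apply: nvra => z z'; rewrite !Ez !f_p.
Qed.

Lemma case_pq a b : dual a b -> dual b a ->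
  size_grid a = size_grid b -> 0 < size_grid a ->
  p %| size_grid a -> q %| size_grid a -> ~~ (r %| size_grid a) -> std_tile a.
Proof.
move=> dab dba eab a_gt0 p_d q_d r_n.
have r_n' := r_n; rewrite eab in r_n'.
have [nra nrb] := (dual_Nr dab r_n', dual_Nr dba r_n).
have [nva nvb] := (not_Vr r_n, not_Vr r_n').
have pq_d : p * q %| size_grid a.
  by rewrite Gauss_dvd ?p_d ?q_d // prime_coprime // dvdn_prime2.
have le_pq : p * q <= size_grid a by apply: dvdn_leq.
have [p2_d|p2_n] := boolP (p ^ 2 %| size_grid a).
  have E : size_grid a = p ^ 2 * q.
    apply: dvdn_eq => //; last first.
      by rewrite Gauss_dvd ?p2_d ?q_d // coprimeXl // prime_coprime //
        dvdn_prime2.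
    have -> : p ^ 2 * q = #|{: ('I_p * 'I_p) * 'I_q}|.
      by rewrite !card_prod !card_ord mulnn.
    apply: (size_leq (g := fun x t y z => ((x, t), y))).
    move=> x x' t t' y y' z z' h h' [? ? ?]; subst x' t' y'.
    by have -> := nra _ _ _ _ _ h h'.
  exists false, false, false, true; split; first by rewrite E !mul1n expn1.
  move=> x x' t t' y y' z z' h h' /= /andP[/eqP ? /eqP ?] /eqP ? _.
  by subst x' t' y'; have -> := nra _ _ _ _ _ h h'.
(* In a tame set with [Nr], y and one base-p digit determine the point, so the size is p q. *)
pose tame (u : grid p q r) := Np u /\ Npr u \/ Np2 u /\ Np2r u.
have [tame_a|wild_a] := lem (tame a).
  case: tame_a => [[np npr]|[np2 np2r]].
    have inj x t t' y z z' : a x t y z -> a x t' y z' -> t = t' /\ z = z'.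
      move=> h h'; have et : t = t'.
        by case: (npr _ _ _ _ _ _ h h') => // e; subst z'; exact: np h h'.
      by subst t'; split=> //; exact: nra h h'.
    have E : size_grid a = p * q.
      apply: dvdn_eq => //.
      have -> : p * q = #|{: 'I_p * 'I_q}| by rewrite card_prod !card_ord.
      apply: (size_leq (g := fun x t y z => (x, y))).
      move=> x x' t t' y y' z z' h h' [? ?]; subst x' y'.
      by have [-> ->] := inj _ _ _ _ _ _ h h'.
    exists false, true, false, true; split.
      by rewrite E muln1 !expn1; ring.
    move=> x x' t t' y y' z z' h h' /= /eqP ? /eqP ? _; subst x' y'.
    by have [-> ->] := inj _ _ _ _ _ _ h h'.
  have inj x x' t t' y z z' : a x t y z -> a x' t' y z' -> x = x'.
    move=> h h'; case: (np2r _ _ _ _ _ _ _ h h') => // e; subst z';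
      exact: np2 h h'.
  have E : size_grid a = p * q.
    apply: dvdn_eq => //.
    have -> : p * q = #|{: 'I_p * 'I_q}| by rewrite card_prod !card_ord.
    apply: (size_leq (g := fun x t y z => (t, y))).
    move=> x x' t t' y y' z z' h h' [? ?]; subst t' y'.
    have ex := inj _ _ _ _ _ _ _ h h'; subst x'.
    by have -> := nra _ _ _ _ _ h h'.
  exists true, false, false, true; split.
    by rewrite E muln1 !expn1; ring.
  move=> x x' t t' y y' z z' h h' /= s /eqP ? _; subst y'.
  have ex := inj _ _ _ _ _ _ _ h h'; subst x'.
  move: s; rewrite eqxx => /eqP ?; subst t'.
  by have -> := nra _ _ _ _ _ h h'.
exfalso.
have not_both (u : grid p q r) :
  size_grid u = size_grid a -> Vp u -> Vp2 u -> False.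
  by move=> e vp vp2; move: p2_n; rewrite -e Vp_Vp2_dvd.
(* For wild [u], failure of [Vp2 v] would force [Vp2r v]; the full line of [v] then supplies what
   [Np2qr_Np2r] requires of [u], which would be tame. *)
have step (u v : grid p q r) :
  dual u v -> dual v u -> size_grid u = size_grid a ->
    size_grid v = size_grid a -> ~ tame u ->
    [/\ Np u, Vp2 v, Vpr v, ~ Vp v & r < q].
  move=> duv dvu eu ev wild.
  have nvu : ~ Vr u by apply: not_Vr; rewrite eu.
  have nru : Nr u by apply: (dual_Nr duv); rewrite ev.
  have nrv : Nr v by apply: (dual_Nr dvu); rewrite eu.
  have strict : r <= q -> r < q by move=> le; rewrite ltn_neqAle eq_sym qr.
  have [v2|nv2] := lem (Vp2 v).
    have nv : ~ Vp v by move=> /(not_both _ ev).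
    have np : Np u by case: (dual_p duv).
    have vpr : Vpr v.
      by case: (dual_pr duv) => // npr; case: wild; left.
    split=> //; apply: strict.
    by have [] := Vp2_Vpr_leq v2 vpr nv nrv.
  have np2 : Np2 u by case: (dual_p2 duv).
  have v2r : Vp2r v by case: (dual_p2r duv) => // np2r; case: wild; right.
  have [/strict lt nqr nv] := Vp2r_line_facts v2r nv2 nrv.
  case: wild; right; split=> //.
  apply: Np2qr_Np2r => //; last by rewrite eu.
    by case: (dual_p2qr duv).
  by case: (dual_qr dvu).
have [npa v2b vprb nvpb lt_rq] := step a b dab dba erefl (esym eab) wild_a.
have [tame_b|wild_b] := lem (tame b).
  case: tame_b => [[npb nprb]|[np2b np2rb]].
    have fx_q x : fx b x <= q.
      rewrite -[leqRHS]card_ord; apply: (fx_leq (g := fun t y z => y)).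
      move=> t t' y y' z z' h h' ?; subst y'.
      have et : t = t'.
        by case: (nprb _ _ _ _ _ _ h h') => // e; subst z'; exact: npb h h'.
      by subst t'; have -> := nrb _ _ _ _ _ h h'.
    have E : size_grid b = p * q.
      by apply/eqP; rewrite eqn_leq -{2}eab le_pq andbT; apply: sum_leq_ord.
    by apply: nvpb => x x'; rewrite !(sum_eq_ord E fx_q).
  have E : size_grid a = p * q.
    apply: dvdn_eq => //; rewrite eab.
    have -> : p * q = #|{: 'I_p * 'I_q}| by rewrite card_prod !card_ord.
    apply: (size_leq (g := fun x t y z => (t, y))).
    move=> x x' t t' y y' z z' h h' [? ?]; subst t' y'.
    have ex : x = x'.
      by case: (np2rb _ _ _ _ _ _ _ h h') => // e; subst z'; exact: np2b h h'.
    by subst x'; have -> := nrb _ _ _ _ _ h h'.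
  by apply: wild_a; left; split=> //;
    apply: case_pq_narrow dab dba _ _ _ _ _ _ _ _ _ _ _ _ _.
have [npb v2a vpra nvpa _] := step b a dba dab (esym eab) erefl wild_b.
exact: (case_pq_wide dba nra nrb).
Qed.

(** * Size divisible by neither q nor r *)

Lemma Vp_Vpr_const a : Vp a -> Vpr a -> forall x x' z, fxz a x z = fxz a x' z.
Proof.
move=> vp v x x'; apply: rect2_rows_eq => //; first exact: prime_gt0.
by rewrite -!fx_xz; apply: vp.
Qed.

Lemma Vp_Vpq_const a : Vp a -> Vpq a -> forall x x' y, fxy a x y = fxy a x' y.
Proof.
move=> vp v x x'; apply: rect2_rows_eq => //; first exact: prime_gt0.
by rewrite -!fx_xy; apply: vp.
Qed.

Lemma ft_leq1 a x t : Nq a -> Nr a -> Nqr a -> ft a x t <= 1.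
Proof.
move=> nq nr nqr; rewrite -[leqRHS]card_unit.
apply: (ft_leq (g := fun _ _ => tt)) => y y' z z' h h' _.
case: (nqr _ _ _ _ _ _ h h') => e; subst; split=> //; first exact: nr h h'.
exact: nq h h'.
Qed.

Lemma ft_leq1_inj a x t y y' z z' : ft a x t <= 1 ->
  a x t y z -> a x t y' z' -> y = y' /\ z = z'.
Proof.
move=> le h h'; have ey : y = y'.
  by apply: (sum_leq1_inj le); apply/fty_gt0P; [exists z|exists z'].
subst y'; split=> //.
have le1 : fty a x t y <= 1 by apply: leq_trans le;
  apply: (leq_sum_term (fty a x t)).
by apply: (sum_leq1_inj le1); rewrite ?h ?h'.
Qed.

Lemma size_leq_pp a : (forall x t, ft a x t <= 1) -> size_grid a <= p ^ 2.
Proof.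
move=> le1; rewrite -mulnn; apply: sum_leq_ord => x; rewrite -[leqRHS]muln1.
exact: sum_leq_ord.
Qed.

(** Small fibres make [ftz] constant in t and [fxz] constant in x, so every z that occurs is visible
    in one fibre, which has fewer than r points. *)
Lemma Vpr_Vp2r_missing_z a : (forall x t, ft a x t < r) -> Vpr a -> Vp2r a ->
  exists z, missing_z a z.
Proof.
move=> small v w; have tc := Vp2r_const w small.
have v2 := ftz_const_Vp2 tc.
have vp := Vp2_Vpr_Vp p_pr r_pr pr v2 v small.
have Ez x t z : fxz a x z = p * ftz a x t z.
  by apply: sum_const_ord => t'; apply: tc.
have [|z fz0] := @sum_lt_ord _ (ftz a i0 i0); first by rewrite -ftE.
exists z => x t y; apply/negP => h.
have : 0 < fxz a x z by apply/fxz_gt0P; exists t, y.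
by rewrite (Vp_Vpr_const vp v x i0) (Ez i0 i0) fz0 muln0.
Qed.

(** * Excluding differences of order q r in [a] when [Vqr b] holds *)

Section CaseP.
Variables a b : grid p q r.
Hypotheses (lt_qr : q < r) (dab : dual a b) (dba : dual b a).
Hypotheses (eab : size_grid a = size_grid b) (a_gt0 : 0 < size_grid a).
Hypotheses (q_n : ~~ (q %| size_grid a)) (r_n : ~~ (r %| size_grid a)).
Hypotheses (vqrb : Vqr b) (wild : ~ Nqr a).

Let q_n' : ~~ (q %| size_grid b). Proof. by rewrite -eab. Qed.
Let r_n' : ~~ (r %| size_grid b). Proof. by rewrite -eab. Qed.
Let b_gt0 : 0 < size_grid b. Proof. by rewrite -eab. Qed.
Let nra : Nr a := dual_Nr dab r_n'.
Let nqb : Nq b := dual_Nq dba q_n.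
Let nrb : Nr b := dual_Nr dba r_n.
Let nvqa : ~ Vq a := not_Vq q_n.
Let nvra : ~ Vr a := not_Vr r_n.
Let nvqb : ~ Vq b := not_Vq q_n'.
Let nvrb : ~ Vr b := not_Vr r_n'.

Let smalla x t : ft a x t < r := leq_ltn_trans (ft_leq_q x t nra) lt_qr.
Let smallb x t : ft b x t < r := leq_ltn_trans (ft_leq_q x t nrb) lt_qr.

Let wild_ft : ~ (forall x t, ft a x t <= 1).
Proof.
move=> le1; apply: wild => x t y y' z z' h h'; left.
by have [] := ft_leq1_inj (le1 x t) h h'.
Qed.

Let vqra_of_large : p ^ 2 < size_grid a -> Vqr a.
Proof.
move=> lt; case: (dual_qr dba) => // nqr.
have : size_grid b <= p ^ 2 by apply: size_leq_pp => x t; apply: ft_leq1.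
by rewrite -eab leqNgt lt.
Qed.

Let vqra_of_Vp_Vp2 : Vp a -> Vp2 a -> Vqr a.
Proof.
move=> vp v2; apply: vqra_of_large; rewrite ltnNge; apply/negP => le.
apply: wild_ft => x t; move: le; rewrite (Vp_Vp2_size x t vp v2).
by rewrite -[leqRHS]muln1 leq_mul2l expn_eq0 => /orP[|//]; have := p_gt1; lia.
Qed.

(** The outcome is a class of [b] concentrated on one z with the same count for every y, so that q
    divides its size and, by [Vp b], the size of [b]. *)
Let no_Vp2r : ~ Vp2r a.
Proof.
move=> v2r; have tc := Vp2r_const v2r smalla; have v2 := ftz_const_Vp2 tc.
have nvpr : ~ Vpr a.
  move=> v; have [z mz] := Vpr_Vp2r_missing_z smalla v v2r.
  have vp := Vp2_Vpr_Vp p_pr r_pr pr v2 v smalla.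
  by apply/nvqa/(missing_z_qr mz)/vqra_of_Vp_Vp2.
have nprb : Npr b by case: (dual_pr dba).
have [y0 L] := Vqr_line_y vqrb nvqb.
have le_rp : r <= p.
  apply: (leq_of_relation L) => z z' x [t h] [t' h'].
  by case: (nprb _ _ _ _ _ _ h h') => // e; subst t'; exact: nrb h h'.
have vpb : Vp b.
  case: (dual_p dab) => // npa.
  have [x [t [y [z h]]]] : exists x t y z, a x t y z by apply/size_gt0P.
  have : p <= q.
    apply: (leq_of_relation (P := fun t y => a x t y z)) => [t'|t1 t2 y'].
      by apply/ftz_gt0P; rewrite (tc _ _ t); apply/ftz_gt0P; exists y.
    exact: npa.
  by move/(leq_trans le_rp); rewrite leqNgt lt_qr.
have npra : Npr a.
  case: (dual_pr dab) => // vprb.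
  have : r <= q.
    apply: (leq_of_relation (P := fun z y => exists t, b i0 t y z)).
      move=> z; have [x [t h]] := L z.
      have : 0 < fxz b i0 z.
        by rewrite (Vp_Vpr_const vpb vprb _ x); apply/fxz_gt0P; exists t, y0.
      by case/fxz_gt0P => t' [y h']; exists y, t'.
    move=> z z' y [t h] [t' h'].
    by case: (nprb _ _ _ _ _ _ h h') => // e; subst t'; exact: nrb h h'.
  by rewrite leqNgt lt_qr.
(* Of two points differing by order q r, replace the first by a point with the same z in another
   fibre t'. By [Npr a] it still differs in y from the second, so order p q r occurs. *)
have vpqrb : Vpqr b.
  case: (dual_pqr dab) => // npqr; case: wild => x t y1 y2 z1 z2 h1 h2.
  apply: contrapT => /not_orP[ney nez].
  have [t' ne] := ord_other t p_gt1.
  have [y' h'] : exists y', a x t' y' z1.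
    by apply/ftz_gt0P; rewrite (tc _ _ t); apply/ftz_gt0P; exists y1.
  have [e|e|e] := npqr _ _ _ _ _ _ _ h2 h'; first by case: ne.
    subst y'; have [e|e] := npra _ _ _ _ _ _ h2 h'; first by case: ne.
    by case: nez.
  by case: nez.
have fR := rect3_slice vpqrb vqrb i0.
have : 0 < fx b i0.
  by move: b_gt0; rewrite (Vp_size i0 vpb) muln_gt0 => /andP[].
case/fx_gt0P => t [y [z h]].
have f0 y1 z1 : 0 < fxyz b i0 y1 z -> z1 <> z -> fxyz b i0 y1 z1 = 0.
  case/fxyz_gt0P => t1 h1 ne; apply/eqP; rewrite -leqn0 leqNgt.
  apply/fxyz_gt0P => -[t2 h2]; apply: ne.
  by case: (nprb _ _ _ _ _ _ h1 h2) => // e; subst t2; exact: nrb h2 h1.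
have f_gt0 y1 : 0 < fxyz b i0 y1 z.
  have [z' ne] := ord_other z r_gt1.
  have f1 : 0 < fxyz b i0 y z by apply/fxyz_gt0P; exists t.
  by have := fR y y1 z z'; rewrite (f0 y z' f1 ne) => e;
    apply: leq_trans f1 _; rewrite -[leqRHS]add0n -e leq_addr.
have f_eq y1 : fxyz b i0 y1 z = fxyz b i0 y z.
  have [z' ne] := ord_other z r_gt1.
  by have := fR y y1 z z';
    rewrite (f0 y z' (f_gt0 y) ne) (f0 y1 z' (f_gt0 y1) ne) addn0 add0n.
move/negP: q_n'; apply; rewrite (Vp_size i0 vpb) dvdn_mull // fx_xyz.
rewrite (sum_const_ord (c := fxyz b i0 y z)) ?dvdn_mulr // => y1.
by rewrite (bigD1 z) //= big1 ?addn0 // => z1 /eqP ne; apply: f0.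
Qed.

Let np2rb : Np2r b.
Proof. by case: (dual_p2r dba) => // /no_Vp2r. Qed.

Let line_y : exists y, forall z, exists x t, b x t y z.
Proof. exact: Vqr_line_y. Qed.

Let line_z : exists z, forall y, exists x t, b x t y z.
Proof. exact: Vqr_line_z. Qed.

Let vpra : Vpr a.
Proof.
case: (dual_pr dba) => // nprb; have [y L] := line_y.
have [z ne] := ord_other k0 r_gt1.
have [x [t h]] := L z; have [x' [t' h']] := L k0.
case: (np2rb h h') => // e; subst x'.
case: (nprb _ _ _ _ _ _ h h') => // e; subst t'.
by case: ne; exact: nrb h h'.
Qed.

Let vp_of_Vp2 : Vp2 a -> Vp a.
Proof. by move=> v2; apply: Vp2_Vpr_Vp p_pr r_pr pr v2 vpra smalla. Qed.

Let missing_x_N x0 : missing_x b x0 -> [/\ Np a, Npr a & Npq a].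
Proof.
move=> mx; split.
- by case: (dual_p dab) => // v; move: b_gt0; rewrite (missing_x_p mx v).
- by case: (dual_pr dab) => // /(missing_x_pr mx).
- by case: (dual_pq dab) => // /(missing_x_pq mx).
Qed.

(** Otherwise a full line in y and one in z force all of [b] into one class. Then [a] gains [Np],
    [Npr], [Npq] and misses a layer z, which gives [Nqr b] and at most one point of [b] per t. So
    the p equal classes of [a] have at most one point each, against [wild]. *)
Let vp2qa : Vp2q a.
Proof.
case: (dual_p2q dba) => // np2qb; exfalso.
have [y0 Ly] := line_y; have [z0 Lz] := line_z.
have [x0 [t0 h0]] := Ly z0.
have on_y0 x t z : b x t y0 z -> x = x0.
  move=> h; have [z1 ne] := ord_other z0 r_gt1; have [x1 [t1 h1]] := Ly z1.
  have e1 : x1 = x0 by case: (np2rb h1 h0).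
  have [e|/eqP nez] := eqVneq z z0; last by case: (np2rb h h0).
  by subst z; case: (np2rb h h1) => [->//|e]; case: ne.
have all_x0 x t y z : b x t y z -> x = x0.
  move=> h; have [e|/eqP ney] := eqVneq y y0; first by subst y; apply: on_y0 h.
  have on_z0 x1 t1 : b x1 t1 y z0 -> x1 = x0.
    by move=> h1; case: (np2qb _ _ _ _ _ _ _ h1 h0).
  have [e|/eqP nez] := eqVneq z z0; first by subst z; apply: on_z0 h.
  have [x1 [t1 h1]] := Lz y; rewrite -(on_z0 _ _ h1).
  by case: (np2rb h h1).
have [x1 ne] := ord_other x0 p_gt1.
have mx : missing_x b x1 by move=> t y z; apply/negP => /all_x0.
have [npa npra npqa] := missing_x_N mx.
have inj x t t' y z z' : a x t y z -> a x t' y z' -> t = t' /\ z = z'.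
  move=> h h'; have e : t = t'.
    by case: (npra _ _ _ _ _ _ h h') => // e; subst z'; exact: npa h h'.
  by subst t'; split=> //; exact: nra h h'.
have vpa : Vp a.
  apply: contrapT => nvp; have [x H] := Vpr_line_x vpra nvp.
  have : r <= q.
    apply: (leq_of_relation (P := fun z y => exists t, a x t y z)).
      by move=> z; have [t [y h]] := H z; exists y, t.
    by move=> z z' y [t h] [t' h']; have [] := inj _ _ _ _ _ _ h h'.
  by rewrite leqNgt lt_qr.
have fx_q : fx a i0 <= q.
  rewrite -[leqRHS]card_ord; apply: (fx_leq (g := fun t y z => y)).
  by move=> t t' y y' z z' h h' e; subst y';
    have [-> ->] := inj _ _ _ _ _ _ h h'.
have [|z1 fz1] := @sum_lt_ord _ (fxz a i0).
  by rewrite -fx_xz; apply: leq_ltn_trans fx_q lt_qr.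
have mz : missing_z a z1.
  move=> x t y; apply/negP => h.
  have : 0 < fxz a x z1 by apply/fxz_gt0P; exists t, y.
  by rewrite (Vp_Vpr_const vpa vpra x i0) fz1.
have nqrb : Nqr b by case: (dual_qr dba) => // /(missing_z_qr mz).
have : size_grid b <= p.
  rewrite -[leqRHS]card_ord; apply: (size_leq (g := fun x t y z => t)).
  move=> x x' t t' y y' z z' h h' e; subst t'.
  have ex : x = x' by rewrite (all_x0 _ _ _ _ h) (all_x0 _ _ _ _ h').
  by subst x'; have [-> ->] := ft_leq1_inj (ft_leq1 x t nqb nrb nqrb) h h'.
rewrite -eab (Vp_size i0 vpa) -[leqRHS]muln1 leq_mul2l => /orP[|le1].
  by have := p_gt1; lia.
apply: wild_ft => x t; apply: leq_trans le1; rewrite (vpa i0 x).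
exact: (leq_sum_term (ft a x)).
Qed.

Let lt_qp : Npq b -> q < p.
Proof.
move=> npqb; have [z L] := line_z; rewrite ltn_neqAle eq_sym pq /=.
apply: (leq_of_relation L) => y y' x [t h] [t' h'].
by case: (npqb _ _ _ _ _ _ h h') => // e; subst t'; exact: nqb h h'.
Qed.

(** [Vp2 a] brings [Vp a] and [Vqr a], and [Npq b] gives q < p. But in a suitable layer z all x
    occur, with distinct y, so p <= q. *)
Let no_Vp2 : ~ Vp2 a.
Proof.
move=> v2; have vpa := vp_of_Vp2 v2; have vqra := vqra_of_Vp_Vp2 vpa v2.
have tc := fty_const v2 vp2qa nra.
have nvpq : ~ Vpq a.
  move=> vpq; have xc := Vp_Vpq_const vpa vpq.
  have Exy x t y : fxy a x y = p * fty a x t y.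
    by apply: sum_const_ord => t'; apply: tc.
  have [z L] := Vqr_line_z vqra nvra.
  have f1 y : fty a i0 i0 y = 1.
    apply/eqP; rewrite eqn_leq fty_leq1 //=.
    have [x [t h]] := L y.
    have : 0 < fxy a i0 y by rewrite (xc _ x); apply/fxy_gt0P; exists t, z.
    by rewrite (Exy _ i0) muln_gt0 => /andP[].
  move/negP: q_n; apply; rewrite (Vp_Vp2_size i0 i0 vpa v2) dvdn_mull //.
  by rewrite /ft (sum_const_ord f1) muln1.
have npqb : Npq b by case: (dual_pq dba).
have ltqp := lt_qp npqb.
have xc := Vp_Vpr_const vpa vpra.
have [y1 L] := Vqr_line_y vqra nvqa.
have f_gt0 x z : 0 < fxz a x z.
  by have [x' [t h]] := L z; rewrite (xc _ x'); apply/fxz_gt0P; exists t, y1.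
have vprb : Vpr b.
  case: (dual_pr dab) => // npra.
  have : r <= q; last by rewrite leqNgt lt_qr.
  apply: (leq_of_relation (P := fun z y => exists t, a i0 t y z)).
    by move=> z; case/fxz_gt0P: (f_gt0 i0 z) => t [y h]; exists y, t.
  move=> z z' y [t h] [t' h']; case: (npra _ _ _ _ _ _ h h') => // e.
  by subst t'; exact: nra h h'.
have np2ra : Np2r a.
  case: (dual_p2r dab) => // v.
  have [z mz] := Vpr_Vp2r_missing_z smallb vprb v.
  by case: nvqb; apply: missing_z_qr mz vqrb.
(* In row y1, z is chosen at most as frequent as z'. If two x met at (y, z), then (y, z') would be
   empty by [Np2r a], and the rectangle identity would make z more frequent. *)
have [z [z' [ne le]]] : exists z z', z' <> z /\ fyz a y1 z <= fyz a y1 z'.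
  have [z' ne] := ord_other k0 r_gt1.
  have [le|/ltnW le] := leqP (fyz a y1 k0) (fyz a y1 z');
    first by exists k0, z'.
  by exists z', k0; split=> // e; apply: ne.
have : p <= q; last by move: ltqp; lia.
apply: (leq_of_relation (P := fun x y => exists t, a x t y z)).
  by move=> x; case/fxz_gt0P: (f_gt0 x z) => t [y h]; exists y, t.
move=> x x' y [t h] [t' h']; apply: contrapT => nex.
have f0 : fyz a y z' = 0.
  apply/eqP; rewrite -leqn0 leqNgt; apply/fyz_gt0P => -[x'' [t'' h'']].
  case: (np2ra _ _ _ _ _ _ _ h'' h) => // e; subst x''.
  by case: (np2ra _ _ _ _ _ _ _ h'' h').
have fy : 0 < fyz a y z by apply/fyz_gt0P; exists x, t.
have := vqra y1 y z z'; rewrite f0 addn0 => e; move: le.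
by rewrite e -[leqRHS]addn0 leq_add2l leqNgt fy.
Qed.

(** Classes of [b] use distinct y, and q < p, so some class is empty. This gives [Np a] and [Npr a],
    under which counts constant in t are zero; hence every fibre of [a] is constant in y, that is,
    [Vq a]. *)
Lemma case_p_absurd : False.
Proof.
have np2b : Np2 b by case: (dual_p2 dba) => // /no_Vp2.
have nvpq : ~ Vpq a.
  move=> v; apply: no_Vp2 => x t t'.
  have [rows|cols] := rect2_bool (vp2qa x) (fun t y => fty_leq1 x t y nra);
    last first.
    by apply: eq_bigr => y _; apply: cols.
  case: nvqa => y y'; rewrite !fy_xy; apply: eq_bigr => x' _.
  have e : fxy a x y = fxy a x y' by apply: eq_bigr => t1 _; apply: rows.
  by have := v x x' y' y; rewrite e => /addnI.
have npqb : Npq b by case: (dual_pq dba).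
have [x1 mx] : exists x1, missing_x b x1.
  apply: contrapT => nE; have : p <= q; last by have := lt_qp npqb; lia.
  apply: (leq_of_relation (P := fun x y => exists t z, b x t y z)).
    move=> x; apply: contrapT => nx; apply: nE; exists x => t y z.
    by apply/negP => h; apply: nx; exists y, t, z.
  move=> x x' y [t [z h]] [t' [z' h']]; case: (np2rb h h') => // e.
  by subst z'; exact: np2b h h'.
have [npa npra npqa] := missing_x_N mx.
apply: nvqa => y y'; rewrite !fy_xy; apply: eq_bigr => x _;
  apply: eq_bigr => t _.
have [rows|cols] := rect2_bool (vp2qa x) (fun t y => fty_leq1 x t y nra);
  first exact: rows.
suff f0 y1 : fty a x t y1 = 0 by rewrite !f0.
apply/eqP; rewrite -leqn0 leqNgt; apply/negP => f_gt0.
have [t' ne] := ord_other t p_gt1.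
have f_gt0' := f_gt0; rewrite (cols _ t') in f_gt0'.
case/fty_gt0P: f_gt0 => z h; case/fty_gt0P: f_gt0' => z' h'; apply: ne.
case: (npra _ _ _ _ _ _ h h') => // e; subst z'; exact: npa h' h.
Qed.

End CaseP.

Lemma inj_x_tile a : 0 < size_grid a -> p %| size_grid a ->
  (forall x t t' y y' z z', a x t y z -> a x t' y' z' ->
    [/\ t = t', y = y' & z = z']) -> std_tile a.
Proof.
move=> a_gt0 p_d inj; have E : size_grid a = p.
  apply: dvdn_eq => //; rewrite -[leqRHS]card_ord.
  apply: (size_leq (g := fun x t y z => x)).
  move=> x x' t t' y y' z z' h h' e; subst x'.
  by have [-> -> ->] := inj _ _ _ _ _ _ _ h h'.
exists false, true, true, true; split; first by rewrite E !expn1 !mulnA mulnn.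
move=> x x' t t' y y' z z' h h' /= /eqP e _ _; subst x'.
by have [-> -> ->] := inj _ _ _ _ _ _ _ h h'.
Qed.

(** If the fibre t' is empty and the fibre t is the single point (y, z), a box with opposite corners
    (t, y, z) and (t', y', z') has at least 1 on one side and 0 on the other. *)
Lemma Vp2qr_Vp2 a : (forall x t, ft a x t <= 1) -> Vp2qr a -> Vp2 a.
Proof.
move=> le1 v x t t'.
wlog lt : t t' / ft a x t' < ft a x t.
  by move=> W; case: (ltngtP (ft a x t') (ft a x t)) => // [/W|/W ->//].
have ft0 : ft a x t' = 0 by have := le1 x t; lia.
have a0 y z : a x t' y z = false.
  by apply/negP => h; have : 0 < ft a x t' by [apply/ft_gt0P; exists y, z];
    rewrite ft0.
have : 0 < ft a x t by lia.
case/ft_gt0P => y [z h].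
have [y' ney] := ord_other y q_gt1; have [z' nez] := ord_other z r_gt1.
have := v x t t' y y' z z'; rewrite !a0 h.
have -> : a x t y' z = false.
  by apply/negP => h'; apply: ney; have [] := ft_leq1_inj (le1 x t) h' h.
have -> : a x t y z' = false.
  by apply/negP => h'; apply: nez; have [] := ft_leq1_inj (le1 x t) h' h.
by case: (a x t y' z').
Qed.


(** Fibres with at most one point are smaller than q and r, so each of [Vp2q], [Vp2r], [Vp2qr] on
    [b] would imply [Vp2 b]. All orders divisible by p^2 are thus excluded in [a]. *)
Lemma same_x_of_not_Vp2 a b : dual a b -> (forall x t, ft b x t <= 1) ->
  ~ Vp2 b -> forall x x' t t' y y' z z', a x t y z -> a x' t' y' z' -> x = x'.
Proof.
move=> dab le1 nv2.
have lt_r x t : ft b x t < r by apply: leq_ltn_trans (le1 x t) r_gt1.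
have lt_q x t : ft (swap_grid b) x t < q.
  by rewrite ft_swap; apply: leq_ltn_trans (le1 x t) q_gt1.
have np2 : Np2 a by case: (dual_p2 dab).
have np2r : Np2r a.
  case: (dual_p2r dab) => // v; case: nv2.
  exact: ftz_const_Vp2 (Vp2r_const v lt_r).
have np2q : Np2q a.
  case: (dual_p2q dab) => // v; case: nv2; apply: Vp2_swap.
  exact: ftz_const_Vp2 (@Vp2r_const p r q (swap_grid b) v lt_q).
have np2qr : Np2qr a by case: (dual_p2qr dab) => // /(Vp2qr_Vp2 le1).
move=> x x' t t' y y' z z' h h'.
have [//|e|e] := np2qr _ _ _ _ _ _ _ _ h h'.
  subst y'; case: (np2r _ _ _ _ _ _ _ h h') => // e.
  by subst z'; exact: np2 h h'.
subst z'; case: (np2q _ _ _ _ _ _ _ h h') => // e.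
by subst y'; exact: np2 h h'.
Qed.

(** The size is p^2 or p. If it is p, [a] either lies in one class with distinct t, or has one point
    in each class; T runs through x or through t accordingly. *)
Lemma case_p_thin a b : dual a b -> dual b a ->
  size_grid a = size_grid b -> 0 < size_grid a -> p %| size_grid a ->
  (forall x t, ft a x t <= 1) -> (forall x t, ft b x t <= 1) -> std_tile a.
Proof.
move=> dab dba eab a_gt0 p_d le1a le1b.
have [p2_d|p2_n] := boolP (p ^ 2 %| size_grid a).
  have E : size_grid a = p ^ 2 by apply: dvdn_eq => //; apply: size_leq_pp.
  exists false, false, true, true; split; first by rewrite E mul1n !expn1 mulnA.
  move=> x x' t t' y y' z z' h h' /= /andP[/eqP ? /eqP ?] _ _; subst x' t'.
  by have [-> ->] := ft_leq1_inj (le1a x t) h h'.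
have not_both (u : grid p q r) : size_grid u = size_grid a -> Vp2 u -> ~ Vp u.
  by move=> e v2 v; move: p2_n; rewrite -e Vp_Vp2_dvd.
have smaller (u : grid p q r) (x0 : 'I_p) : (forall x t, ft u x t <= 1) ->
    (forall x t y z, u x t y z -> x = x0) -> size_grid u <= p.
  move=> le1 all_x0; rewrite -[leqRHS]card_ord.
  apply: (size_leq (g := fun x t y z => t)) => x x' t t' y y' z z' h h' e.
  subst t'; have ex : x = x' by rewrite (all_x0 _ _ _ _ h) (all_x0 _ _ _ _ h').
  by subst x'; have [-> ->] := ft_leq1_inj (le1 x t) h h'.
have size_p (u : grid p q r) : size_grid u = size_grid a ->
    (forall x t, ft u x t <= 1) ->
    (forall x x' t t' y y' z z', u x t y z -> u x' t' y' z' -> x = x') ->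
    size_grid a = p.
  move=> e le1 same; apply: dvdn_eq => //; rewrite -e.
  have [x0 [t0 [y0 [z0 h0]]]] : exists x t y z, u x t y z.
    by apply/size_gt0P; rewrite e.
  by apply: (smaller u x0) => // x t y z h; apply: same h h0.
have V2 (u : grid p q r) : size_grid u = size_grid a ->
    (forall x t, ft u x t <= 1) -> Vp2 u -> [/\ ~ Vp u, ~ Vpr u & ~ Vpq u].
  move=> e le1 v2; have nv := not_both u e v2; split=> // v; apply: nv.
    apply: (Vp2_Vpr_Vp p_pr r_pr pr v2 v) => x t.
    exact: leq_ltn_trans (le1 x t) r_gt1.
  apply: Vp_swap; apply: (@Vp2_Vpr_Vp p r q (swap_grid u)) => //.
    by move=> x t t'; rewrite ft_swap [RHS]ft_swap.
  by move=> x t; rewrite ft_swap; apply: leq_ltn_trans (le1 x t) q_gt1.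
have [v2b|nv2b] := lem (Vp2 b); last first.
  have same := same_x_of_not_Vp2 dab le1b nv2b.
  have E := size_p a erefl le1a same.
  exists true, false, true, true; split; first by rewrite E !expn1 !mulnA mulnn.
  move=> x x' t t' y y' z z' h h' /= s _ _.
  have ex := same _ _ _ _ _ _ _ _ h h'; subst x'.
  move: s; rewrite eqxx => /eqP ?; subst t'.
  by have [-> ->] := ft_leq1_inj (le1a x t) h h'.
have [nvpb nvprb nvpqb] := V2 b (esym eab) le1b v2b.
have npa : Np a by case: (dual_p dab).
have npra : Npr a by case: (dual_pr dab).
have npqa : Npq a by case: (dual_pq dab).
case: (dual_pqr dab) => [vpqrb|npqra]; last first.
  apply: inj_x_tile => // x t t' y y' z z' h h'.
  suff et : t = t' by subst t'; have [-> ->] := ft_leq1_inj (le1a x t) h h'.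
  have [//|e|e] := npqra _ _ _ _ _ _ _ h h'.
    by subst y'; case: (npra _ _ _ _ _ _ h h') => // e; subst z';
      exact: npa h h'.
  by subst z'; case: (npqa _ _ _ _ _ _ h h') => // e; subst y'; exact: npa h h'.
(* By [Vp2 b] a nonempty class has at least p points, and p nonempty classes would make the size
   p^2. *)
have [x1 mx] : exists x1, missing_x b x1.
  apply: contrapT => nE; case/negP: p2_n.
  have -> : size_grid a = p ^ 2; last exact: dvdnn.
  apply/eqP; rewrite eqn_leq size_leq_pp //= eab -mulnn.
  apply: sum_geq_ord => x; rewrite (Vp2_fx x i0 v2b) leq_pmulr // lt0n.
  apply/eqP => ft0; apply: nE; exists x => t y z; apply/negP => h.
  have : 0 < ft b x t by apply/ft_gt0P; exists y, z.
  by rewrite (v2b x t i0) ft0.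
have fR := missing_x_pqr mx vpqrb.
have [nVa|//] : [/\ ~ Vp a, ~ Vpr a & ~ Vpq a] \/ std_tile a.
  have [v2a|nv2a] := lem (Vp2 a); first by left; apply: V2.
  have E := size_p b (esym eab) le1b (same_x_of_not_Vp2 dba le1a nv2a).
  have [vpa|nvpa] := lem (Vp a).
    right; apply: inj_x_tile => // x t t' y y' z z' h h'.
    have fx1 : fx a x <= 1.
      move: E; rewrite (Vp_size x vpa) -[RHS]muln1 => /eqP.
      by rewrite eqn_mul2l => /orP[|/eqP->//]; have := p_gt1; lia.
    have et : t = t'.
      by apply: (sum_leq1_inj fx1); apply/ft_gt0P; [exists y, z|exists y', z'].
    by subst t'; have [-> ->] := ft_leq1_inj (le1a x t) h h'.
  left; split=> // v; apply: nvpa; first exact: Vpr_Vp_small p_pr r_pr pr E v.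
  by apply: Vp_swap; apply: (@Vpr_Vp_small p r q (swap_grid a)) => //;
    rewrite size_swap.
case: nVa => nvpa nvpra nvpqa; exfalso.
have npb : Np b by case: (dual_p dba).
have nprb : Npr b by case: (dual_pr dba).
have npqb : Npq b by case: (dual_pq dba).
have [x [t [y [z h]]]] : exists x t y z, b x t y z by apply/size_gt0P;
  rewrite -eab.
have [y' ney] := ord_other y q_gt1; have [z' nez] := ord_other z r_gt1.
have f0z : fxyz b x y z' = 0.
  apply/eqP; rewrite -leqn0 leqNgt; apply/fxyz_gt0P => -[t' h'].
  case: (nprb _ _ _ _ _ _ h' h) => // e; subst t'.
  by apply: nez; have [] := ft_leq1_inj (le1b x t) h' h.
have f0y : fxyz b x y' z = 0.
  apply/eqP; rewrite -leqn0 leqNgt; apply/fxyz_gt0P => -[t' h'].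
  case: (npqb _ _ _ _ _ _ h' h) => // e; subst t'.
  by apply: ney; have [] := ft_leq1_inj (le1b x t) h' h.
have f1 : 0 < fxyz b x y z by apply/fxyz_gt0P; exists t.
(* A positive entry cannot have zeros both in its row and in its column. *)
have := fR x y y' z z'; rewrite f0z f0y => /eqP;
  rewrite addn_eq0 => /andP[/eqP f0 _].
by rewrite f0 in f1.
Qed.

Lemma case_p_lt a b : q < r -> dual a b -> dual b a ->
  size_grid a = size_grid b -> 0 < size_grid a ->
  p %| size_grid a -> ~~ (q %| size_grid a) -> ~~ (r %| size_grid a) ->
  std_tile a.
Proof.
move=> lt_qr dab dba eab a_gt0 p_d q_n r_n.
have b_gt0 : 0 < size_grid b by rewrite -eab.
have [q_n' r_n'] :
  ~~ (q %| size_grid b) /\ ~~ (r %| size_grid b) by rewrite -eab.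
have nqra : Nqr a.
  case: (dual_qr dab) => // v; apply: contrapT => wild.
  exact: (case_p_absurd lt_qr dab dba).
have nqrb : Nqr b.
  case: (dual_qr dba) => // v; apply: contrapT => wild.
  exact: (case_p_absurd lt_qr dba dab (esym eab)).
apply: (case_p_thin dab dba) => // x t; apply: ft_leq1 => //.
- exact: dual_Nq dab q_n'.
- exact: dual_Nr dab r_n'.
- exact: dual_Nq dba q_n.
- exact: dual_Nr dba r_n.
Qed.


End Facts.


(** * The eight divisibility cases *)

Theorem spectral_grid_tile p q r (a b : grid p q r) :
  prime p -> prime q -> prime r -> p != q -> p != r -> q != r ->
  dual a b -> dual b a -> size_grid a = size_grid b -> 0 < size_grid a ->
  std_tile a.
Proof.
(* The order of q and r matters when neither divides the size; the cases distinguishing q from r are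
   also used with the two exchanged. *)
move=> p_pr; wlog: q r a b / q < r.
  move=> W q_pr r_pr pq pr qr dab dba eab a_gt0.
  have [lt|lt|eqr] := ltngtP q r; last by rewrite eqr eqxx in qr.
    exact: (W q r a b).
  apply: std_tile_swap; apply: (W r q (swap_grid a) (swap_grid b)) => //.
  - by rewrite eq_sym.
  - exact: dual_swap.
  - exact: dual_swap.
  - by rewrite (size_swap a) (size_swap b).
  - by rewrite (size_swap a).
move=> lt_qr q_pr r_pr pq pr qr dab dba eab a_gt0.
have rq : r != q by rewrite eq_sym.
have swap : std_tile (swap_grid a) -> std_tile a := @std_tile_swap p q r a.
have [dab' dba'] := (dual_swap dab, dual_swap dba).
have eab' :
  size_grid (swap_grid a) = size_grid (swap_grid b) by rewrite (size_swap a)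
    (size_swap b).
have [Ds a_gt0'] :
  size_grid (swap_grid a) = size_grid a /\ 0 < size_grid (swap_grid a).
  by rewrite (size_swap a).
have [p_d|p_n] := boolP (p %| size_grid a);
  have [q_d|q_n] := boolP (q %| size_grid a);
  have [r_d|r_n] := boolP (r %| size_grid a).
- exact: (case_pqr p_pr q_pr r_pr pq pr qr dab).
- exact: (case_pq p_pr q_pr r_pr pq pr qr dab dba).
- apply: swap; apply: (case_pq p_pr r_pr q_pr pr pq rq dab' dba') => //;
  by rewrite Ds.
- exact: (case_p_lt p_pr q_pr r_pr pq pr qr lt_qr dab dba).
- exact: (case_qr p_pr q_pr r_pr qr dab).
- exact: (case_q p_pr q_pr r_pr pq pr qr dab dba).
- apply: swap; apply: (case_q p_pr r_pr q_pr pr pq rq dab' dba') => //;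
  by rewrite Ds.
- exact: (case_none_lt p_pr q_pr r_pr pq pr qr lt_qr dab dba).
Qed.

(** * Vanishing sums of roots of unity *)

Module Fourier.

Import Order.TTheory GRing.Theory Num.Theory.
Local Open Scope ring_scope.

Section Conjugates.
Variable F : numFieldType.

(** X^d - 1 is the product of the cyclotomic polynomials of the divisors e of d; vanishing of the
    factor e makes z an e-th root of unity, so e = d. *)
Lemma root_Cyclotomic d (z : F) :
  d.-primitive_root z -> root (map_poly intr 'Phi_d) z.
Proof.
move=> zP; have d_gt0 := prim_order_gt0 zP.
have mapX e :
  (0 < e)%N ->
    \prod_(c <- divisors e) map_poly intr 'Phi_c = 'X^e - 1 :> {poly F}.
  by move=> e_gt0;
    rewrite -rmorph_prod prod_Cyclotomic // rmorphB /= map_polyXn rmorph1.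
have : root ('X^d - 1) z by rewrite rootE !hornerE (prim_expr_order zP) subrr.
rewrite -(mapX _ d_gt0) rootE horner_prod prodf_seq_eq0 => /hasP[e].
rewrite -dvdn_divisors //= => e_d ez.
have e_gt0 : (0 < e)%N by apply: dvdn_gt0 e_d.
suff /eqP <- : e == d by rewrite rootE.
rewrite eqn_dvd e_d (prim_order_dvd zP) /=.
have : root ('X^e - 1) z.
  rewrite -(mapX _ e_gt0) rootE horner_prod prodf_seq_eq0; apply/hasP;
    exists e => //.
  by rewrite -dvdn_divisors.
by rewrite rootE !hornerE subr_eq0.
Qed.

(** The minimal polynomial Q of a primitive d-th root divides P or is coprime to P over the
    rationals. Minimality is obtained in [algC], and the rational coefficients carry the dichotomy
    over to F. *)
Lemma prim_root_conjugate (P : {poly int}) d (z w : F) :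
  d.-primitive_root z -> d.-primitive_root w ->
  root (map_poly intr P) z -> root (map_poly intr P) w.
Proof.
move=> zP wP Pz.
have [x xP] := C_prim_root_exists (prim_order_gt0 zP).
have [Q [DQ monQ] dvQ] := minCpolyP x.
have ratZ (K : {poly int}) (E : numFieldType) :
    map_poly (ratr : rat -> E) (map_poly intr K) = map_poly intr K.
  by rewrite -map_poly_comp; apply: eq_map_poly => c; rewrite /= ratr_int.
have EQ : Q = map_poly intr 'Phi_d.
  apply: (map_poly_inj (ratr : {rmorphism rat -> algC})) => /=.
  transitivity (minCpoly x); first by rewrite DQ.
  rewrite (minCpoly_cyclotomic xP) -(Cintr_Cyclotomic xP); exact/esym/ratZ.
pose p : {poly rat} := map_poly intr P.
have rootQ y : d.-primitive_root y -> root (map_poly (ratr : rat -> F) Q) y.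
  by move=> yP; rewrite EQ ratZ; apply: root_Cyclotomic.
have [/dvdpP[k Dp]|nQp] := boolP (Q %| p).
  by rewrite -ratZ -/p Dp rmorphM rootM rootQ // orbT.
have Q0 : Q != 0 := monic_neq0 monQ.
have cQp : coprimep Q p.
  rewrite /coprimep.
  have [h Dh] : exists h, Q = h * gcdp Q p by apply/dvdpP; apply: dvdp_gcdl.
  have : root (map_poly ratr Q) x by rewrite dvQ dvdpp.
  have [h0 g0] : h != 0 /\ gcdp Q p != 0.
    by move: Q0; rewrite {1}Dh mulf_eq0 negb_or => /andP[].
  rewrite {1}Dh rmorphM rootM => /orP[]; rewrite dvQ => dv.
    have := dvdp_leq h0 dv; rewrite {1}Dh size_mul //.
    have gP : (0 < size (gcdp Q p))%N by rewrite size_poly_gt0.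
    rewrite -ltnS prednK ?addn_gt0 ?gP ?orbT // -addn1 leq_add2l => le1.
    by rewrite eqn_leq le1.
  by case/negP: nQp; apply: dvdp_trans dv (dvdp_gcdr _ _).
have := rootQ _ zP => /(coprimep_root _);
  have : coprimep (map_poly (ratr :
    rat -> F) Q) (map_poly ratr p) by rewrite coprimep_map.
by move=> c /(_ _ c); rewrite -rootE ratZ Pz.
Qed.

End Conjugates.

Section Alternating.
Variables (F : numFieldType) (I : finType) (S : {set I}) (v : I -> nat).
Variables (d : nat) (z : F).
Hypothesis zP : d.-primitive_root z.
Hypothesis sum0 : \sum_(x in S) z ^+ v x = 0.

Definition residue_count i := (\sum_(x in S) (v x == i %[mod d]))%N.

Lemma sum_conjugate0 j : coprime j d -> \sum_(x in S) z ^+ (j * v x) = 0.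
Proof.
move=> co; pose P : {poly int} := \sum_(x in S) 'X^(v x).
have EP y : (map_poly intr P).[y] = \sum_(x in S) y ^+ v x :> F.
  rewrite rmorph_sum horner_sum; apply: eq_bigr => x _.
  by rewrite /= map_polyXn hornerXn.
have : root (map_poly intr P) (z ^+ j).
  apply: (prim_root_conjugate zP); first by rewrite prim_root_exp_coprime.
  by rewrite rootE EP sum0.
by rewrite rootE EP => /eqP e; rewrite -[RHS]e; apply: eq_bigr => x _;
  rewrite exprM.
Qed.

Lemma z_neq0 : z != 0.
Proof. by rewrite (prim_root_eq0 zP) -lt0n (prim_order_gt0 zP). Qed.

Lemma residue_countE i : d%:R * (residue_count i)%:R =
  \sum_(j < d) z ^- (j * i) * \sum_(x in S) z ^+ (j * v x).
Proof.
under eq_bigr do rewrite mulr_sumr; rewrite exchange_big /= natr_sum mulr_sumr.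
apply: eq_bigr => x _.
pose y := z ^+ v x / z ^+ i.
have Ey (j : 'I_d) : z ^- (j * i) * z ^+ (j * v x) = y ^+ j.
  by rewrite /y expr_div_n -!exprM mulrC ![(j * _)%N]mulnC.
rewrite (eq_bigr _ (fun j _ => Ey j)).
have zi0 : z ^+ i != 0 by rewrite expf_neq0 ?z_neq0.
have [e|ne] := boolP (v x == i %[mod d]).
  have -> : y = 1 by rewrite /y (eqP (_ :
    z ^+ v x == z ^+ i)) ?divff // (eq_prim_root_expr zP).
  by under eq_bigr do rewrite expr1n; rewrite sumr_const card_ord mulr1.
rewrite mulr0; have y1 : y - 1 != 0.
  rewrite subr_eq0; apply: contra ne => /eqP y1;
    rewrite -(eq_prim_root_expr zP).
  by rewrite -[z ^+ v x](divfK zi0) -/y y1 mul1r.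
have : (y - 1) * \sum_(j < d) y ^+ j = 0.
  rewrite -subrX1 /y expr_div_n -!exprM ![(_ * d)%N]mulnC !exprM.
  by rewrite (prim_expr_order zP) !expr1n divr1 subrr.
by move/eqP; rewrite mulf_eq0 (negPf y1) /= => /eqP.
Qed.

(** Iterated difference operator; on a character it multiplies by a product of
    factors 1 - z ^- (j * h). *)
Fixpoint alternate (G : nat -> F) (hs : seq nat) i :=
  if hs is h :: hs' then alternate G hs' i - alternate G hs' (i + h)%N else G i.

Lemma alternate_char j c hs i :
  alternate (fun i => z ^- (j * i) * c) hs i =
  z ^- (j * i) * c * \prod_(h <- hs) (1 - z ^- (j * h)).
Proof.
elim: hs i => [|h hs IH] i /=; first by rewrite big_nil mulr1.
by rewrite big_cons !IH mulnDr exprD invfM; ring.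
Qed.

Lemma alternate_sum (G : 'I_d -> nat -> F) hs i :
  alternate (fun i => \sum_j G j i) hs i = \sum_j alternate (G j) hs i.
Proof. by elim: hs i => //= h hs IH i; rewrite !IH sumrB. Qed.

Lemma alternate_scale (G : nat -> F) (c : F) hs i :
  alternate (fun i => c * G i) hs i = c * alternate G hs i.
Proof. by elim: hs i => //= h hs IH i; rewrite !IH mulrBr. Qed.

Lemma eq_alternate (G H : nat -> F) hs i :
  G =1 H -> alternate G hs i = alternate H hs i.
Proof. by move=> e; elim: hs i => //= h hs IH i; rewrite !IH. Qed.

(** Expand the counts in characters j. If j is prime to d, its sum vanishes by conjugation; if a
    prime l divides j and d, the side h with d | l h makes the factor 1 - z^(-j h) zero. *)
Lemma alternate_count0 hs i :
  (forall l, prime l -> (l %| d)%N -> exists2 h, h \in hs & (d %| l * h)%N) ->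
  alternate (fun i => (residue_count i)%:R) hs i = 0.
Proof.
move=> H;
  have d0 : d%:R != 0 :> F by rewrite pnatr_eq0 -lt0n (prim_order_gt0 zP).
apply: (mulfI d0); rewrite mulr0 -alternate_scale.
rewrite (eq_alternate _ _ residue_countE) alternate_sum big1 // => j _.
rewrite (alternate_char j (\sum_(x in S) z ^+ (j * v x))).
have [co|nco] := boolP (coprime j d);
  first by rewrite sum_conjugate0 // mulr0 mul0r.
have g1 : (1 < gcdn j d)%N.
  by rewrite ltn_neqAle eq_sym nco gcdn_gt0 (prim_order_gt0 zP) orbT.
have [l l_pr] := pdivP g1; rewrite dvdn_gcd => /andP[/dvdnP[k Ej] l_d].
have [h h_in d_lh] := H l l_pr l_d.
have -> : \prod_(h <- hs) (1 - z ^- (j * h)) = 0.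
  apply/eqP; rewrite prodf_seq_eq0; apply/hasP; exists h => //=.
  have : z ^+ (j * h) == 1 by rewrite -(prim_order_dvd zP) Ej -mulnA dvdn_mull.
  by move/eqP->; rewrite invr1 subrr.
by rewrite mulr0.
Qed.

Lemma residue_count_shift h i :
  (forall l, prime l -> (l %| d)%N -> (d %| l * h)%N) ->
  residue_count i = residue_count (i + h).
Proof.
move=> H; have := @alternate_count0 [:: h] i _; rewrite /=.
move=> e; apply/eqP; rewrite -(eqr_nat F) -subr_eq0 e // => l l_pr l_d.
by exists h; rewrite ?inE ?H.
Qed.

Lemma residue_count_rect h1 h2 i :
  (forall l, prime l -> (l %| d)%N -> (d %| l * h1)%N \/ (d %| l * h2)%N) ->
  (residue_count i + residue_count (i + h1 + h2) =
   residue_count (i + h1) + residue_count (i + h2))%N.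
Proof.
move=> H; have := @alternate_count0 [:: h1; h2] i _; rewrite /=.
move=> e; apply/eqP; rewrite -(eqr_nat F) !natrD -subr_eq0.
rewrite -[X in _ == X]e; last first.
  move=> l l_pr l_d; case: (H l l_pr l_d) => dv; [exists h1|exists h2] => //;
  by rewrite !inE eqxx ?orbT.
by apply/eqP; ring.
Qed.

Lemma residue_count_box h1 h2 h3 i :
  (forall l, prime l -> (l %| d)%N ->
     [\/ (d %| l * h1)%N, (d %| l * h2)%N | (d %| l * h3)%N]) ->
  (residue_count i + residue_count (i + h2 + h3) +
   residue_count (i + h1 + h3) + residue_count (i + h1 + h2) =
   residue_count (i + h1 + h2 + h3) + residue_count (i + h1) +
   residue_count (i + h2) + residue_count (i + h3))%N.
Proof.
move=> H; have := @alternate_count0 [:: h1; h2; h3] i _; rewrite /=.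
move=> e; apply/eqP; rewrite -(eqr_nat F) !natrD -subr_eq0.
rewrite -[X in _ == X]e; last first.
  move=> l l_pr l_d; case: (H l l_pr l_d) => dv;
    [exists h1|exists h2|exists h3] => //;
  by rewrite !inE eqxx ?orbT.
by apply/eqP; ring.
Qed.

End Alternating.
End Fourier.

Module Spectrum.

Import Order.TTheory GRing.Theory Num.Theory.
Local Open Scope ring_scope.
Local Open Scope complex_scope.

(** * The character table of a spectral pair *)

Section RootOfUnity.
Variables (R : realType) (n : nat).
Hypothesis n_gt1 : (1 < n)%N.

Let n0 : n%:R != 0 :> R.
Proof. by rewrite pnatr_eq0 -lt0n ltnW. Qed.

Definition omega : R[i] := cos (2 * pi / n%:R) +i* sin (2 * pi / n%:R).

Lemma expi_exp (t : R) m :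
  (cos t +i* sin t) ^+ m = cos (t *+ m) +i* sin (t *+ m).
Proof.
elim: m => [|m IH]; first by rewrite expr0 !mulr0n cos0 sin0.
rewrite exprS IH mulrS cosD sinD; apply/eqP.
by rewrite eq_complex /= eqxx /= addrC.
Qed.

Lemma chiE (k x : 'Z_n) : chi R k x = omega ^+ (k * x).
Proof.
rewrite /chi /omega expi_exp -[_ *+ (k * x)]mulr_natr natrM.
have -> : 2 * pi * (k : nat)%:R * (x : nat)%:R / n%:R =
  2 * pi / n%:R * ((k : nat)%:R * (x : nat)%:R) :> R by ring.
by [].
Qed.

(** If 0 < i < n and cos 2t = 1 for t = i pi / n, then sin t = 0, whereas sin is positive on ]0,
    pi[. *)
Lemma omega_prim : n.-primitive_root omega.
Proof.
rewrite /primitive_root_of_unity ltnW //=; apply/forallP => i; apply/eqP.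
have -> : i.+1.-unity_root omega = (omega ^+ i.+1 == 1) by rewrite unity_rootE.
have Ei : omega ^+ i.+1 = cos ((i.+1%:R / n%:R * pi) *+ 2) +i* sin ((i.+1%:R /
  n%:R * pi) *+ 2).
  rewrite /omega expi_exp.
  have -> : (2 * pi / n%:R) *+ i.+1 = (i.+1%:R / n%:R * pi) *+ 2 :> R.
    by rewrite -[LHS]mulr_natr -[RHS]mulr_natr; ring.
  by [].
rewrite Ei; have [e|ne] := eqVneq i.+1 n.
  by rewrite e divff ?n0 // mul1r cos2pi sin2pi eqxx.
apply/eqP => -[+ _]; rewrite cos_mulr2n cos2sin2.
set t := _ * pi; have t_gt0 : 0 < sin t.
  have n_gt0 : 0 < n%:R :> R by rewrite ltr0n ltnW.
  have i_gt0 : 0 < i.+1%:R :> R by rewrite ltr0n.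
  apply: sin_gt0_pi; apply/andP; split.
    by rewrite mulr_gt0 ?divr_gt0 // pi_gt0.
  rewrite gtr_pMl ?pi_gt0 // ltr_pdivrMr // mul1r ltr_nat.
  by rewrite ltn_neqAle ne; apply: ltn_ord.
have s_gt0 : 0 < sin t ^+ 2 by rewrite exprn_gt0.
move=> e; have : sin t ^+ 2 *+ 2 = 0.
  have -> : sin t ^+ 2 *+ 2 = 1 - ((1 - sin t ^+ 2) *+ 2 - 1) by ring.
  by rewrite e subrr.
by move/eqP; rewrite mulrn_eq0 /= gt_eqF.
Qed.

Lemma omega_neq0 : omega != 0.
Proof. by rewrite (prim_root_eq0 omega_prim) -lt0n ltnW. Qed.

Lemma omega_conj m : ((omega ^+ m)^*)%R = omega ^- m.
Proof.
change (conjc (omega ^+ m) = omega ^- m).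
apply: (mulfI (expf_neq0 m omega_neq0));
  rewrite divff ?expf_neq0 ?omega_neq0 //.
rewrite /omega expi_exp; apply/eqP; rewrite eq_complex /=.
by rewrite !mulrN opprK -!expr2 cos2Dsin2 eqxx /= mulrC addNr.
Qed.

Definition orthogonal (S L : {set 'Z_n}) :=
  {in L &, forall k l : 'Z_n, k != l ->
    \sum_(x in S) (omega ^+ k / omega ^+ l) ^+ x = 0}.

Lemma mulmx1C_cast (F : fieldType) m k (A : 'M[F]_(m, k)) (B : 'M_(k, m)) :
  m = k -> A *m B = 1%:M -> B *m A = 1%:M.
Proof. by move=> e; subst k; apply: mulmx1C. Qed.

(** For M the table and N its normalized adjoint, M N = 1 gives |L| <= |S|, and spanning gives the
    converse. Being square, the matrices satisfy N M = 1, whose entries off the diagonal are the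
    second orthogonality. *)
Lemma spectral_orthogonal (S : {set 'Z_n}) : spectral R S ->
  S != set0 /\ exists L : {set 'Z_n},
    [/\ #|L| = #|S|, orthogonal S L & orthogonal L S].
Proof.
move=> [S0 [L [orth span]]]; split=> //; exists L.
have S_gt0 : (0 < #|S|)%N by rewrite card_gt0.
have oSL : orthogonal S L.
  move=> k l kL lL ne; have := orth k l kL lL ne; rewrite /inner => e.
  rewrite -[RHS]e big_sub; apply: eq_bigr => x _.
  rewrite !ffunE !chiE omega_conj expr_div_n -!exprM.
  by congr (_ * _).
have le_SL : (#|S| <= #|L|)%N.
  have := dim_span [seq chi_on R S k | k in L].
  by rewrite span dimvf /dim /= card_sig muln1 size_map -cardE.
pose kk (i : 'I_#|L|) : 'Z_n := enum_val i.
pose ss (j : 'I_#|S|) : 'Z_n := enum_val j.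
pose M : 'M[R[i]]_(#|L|, #|S|) := \matrix_(i, j) omega ^+ (kk i * ss j).
pose N : 'M[R[i]]_(#|S|, #|L|) :=
  \matrix_(j, i) (omega ^- (kk i * ss j) / #|S|%:R).
have S_neq0 : #|S|%:R != 0 :> R[i] by rewrite pnatr_eq0 -lt0n.
have pow (a b c : nat) :
    omega ^+ (a * c) * omega ^- (b * c) = (omega ^+ a / omega ^+ b) ^+ c.
  by rewrite expr_div_n -!exprM.
have MN : M *m N = 1%:M.
  apply/matrixP => i i'; rewrite !mxE.
  have -> : \sum_j M i j * N j i' =
      (\sum_(x in S) (omega ^+ kk i / omega ^+ kk i') ^+ x) / #|S|%:R.
    rewrite mulr_suml [RHS]big_enum_val; apply: eq_bigr => j _.
    by rewrite !mxE mulrA pow.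
  have [<-|ne] := eqVneq i i'.
    rewrite divff ?expf_neq0 ?omega_neq0 //.
    by under eq_bigr do rewrite expr1n; rewrite sumr_const divff.
  rewrite oSL ?mul0r ?enum_valP //.
  by apply: contra_neq ne => /enum_val_inj.
have cLS : #|L| = #|S|.
  by apply/eqP; rewrite eqn_leq le_SL andbT; apply: mulmx1_min MN.
split=> //.
have NM := mulmx1C_cast cLS MN.
move=> x y xS yS ne.
have := congr1 (fun A : 'M_(#|S|) =>
  A (enum_rank_in yS y) (enum_rank_in xS x)) NM.
rewrite !mxE.
have -> : (enum_rank_in yS y == enum_rank_in xS x) = false.
  apply/negP => /eqP/(congr1 enum_val); rewrite !enum_rankK_in // => e.
  by move: ne; rewrite e eqxx.
move=> e; apply: (mulIf (invr_neq0 S_neq0)); rewrite mul0r -[RHS]e mulr_suml.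
rewrite [LHS]big_enum_val; apply: eq_bigr => i _;
  rewrite !mxE /ss !enum_rankK_in //.
by rewrite -pow -/(kk i) [RHS]mulrC mulrA ![(kk i * _)%N]mulnC.
Qed.

Lemma ratio_prim (k l : 'Z_n) d e : n = (d * e)%N ->
  gcdn (k + (n - l)) n = e -> d.-primitive_root (omega ^+ k / omega ^+ l).
Proof.
move=> En Eg.
have e_gt0 : (0 < e)%N by rewrite -Eg gcdn_gt0 (ltnW n_gt1) orbT.
have ln : (l <= n)%N.
  by apply: ltnW; rewrite -[X in (_ < X)%N](Zp_cast n_gt1); apply: ltn_ord.
have -> : omega ^+ k / omega ^+ l = omega ^+ (k + (n - l)).
  apply: (mulIf (expf_neq0 l omega_neq0));
    rewrite divfK ?expf_neq0 ?omega_neq0 //.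
  by rewrite -exprD -addnA subnK // exprD (prim_expr_order omega_prim) mulr1.
have := exp_prim_root omega_prim (k + (n - l)).
by rewrite Eg {1}En mulnK.
Qed.

End RootOfUnity.
End Spectrum.

(** * Cuboids of residues under a vanishing character sum *)

Lemma gcdn_coprime_mul d a b :
  coprime a b -> gcdn d (a * b) = gcdn d a * gcdn d b.
Proof.
move=> co; apply/eqP; rewrite eqn_dvd; apply/andP; split.
  rewrite muln_gcdr !muln_gcdl !dvdn_gcd.
  have [gd gab] := (dvdn_gcdl d (a * b), dvdn_gcdr d (a * b)).
  by rewrite gab !(dvdn_mulr _ gd) (dvdn_mull _ gd).
have co' : coprime (gcdn d a) (gcdn d b).
  by apply: coprime_dvdl (dvdn_gcdr _ _) _;
    apply: coprime_dvdr (dvdn_gcdr _ _) co.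
rewrite Gauss_dvd // !dvdn_gcd !dvdn_gcdl /=.
by rewrite (dvdn_mulr _ (dvdn_gcdr d a)) (dvdn_mull _ (dvdn_gcdr d b)).
Qed.

(** a' - a is a multiple of d / l for all primes l dividing d: an admissible
    side for a cuboid modulo d. *)
Definition near d a a' :=
  forall l, prime l -> l %| d -> l * a = l * a' %[mod d].

Lemma near_prime d a a' : prime d -> near d a a'.
Proof.
move=> d_pr l l_pr; rewrite dvdn_prime2 // => /eqP->.
by rewrite !modnMr.
Qed.

Lemma near_sq p a a' : prime p -> a = a' %[mod p] -> near (p ^ 2) a a'.
Proof.
move=> p_pr e l l_pr l_d; have -> : l = p.
  by apply/eqP; rewrite -dvdn_prime2 //; move: l_d;
    rewrite Euclid_dvdX // => /andP[].
by rewrite -mulnn -!muln_modr e.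
Qed.

(** A natural number congruent to a' - a modulo d: d * a - a is a genuine difference and represents
    -a. *)
Definition offset d a a' := a' + (d * a - a).

Lemma offset_add d a a' : 0 < d -> a + offset d a a' = a' %[mod d].
Proof.
move=> d_gt0; rewrite /offset addnCA subnKC ?leq_pmull //.
by rewrite addnC mulnC modnMDl.
Qed.

Lemma offset_dvd d a a' l m : m %| d -> 0 < d -> l * a = l * a' %[mod m] ->
  m %| l * offset d a a'.
Proof.
move=> m_d d_gt0 e;
  have le : l * a <= l * (d * a) by rewrite leq_mul2l leq_pmull ?orbT.
rewrite /offset mulnDr mulnBr addnBA // -eqn_mod_dvd; last first.
  by apply: leq_trans le _; rewrite leq_addl.
have -> : l * (d * a) = l * a * (d %/ m) * m by rewrite -mulnA divnK //; ring.
by rewrite addnC modnMDl e.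
Qed.

Lemma eq_mod_dvd m d x y : m %| d -> x = y %[mod d] -> x = y %[mod m].
Proof.
by move=> md e; rewrite -(modn_dvdm x md) -(modn_dvdm y md) e.
Qed.

Lemma addn_dvd_mod m h x : m %| h -> x + h = x %[mod m].
Proof. by move=> /eqP e; rewrite -modnDmr e addn0. Qed.

Section Residues.
Variables (F : numFieldType) (I : finType) (S : {set I}) (v : I -> nat).

Lemma eq_residue_count d i i' : i = i' %[mod d] ->
  Fourier.residue_count S v d i = Fourier.residue_count S v d i'.
Proof. by move=> e; apply: eq_bigr => x _; rewrite e. Qed.

Definition vanishing d :=
  (exists2 z : F, d.-primitive_root z & \sum_(x in S) z ^+ v x = 0)%R.

Lemma vanishing_gt0 d : vanishing d -> 0 < d.
Proof. by case=> z /prim_order_gt0. Qed.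

Lemma vanishing_near d a a' : vanishing d -> near d a a' ->
  Fourier.residue_count S v d a = Fourier.residue_count S v d a'.
Proof.
move=> V nr; have d_gt0 := vanishing_gt0 V; case: V => z zP z0.
rewrite (Fourier.residue_count_shift zP z0 (h := offset d a a')).
  by apply: eq_residue_count; apply: offset_add.
by move=> l l_pr l_d; apply: offset_dvd => //; apply: nr.
Qed.

(** Side h1 is 0 modulo d2 and admissible modulo d1, and h2 the reverse. The Chinese remainder
    theorem identifies the sum of the sides with the opposite corner, which is only given by its
    residues. *)
Lemma vanishing_rect d1 d2 (a : bool -> bool -> nat) :
  coprime d1 d2 -> vanishing (d1 * d2) ->
  (forall i j j', a i j = a i j' %[mod d1]) ->
  (forall i i' j, a i j = a i' j %[mod d2]) ->
  near d1 (a false false) (a true false) ->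
  near d2 (a false false) (a false true) ->
  let N i j := Fourier.residue_count S v (d1 * d2) (a i j) in
  N false false + N true true = N true false + N false true.
Proof.
move=> co V H1 H2 n1 n2 /=; have d_gt0 := vanishing_gt0 V; case: V => z zP z0.
set d := d1 * d2 in d_gt0 *.
pose h1 := offset d (a false false) (a true false).
pose h2 := offset d (a false false) (a false true).
have [d1d d2d] : d1 %| d /\ d2 %| d by rewrite dvdn_mulr // dvdn_mull.
have E1 := offset_add (a false false) (a true false) d_gt0.
have E2 := offset_add (a false false) (a false true) d_gt0.
rewrite -(eq_residue_count E1) -(eq_residue_count E2) -/h1 -/h2.
have h1d2 l : d2 %| l * h1.
  by apply: offset_dvd => //; rewrite -modnMmr (H2 _ true) modnMmr.
have h2d1 l : d1 %| l * h2.
  by apply: offset_dvd => //; rewrite -modnMmr (H1 _ _ true) modnMmr.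
rewrite -(Fourier.residue_count_rect zP z0 (h1 := h1) (h2 := h2)); last first.
  move=> l l_pr; rewrite Euclid_dvdM // => /orP[l_d|l_d]; [left|right].
    by rewrite Gauss_dvd // h1d2 andbT; apply: offset_dvd => //; apply: n1.
  by rewrite Gauss_dvd // h2d1; apply: offset_dvd => //; apply: n2.
congr (_ + _); apply: eq_residue_count; apply/eqP; rewrite chinese_remainder //.
have D m h x : (forall l, m %| l * h) -> x + h = x %[mod m].
  by move=> dv; apply: addn_dvd_mod; rewrite -[h]mul1n.
apply/andP; split.
  rewrite (D _ _ _ h2d1) (eq_mod_dvd d1d E1).
  by rewrite (H1 true true false).
rewrite addnAC (D _ _ _ h1d2) (eq_mod_dvd d2d E2).
by rewrite (H2 true false true).
Qed.

Lemma vanishing_box d1 d2 d3 (a : bool -> bool -> bool -> nat) :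
  coprime d1 d2 -> coprime d1 d3 -> coprime d2 d3 ->
  vanishing (d1 * (d2 * d3)) ->
  (forall i j j' k k', a i j k = a i j' k' %[mod d1]) ->
  (forall i i' j k k', a i j k = a i' j k' %[mod d2]) ->
  (forall i i' j j' k, a i j k = a i' j' k %[mod d3]) ->
  near d1 (a false false false) (a true false false) ->
  near d2 (a false false false) (a false true false) ->
  near d3 (a false false false) (a false false true) ->
  let N i j k := Fourier.residue_count S v (d1 * (d2 * d3)) (a i j k) in
  N false false false + N false true true + N true false true +
    N true true false =
  N true true true + N true false false + N false true false +
    N false false true.
Proof.
move=> co12 co13 co23 V H1 H2 H3 n1 n2 n3 /=.
have d_gt0 := vanishing_gt0 V; case: V => z zP z0.
have co1 : coprime d1 (d2 * d3) by rewrite coprimeMr co12.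
set d := d1 * (d2 * d3) in d_gt0 *; set i := a false false false in n1 n2 n3 *.
pose h1 := offset d i (a true false false).
pose h2 := offset d i (a false true false).
pose h3 := offset d i (a false false true).
have [[d1d d2d] d3d] : (d1 %| d /\ d2 %| d) /\ d3 %| d.
  by split; [split|];
    [apply: dvdn_mulr|apply/dvdn_mull/dvdn_mulr|do 2!apply: dvdn_mull].
have E1 : i + h1 = a true false false %[mod d] := offset_add _ _ d_gt0.
have E2 : i + h2 = a false true false %[mod d] := offset_add _ _ d_gt0.
have E3 : i + h3 = a false false true %[mod d] := offset_add _ _ d_gt0.
have off m a' l : m %| d -> i = a' %[mod m] -> m %| l * offset d i a'.
  by move=> md e; apply: offset_dvd => //; rewrite -modnMmr e modnMmr.
have [h1d2 h1d3] : (forall l, d2 %| l * h1) /\ (forall l, d3 %| l * h1).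
  by split=> l; apply: off => //; [apply: H2|apply: H3].
have [h2d1 h2d3] : (forall l, d1 %| l * h2) /\ (forall l, d3 %| l * h2).
  by split=> l; apply: off => //; [apply: H1|apply: H3].
have [h3d1 h3d2] : (forall l, d1 %| l * h3) /\ (forall l, d2 %| l * h3).
  by split=> l; apply: off => //; [apply: H1|apply: H2].
have D m h x : (forall l, m %| l * h) -> x + h = x %[mod m].
  by move=> dv; apply: addn_dvd_mod; rewrite -[h]mul1n.
have crt x y : x = y %[mod d1] -> x = y %[mod d2] -> x = y %[mod d3] ->
    Fourier.residue_count S v d x = Fourier.residue_count S v d y.
  move=> e1 e2 e3; apply/eq_residue_count/eqP.
  by rewrite !chinese_remainder // e1 e2 e3 !eqxx.
have := @Fourier.residue_count_box F I S v d z zP z0 h1 h2 h3 i.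
rewrite -/d (eq_residue_count E1) (eq_residue_count E2) (eq_residue_count E3).
have -> : Fourier.residue_count S v d (i + h2 + h3) =
          Fourier.residue_count S v d (a false true true).
  apply: crt; first by rewrite (D _ _ _ h3d1) (D _ _ _ h2d1); apply: H1.
    by rewrite (D _ _ _ h3d2) (eq_mod_dvd d2d E2); apply: H2.
  by rewrite addnAC (D _ _ _ h2d3) (eq_mod_dvd d3d E3); apply: H3.
have -> : Fourier.residue_count S v d (i + h1 + h3) =
          Fourier.residue_count S v d (a true false true).
  apply: crt; first by rewrite (D _ _ _ h3d1) (eq_mod_dvd d1d E1); apply: H1.
    by rewrite (D _ _ _ h3d2) (D _ _ _ h1d2); apply: H2.
  by rewrite addnAC (D _ _ _ h1d3) (eq_mod_dvd d3d E3); apply: H3.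
have -> : Fourier.residue_count S v d (i + h1 + h2) =
          Fourier.residue_count S v d (a true true false).
  apply: crt; first by rewrite (D _ _ _ h2d1) (eq_mod_dvd d1d E1); apply: H1.
    by rewrite addnAC (D _ _ _ h1d2) (eq_mod_dvd d2d E2); apply: H2.
  by rewrite (D _ _ _ h2d3) (D _ _ _ h1d3); apply: H3.
have -> : Fourier.residue_count S v d (i + h1 + h2 + h3) =
          Fourier.residue_count S v d (a true true true).
  apply: crt.
  - by rewrite (D _ _ _ h3d1) (D _ _ _ h2d1) (eq_mod_dvd d1d E1); apply: H1.
  - rewrite (D _ _ _ h3d2) addnAC (D _ _ _ h1d2) (eq_mod_dvd d2d E2); exact: H2.
  - rewrite addnAC (D _ _ _ h2d3) addnAC (D _ _ _ h1d3) (eq_mod_dvd d3d E3).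
    exact: H3.
apply=> l l_pr l_d.
have /or3P[{}l_d|{}l_d|{}l_d] :
  [|| l %| d1, l %| d2 | l %| d3] by rewrite -!Euclid_dvdM.
- apply: Or31; rewrite !Gauss_dvd // h1d2 h1d3 !andbT.
  by apply: offset_dvd => //; apply: n1.
- apply: Or32; rewrite !Gauss_dvd // h2d1 h2d3 andbT /=.
  by apply: offset_dvd => //; apply: n2.
- apply: Or33; rewrite !Gauss_dvd // h3d1 h3d2 /=.
  by apply: offset_dvd => //; apply: n3.
Qed.

End Residues.

(** * Coordinates on Z_n *)

Section Coordinates.
Variables p q r n : nat.
Hypotheses (p_pr : prime p) (q_pr : prime q) (r_pr : prime r).
Hypotheses (pq : p != q) (pr : p != r) (qr : q != r).
Hypothesis En : n = p ^ 2 * q * r.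

Let p_gt0 : 0 < p. Proof. exact: prime_gt0. Qed.
Let q_gt0 : 0 < q. Proof. exact: prime_gt0. Qed.
Let r_gt0 : 0 < r. Proof. exact: prime_gt0. Qed.
Let x0 : 'I_p := Ordinal p_gt0.
Let y0 : 'I_q := Ordinal q_gt0.
Let z0 : 'I_r := Ordinal r_gt0.

Let co_pq : coprime p q. Proof. by rewrite prime_coprime // dvdn_prime2. Qed.
Let co_pr : coprime p r. Proof. by rewrite prime_coprime // dvdn_prime2. Qed.
Let co_qr : coprime q r. Proof. by rewrite prime_coprime // dvdn_prime2. Qed.
Let co_p2q : coprime (p ^ 2) q. Proof. exact: coprimeXl. Qed.
Let co_p2r : coprime (p ^ 2) r. Proof. exact: coprimeXl. Qed.

Let co_p2q_r : coprime (p ^ 2 * q) r. Proof. by rewrite coprimeMl co_p2r. Qed.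
Let co_p_qr : coprime p (q * r). Proof. by rewrite coprimeMr co_pq. Qed.
Let co_p2_qr : coprime (p ^ 2) (q * r). Proof. by rewrite coprimeMr co_p2q. Qed.

Lemma n_gt1 : 1 < n.
Proof.
rewrite En (leq_trans (prime_gt1 r_pr)) // leq_pmull //.
by rewrite muln_gt0 expn_gt0 p_gt0 q_gt0.
Qed.

Let Zn : (Zp_trunc n).+2 = n := Zp_cast n_gt1.

Lemma Zn_lt (s : 'Z_n) : s < n.
Proof. by rewrite -[X in _ < X]Zn; apply: ltn_ord. Qed.

Lemma digit_subproof (s : nat) : (s %% p ^ 2) %/ p < p.
Proof. by rewrite ltn_divLR // mulnn ltn_pmod // expn_gt0 p_gt0. Qed.

Definition cx (s : 'Z_n) : 'I_p := Ordinal (ltn_pmod s p_gt0).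
Definition ct (s : 'Z_n) : 'I_p := Ordinal (digit_subproof s).
Definition cy (s : 'Z_n) : 'I_q := Ordinal (ltn_pmod s q_gt0).
Definition cz (s : 'Z_n) : 'I_r := Ordinal (ltn_pmod s r_gt0).

Lemma cx_eq s s' : (cx s == cx s') = (s == s' %[mod p]).
Proof. by []. Qed.

Lemma cy_eq s s' : (cy s == cy s') = (s == s' %[mod q]).
Proof. by []. Qed.

Lemma cz_eq s s' : (cz s == cz s') = (s == s' %[mod r]).
Proof. by []. Qed.

Lemma cxt_eq s s' : (cx s == cx s') && (ct s == ct s') = (s == s' %[mod p ^ 2]).
Proof.
have p_p2 : p %| p ^ 2 by rewrite -mulnn dvdn_mulr.
rewrite cx_eq -val_eqE /=; apply/andP/eqP => [[/eqP e1 /eqP e2]|e].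
  rewrite (divn_eq (s %% p ^ 2) p) (divn_eq (s' %% p ^ 2) p) e2.
  by rewrite !(modn_dvdm _ p_p2) e1.
by rewrite e -(modn_dvdm s p_p2) e modn_dvdm.
Qed.

Lemma cx_mod s s' : cx s = cx s' -> s = s' %[mod p].
Proof. by move=> /eqP; rewrite cx_eq => /eqP. Qed.

Lemma cy_mod s s' : cy s = cy s' -> s = s' %[mod q].
Proof. by move=> /eqP; rewrite cy_eq => /eqP. Qed.

Lemma cz_mod s s' : cz s = cz s' -> s = s' %[mod r].
Proof. by move=> /eqP; rewrite cz_eq => /eqP. Qed.

Lemma cxt_mod s s' : cx s = cx s' -> ct s = ct s' -> s = s' %[mod p ^ 2].
Proof. by move=> ex et; apply/eqP; rewrite -cxt_eq ex et !eqxx. Qed.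

Definition coords s := (cx s, ct s, cy s, cz s).

Lemma coords_inj : injective coords.
Proof.
move=> s s' /eqP; rewrite /coords !xpair_eqE -!andbA.
move=> /and4P[/eqP ex /eqP et /eqP ey /eqP ez]; apply: val_inj => /=.
have /eqP : s == s' %[mod p ^ 2 * q * r].
  rewrite (chinese_remainder co_p2q_r) (chinese_remainder co_p2q).
  apply/andP; split; last by apply/eqP/cz_mod.
  by apply/andP; split; apply/eqP; [apply: cxt_mod|apply: cy_mod].
by rewrite -En !modn_small ?Zn_lt.
Qed.

Lemma coords_bij : bijective coords.
Proof.
apply: inj_card_bij coords_inj _.
by rewrite !card_prod !card_ord Zn En -mulnn.
Qed.

(** The default 0 is never returned, since [coords] is bijective. *)
Definition psi x t y z : 'Z_n := odflt 0%R [pick s | coords s == (x, t, y, z)].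

Lemma coords_psi x t y z : coords (psi x t y z) = (x, t, y, z).
Proof.
rewrite /psi; case: pickP => [s /eqP//|none].
have [g _ gK] := coords_bij.
by have := none (g (x, t, y, z)); rewrite gK eqxx.
Qed.

Lemma cx_psi x t y z : cx (psi x t y z) = x.
Proof. by have [] := coords_psi x t y z. Qed.

Lemma ct_psi x t y z : ct (psi x t y z) = t.
Proof. by have [] := coords_psi x t y z. Qed.

Lemma cy_psi x t y z : cy (psi x t y z) = y.
Proof. by have [] := coords_psi x t y z. Qed.

Lemma cz_psi x t y z : cz (psi x t y z) = z.
Proof. by have [] := coords_psi x t y z. Qed.

Definition grid_of (S : {set 'Z_n}) : grid p q r :=
  fun x t y z => [exists s in S, coords s == (x, t, y, z)].

Section Counting.
Variable S : {set 'Z_n}.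

Lemma grid_ofP x t y z : reflect
  (exists2 s, s \in S & [/\ cx s = x, ct s = t, cy s = y & cz s = z])
  (grid_of S x t y z).
Proof.
apply: (iffP exists_inP) => [[s sS /eqP[<- <- <- <-]]|[s sS [<- <- <- <-]]].
  by exists s.
by exists s.
Qed.

Definition count_in (P : pred 'Z_n) := \sum_(s in S) (P s : nat).

Lemma grid_ofE x t y z : grid_of S x t y z =
  count_in (fun s => [&& cx s == x, ct s == t, cy s == y & cz s == z]) :> nat.
Proof.
have E s : [&& cx s == x, ct s == t, cy s == y & cz s == z] =
    (coords s == (x, t, y, z)).
  by rewrite !xpair_eqE -!andbA.
have -> : count_in (fun s => [&& cx s == x, ct s == t, cy s == y & cz s == z]) =
    \sum_(s in S) (coords s == (x, t, y, z)).
  by apply: eq_bigr => s _; rewrite E.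
case G: (grid_of S x t y z).
  have /exists_inP[s sS /eqP e] := G.
  rewrite (bigD1 s) //= e eqxx big1 // => s' /andP[_ ne].
  by rewrite -e (inj_eq coords_inj) (negPf ne).
rewrite big1 // => s sS; case e: (coords s == _) => //.
by have /negP[] := negbT G; apply/exists_inP; exists s.
Qed.

Lemma sum_count_in (I : finType) (c : 'Z_n -> I) (P : pred 'Z_n)
    (Q : I -> pred 'Z_n) :
  (forall i s, Q i s = P s && (c s == i)) -> \sum_i count_in (Q i) = count_in P.
Proof.
move=> E; rewrite exchange_big; apply: eq_bigr => s _.
rewrite (bigD1 (c s)) //= big1 => [|i ne]; first by rewrite E eqxx andbT addn0.
by rewrite E eq_sym (negPf ne) andbF.
Qed.

Lemma fxyz_of x y z : fxyz (grid_of S) x y z =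
  count_in (fun s => [&& cx s == x, cy s == y & cz s == z]).
Proof.
rewrite -(sum_count_in (c := ct)
  (Q := fun t s => [&& cx s == x, ct s == t, cy s == y & cz s == z])).
  by apply: eq_bigr => t _; apply: grid_ofE.
by move=> t s; do !case: (_ == _).
Qed.

Lemma ftz_of x t z : ftz (grid_of S) x t z =
  count_in (fun s => [&& cx s == x, ct s == t & cz s == z]).
Proof.
rewrite -(sum_count_in (c := cy)
  (Q := fun y s => [&& cx s == x, ct s == t, cy s == y & cz s == z])).
  by apply: eq_bigr => y _; apply: grid_ofE.
by move=> y s; do !case: (_ == _).
Qed.

Lemma fty_of x t y : fty (grid_of S) x t y =
  count_in (fun s => [&& cx s == x, ct s == t & cy s == y]).
Proof.
rewrite -(sum_count_in (c := cz)
  (Q := fun z s => [&& cx s == x, ct s == t, cy s == y & cz s == z])).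
  by apply: eq_bigr => z _; apply: grid_ofE.
by move=> z s; do !case: (_ == _).
Qed.

Lemma fxz_of x z : fxz (grid_of S) x z =
  count_in (fun s => (cx s == x) && (cz s == z)).
Proof.
rewrite -(sum_count_in (c := ct)
  (Q := fun t s => [&& cx s == x, ct s == t & cz s == z])).
  by apply: eq_bigr => t _; apply: ftz_of.
by move=> t s; do !case: (_ == _).
Qed.

Lemma fxy_of x y : fxy (grid_of S) x y =
  count_in (fun s => (cx s == x) && (cy s == y)).
Proof.
rewrite -(sum_count_in (c := ct)
  (Q := fun t s => [&& cx s == x, ct s == t & cy s == y])).
  by apply: eq_bigr => t _; apply: fty_of.
by move=> t s; do !case: (_ == _).
Qed.

Lemma fyz_of y z : fyz (grid_of S) y z =
  count_in (fun s => (cy s == y) && (cz s == z)).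
Proof.
rewrite -(sum_count_in (c := cx)
  (Q := fun x s => [&& cx s == x, cy s == y & cz s == z])).
  by apply: eq_bigr => x _; apply: fxyz_of.
by move=> x s; do !case: (_ == _).
Qed.

Lemma ft_of x t : ft (grid_of S) x t =
  count_in (fun s => (cx s == x) && (ct s == t)).
Proof.
rewrite -(sum_count_in (c := cy)
  (Q := fun y s => [&& cx s == x, ct s == t & cy s == y])).
  by apply: eq_bigr => y _; apply: fty_of.
by move=> y s; do !case: (_ == _).
Qed.

Lemma fx_of x : fx (grid_of S) x = count_in (fun s => cx s == x).
Proof.
rewrite -(sum_count_in (c := ct) (Q := fun t s =>
  (cx s == x) && (ct s == t))) //.
by apply: eq_bigr => t _; apply: ft_of.
Qed.

Lemma fy_of y : fy (grid_of S) y = count_in (fun s => cy s == y).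
Proof.
rewrite -(sum_count_in (c := cz) (Q := fun z s =>
  (cy s == y) && (cz s == z))) //.
by apply: eq_bigr => z _; apply: fyz_of.
Qed.

Lemma fz_of z : fz (grid_of S) z = count_in (fun s => cz s == z).
Proof.
rewrite -(sum_count_in (c := cy) (Q := fun y s => (cy s == y) && (cz s == z))).
  by apply: eq_bigr => y _; apply: fyz_of.
by move=> y s; rewrite andbC.
Qed.

Lemma size_grid_of : size_grid (grid_of S) = #|S|.
Proof.
rewrite -sum1_card -[RHS]/(count_in xpredT).
rewrite -(sum_count_in (c := cx) (Q := fun x s => cx s == x)) //.
by apply: eq_bigr => x _; apply: fx_of.
Qed.

Variable F : numFieldType.

Notation residues d s :=
  (Fourier.residue_count S (fun u : 'Z_n => u : nat) d (nat_of_ord s)).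
Notation V d := (vanishing F S (fun u : 'Z_n => u : nat) d).

(** Any number with the right coordinates represents the residue class; those that the marginal
    ignores stay free, so the corners of a cuboid can be chosen uniformly. *)
Let fx_res x t y z : fx (grid_of S) x = residues p (psi x t y z).
Proof. by rewrite fx_of; apply: eq_bigr => s _; rewrite -cx_eq cx_psi. Qed.

Let fy_res x t y z : fy (grid_of S) y = residues q (psi x t y z).
Proof. by rewrite fy_of; apply: eq_bigr => s _; rewrite -cy_eq cy_psi. Qed.

Let fz_res x t y z : fz (grid_of S) z = residues r (psi x t y z).
Proof. by rewrite fz_of; apply: eq_bigr => s _; rewrite -cz_eq cz_psi. Qed.

Let ft_res x t y z : ft (grid_of S) x t = residues (p ^ 2) (psi x t y z).
Proof. by rewrite ft_of; apply: eq_bigr => s _;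
  rewrite -cxt_eq cx_psi ct_psi. Qed.

Let fxy_res x t y z : fxy (grid_of S) x y = residues (p * q) (psi x t y z).
Proof.
rewrite fxy_of; apply: eq_bigr => s _.
by rewrite (chinese_remainder co_pq) -cx_eq -cy_eq cx_psi cy_psi.
Qed.

Let fxz_res x t y z : fxz (grid_of S) x z = residues (p * r) (psi x t y z).
Proof.
rewrite fxz_of; apply: eq_bigr => s _.
by rewrite (chinese_remainder co_pr) -cx_eq -cz_eq cx_psi cz_psi.
Qed.

Let fyz_res x t y z : fyz (grid_of S) y z = residues (q * r) (psi x t y z).
Proof.
rewrite fyz_of; apply: eq_bigr => s _.
by rewrite (chinese_remainder co_qr) -cy_eq -cz_eq cy_psi cz_psi.
Qed.

Let fty_res x t y z :
  fty (grid_of S) x t y = residues (p ^ 2 * q) (psi x t y z).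
Proof.
rewrite fty_of; apply: eq_bigr => s _.
by rewrite (chinese_remainder co_p2q) -cxt_eq -cy_eq cx_psi ct_psi cy_psi andbA.
Qed.

Let ftz_res x t y z :
  ftz (grid_of S) x t z = residues (p ^ 2 * r) (psi x t y z).
Proof.
rewrite ftz_of; apply: eq_bigr => s _.
by rewrite (chinese_remainder co_p2r) -cxt_eq -cz_eq cx_psi ct_psi cz_psi andbA.
Qed.

Let fxyz_res x t y z :
  fxyz (grid_of S) x y z = residues (p * (q * r)) (psi x t y z).
Proof.
rewrite fxyz_of; apply: eq_bigr => s _.
rewrite (chinese_remainder co_p_qr) (chinese_remainder co_qr).
by rewrite -cx_eq -cy_eq -cz_eq cx_psi cy_psi cz_psi.
Qed.

Let grid_res x t y z :
  grid_of S x t y z = residues (p ^ 2 * (q * r)) (psi x t y z) :> nat.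
Proof.
rewrite grid_ofE; apply: eq_bigr => s _.
rewrite (chinese_remainder co_p2_qr) (chinese_remainder co_qr).
by rewrite -cxt_eq -cy_eq -cz_eq cx_psi ct_psi cy_psi cz_psi andbA.
Qed.

Lemma vanishing_Vp : V p -> Vp (grid_of S).
Proof.
move=> v x x'; rewrite !(fx_res _ x0 y0 z0).
by apply: (vanishing_near v); apply: near_prime.
Qed.

Lemma vanishing_Vq : V q -> Vq (grid_of S).
Proof.
move=> v y y'; rewrite !(fy_res x0 x0 _ z0).
by apply: (vanishing_near v); apply: near_prime.
Qed.

Lemma vanishing_Vr : V r -> Vr (grid_of S).
Proof.
move=> v z z'; rewrite !(fz_res x0 x0 y0).
by apply: (vanishing_near v); apply: near_prime.
Qed.

Lemma vanishing_Vp2 : V (p ^ 2) -> Vp2 (grid_of S).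
Proof.
move=> v x t t'; rewrite !(ft_res _ _ y0 z0).
by apply: (vanishing_near v); apply: (near_sq p_pr); apply: cx_mod;
  rewrite !cx_psi.
Qed.

Lemma vanishing_Vpq : V (p * q) -> Vpq (grid_of S).
Proof.
move=> v x x' y y'; rewrite [RHS]addnC !(fxy_res _ x0 _ z0).
apply: (vanishing_rect co_pq v
  (a := fun i j => psi (if i then x' else x) x0 (if j then y' else y) z0)).
- by move=> i j j'; apply: cx_mod; rewrite !cx_psi.
- by move=> i i' j; apply: cy_mod; rewrite !cy_psi.
- exact: near_prime.
- exact: near_prime.
Qed.

Lemma vanishing_Vpr : V (p * r) -> Vpr (grid_of S).
Proof.
move=> v x x' z z'; rewrite [RHS]addnC !(fxz_res _ x0 y0 _).
apply: (vanishing_rect co_pr v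
  (a := fun i j => psi (if i then x' else x) x0 y0 (if j then z' else z))).
- by move=> i j j'; apply: cx_mod; rewrite !cx_psi.
- by move=> i i' j; apply: cz_mod; rewrite !cz_psi.
- exact: near_prime.
- exact: near_prime.
Qed.

Lemma vanishing_Vqr : V (q * r) -> Vqr (grid_of S).
Proof.
move=> v y y' z z'; rewrite [RHS]addnC !(fyz_res x0 x0 _ _).
apply: (vanishing_rect co_qr v
  (a := fun i j => psi x0 x0 (if i then y' else y) (if j then z' else z))).
- by move=> i j j'; apply: cy_mod; rewrite !cy_psi.
- by move=> i i' j; apply: cz_mod; rewrite !cz_psi.
- exact: near_prime.
- exact: near_prime.
Qed.

Lemma vanishing_Vp2q : V (p ^ 2 * q) -> Vp2q (grid_of S).
Proof.
move=> v x t t' y y'; rewrite [RHS]addnC !(fty_res _ _ _ z0).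
apply: (vanishing_rect co_p2q v
  (a := fun i j => psi x (if i then t' else t) (if j then y' else y) z0)).
- by move=> i j j'; apply: cxt_mod; rewrite ?cx_psi ?ct_psi.
- by move=> i i' j; apply: cy_mod; rewrite !cy_psi.
- by apply: (near_sq p_pr); apply: cx_mod; rewrite !cx_psi.
- exact: near_prime.
Qed.

Lemma vanishing_Vp2r : V (p ^ 2 * r) -> Vp2r (grid_of S).
Proof.
move=> v x t t' z z'; rewrite [RHS]addnC !(ftz_res _ _ y0 _).
apply: (vanishing_rect co_p2r v
  (a := fun i j => psi x (if i then t' else t) y0 (if j then z' else z))).
- by move=> i j j'; apply: cxt_mod; rewrite ?cx_psi ?ct_psi.
- by move=> i i' j; apply: cz_mod; rewrite !cz_psi.
- by apply: (near_sq p_pr); apply: cx_mod; rewrite !cx_psi.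
- exact: near_prime.
Qed.

Lemma vanishing_Vpqr : V (p * (q * r)) -> Vpqr (grid_of S).
Proof.
move=> v x x' y y' z z'; rewrite !(fxyz_res _ x0 _ _).
apply: (vanishing_box co_pq co_pr co_qr v
  (a := fun i j k => psi (if i then x' else x) x0 (if j then y' else y)
                         (if k then z' else z))).
- by move=> i j j' k k'; apply: cx_mod; rewrite !cx_psi.
- by move=> i i' j k k'; apply: cy_mod; rewrite !cy_psi.
- by move=> i i' j j' k; apply: cz_mod; rewrite !cz_psi.
- exact: near_prime.
- exact: near_prime.
- exact: near_prime.
Qed.

Lemma vanishing_Vp2qr : V (p ^ 2 * (q * r)) -> Vp2qr (grid_of S).
Proof.
move=> v x t t' y y' z z'; rewrite !grid_res.
apply: (vanishing_box co_p2q co_p2r co_qr v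
  (a := fun i j k => psi x (if i then t' else t) (if j then y' else y)
                         (if k then z' else z))).
- by move=> i j j' k k'; apply: cxt_mod; rewrite ?cx_psi ?ct_psi.
- by move=> i i' j k k'; apply: cy_mod; rewrite !cy_psi.
- by move=> i i' j j' k; apply: cz_mod; rewrite !cz_psi.
- by apply: (near_sq p_pr); apply: cx_mod; rewrite !cx_psi.
- exact: near_prime.
- exact: near_prime.
Qed.

End Counting.

(** * Orders of differences and duality *)

Section Differences.
Variables k l : 'Z_n.

Lemma dvdn_diff d : d %| n -> (d %| k + (n - l)) = (k == l %[mod d]).
Proof.
move=> d_n; have ln : l <= n := ltnW (Zn_lt l).
rewrite addnBA // -eqn_mod_dvd; last by rewrite (leq_trans ln) ?leq_addl.
by rewrite -modnDmr (eqP d_n) addn0.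
Qed.

Lemma gcdn_diff : gcdn (k + (n - l)) n =
  gcdn (k + (n - l)) (p ^ 2) * gcdn (k + (n - l)) q * gcdn (k + (n - l)) r.
Proof.
set m := k + _; have -> : gcdn m n = gcdn m (p ^ 2 * q * r) by rewrite -En.
by rewrite (gcdn_coprime_mul _ co_p2q_r) (gcdn_coprime_mul _ co_p2q).
Qed.

Let q_n : q %| n. Proof. by rewrite En -mulnA dvdn_mull // dvdn_mulr. Qed.
Let r_n : r %| n. Proof. by rewrite En dvdn_mull. Qed.
Let p2_n : p ^ 2 %| n. Proof. by rewrite En -mulnA dvdn_mulr. Qed.
Let p_n : p %| n. Proof. by apply: dvdn_trans p2_n;
  rewrite -mulnn dvdn_mulr. Qed.

Lemma gcdn_diff_q : cy k = cy l -> gcdn (k + (n - l)) q = q.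
Proof. by move=> /cy_mod/eqP e; apply/gcdn_idPr; rewrite dvdn_diff. Qed.

Lemma gcdn_diff_q1 : cy k <> cy l -> gcdn (k + (n - l)) q = 1.
Proof.
move=> ne; apply/eqP; rewrite -/(coprime _ _) coprime_sym prime_coprime //.
by rewrite dvdn_diff // -cy_eq; apply/eqP.
Qed.

Lemma gcdn_diff_r : cz k = cz l -> gcdn (k + (n - l)) r = r.
Proof. by move=> /cz_mod/eqP e; apply/gcdn_idPr; rewrite dvdn_diff. Qed.

Lemma gcdn_diff_r1 : cz k <> cz l -> gcdn (k + (n - l)) r = 1.
Proof.
move=> ne; apply/eqP; rewrite -/(coprime _ _) coprime_sym prime_coprime //.
by rewrite dvdn_diff // -cz_eq; apply/eqP.
Qed.

Lemma gcdn_diff_p2 : cx k = cx l -> ct k = ct l ->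
  gcdn (k + (n - l)) (p ^ 2) = p ^ 2.
Proof.
by move=> ex et; apply/gcdn_idPr; rewrite dvdn_diff // -cxt_eq ex et !eqxx.
Qed.

Lemma gcdn_diff_p : cx k = cx l -> ct k <> ct l ->
  gcdn (k + (n - l)) (p ^ 2) = p.
Proof.
move=> ex et; set m := k + _.
have p_m : p %| m by rewrite dvdn_diff // -cx_eq ex.
have p2_m : ~~ (p ^ 2 %| m) by rewrite dvdn_diff // -cxt_eq ex eqxx; apply/eqP.
have /(dvdn_pfactor _ _ p_pr)[[|[|[|//]]] _ e] := dvdn_gcdr m (p ^ 2).
- have : p %| gcdn m (p ^ 2) by rewrite dvdn_gcd p_m -mulnn dvdn_mulr.
  by rewrite e expn0 dvdn1 gtn_eqF // prime_gt1.
- by rewrite e expn1.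
- by case/negP: p2_m; rewrite -e dvdn_gcdl.
Qed.

Lemma gcdn_diff_p1 : cx k <> cx l -> gcdn (k + (n - l)) (p ^ 2) = 1.
Proof.
move=> ne; apply/eqP; rewrite -/(coprime _ _) coprime_sym coprime_pexpl //.
by rewrite prime_coprime // dvdn_diff // -cx_eq; apply/eqP.
Qed.

End Differences.

Section Dual.
Local Open Scope complex_scope.
Variables (R : realType) (S L : {set 'Z_n}).
Hypothesis SL : Spectrum.orthogonal R S L.

(** The order of k - l is n divided by its gcd with n, and the coordinates give the parts of this
    gcd at p^2, q and r separately. *)
Lemma orthogonal_vanishing (k l : 'Z_n) gp gq gr d :
  k \in L -> l \in L -> k <> l ->
  gcdn (k + (n - l)) (p ^ 2) = gp -> gcdn (k + (n - l)) q = gq ->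
  gcdn (k + (n - l)) r = gr -> p ^ 2 * q * r = d * (gp * gq * gr) ->
  vanishing R[i] S (fun u : 'Z_n => u : nat) d.
Proof.
move=> kL lL ne <- <- <- e.
exists (Spectrum.omega R n ^+ k / Spectrum.omega R n ^+ l)%R.
  by apply: (Spectrum.ratio_prim R n_gt1 _ (gcdn_diff k l)); rewrite -e En.
by apply: SL => //; apply/eqP.
Qed.

Lemma grid_dual : dual (grid_of L) (grid_of S).
Proof.
split.
- have [v|nv] := lem (Vp (grid_of S)); [by left|right].
  move=> x t t' y z /grid_ofP[k kL [<- <- <- <-]] /grid_ofP[l lL [ex et ey ez]].
  rewrite -et; apply: contrapT => ne; apply/nv/(@vanishing_Vp _ R[i]).
  apply: (orthogonal_vanishing kL lL _ (gcdn_diff_p (esym ex) ne)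
    (gcdn_diff_q (esym ey)) (gcdn_diff_r (esym ez))); last by ring.
  by move=> e; apply: ne; rewrite e.
- have [v|nv] := lem (Vp2 (grid_of S)); [by left|right].
  move=> x x' t t' y z /grid_ofP[k kL [<- _ <- <-]] /grid_ofP[l lL [ex et ey
    ez]].
  rewrite -ex; apply: contrapT => ne; apply/nv/(@vanishing_Vp2 _ R[i]).
  apply: (orthogonal_vanishing kL lL _ (gcdn_diff_p1 ne)
    (gcdn_diff_q (esym ey)) (gcdn_diff_r (esym ez))); last by ring.
  by move=> e; apply: ne; rewrite e.
- have [v|nv] := lem (Vq (grid_of S)); [by left|right].
  move=> x t y y' z /grid_ofP[k kL [<- <- <- <-]] /grid_ofP[l lL [ex et ey ez]].
  rewrite -ey; apply: contrapT => ne; apply/nv/(@vanishing_Vq _ R[i]).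
  apply: (orthogonal_vanishing kL lL _ (gcdn_diff_p2 (esym ex) (esym et))
    (gcdn_diff_q1 ne) (gcdn_diff_r (esym ez))); last by ring.
  by move=> e; apply: ne; rewrite e.
- have [v|nv] := lem (Vr (grid_of S)); [by left|right].
  move=> x t y z z' /grid_ofP[k kL [<- <- <- <-]] /grid_ofP[l lL [ex et ey ez]].
  rewrite -ez; apply: contrapT => ne; apply/nv/(@vanishing_Vr _ R[i]).
  apply: (orthogonal_vanishing kL lL _ (gcdn_diff_p2 (esym ex) (esym et))
    (gcdn_diff_q (esym ey)) (gcdn_diff_r1 ne)); last by ring.
  by move=> e; apply: ne; rewrite e.
- have [v|nv] := lem (Vpq (grid_of S)); [by left|right].
  move=> x t t' y y' z /grid_ofP[k kL [<- <- <- <-]] /grid_ofP[l lL [ex et ey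
    ez]].
  rewrite -et -ey; apply: contrapT => /not_orP[ne ne'].
  apply/nv/(@vanishing_Vpq _ R[i]).
  apply: (orthogonal_vanishing kL lL _ (gcdn_diff_p (esym ex) ne)
    (gcdn_diff_q1 ne') (gcdn_diff_r (esym ez))); last by ring.
  by move=> e; apply: ne; rewrite e.
- have [v|nv] := lem (Vpr (grid_of S)); [by left|right].
  move=> x t t' y z z' /grid_ofP[k kL [<- <- <- <-]] /grid_ofP[l lL [ex et ey
    ez]].
  rewrite -et -ez; apply: contrapT => /not_orP[ne ne'].
  apply/nv/(@vanishing_Vpr _ R[i]).
  apply: (orthogonal_vanishing kL lL _ (gcdn_diff_p (esym ex) ne)
    (gcdn_diff_q (esym ey)) (gcdn_diff_r1 ne')); last by ring.
  by move=> e; apply: ne; rewrite e.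
- have [v|nv] := lem (Vqr (grid_of S)); [by left|right].
  move=> x t y y' z z' /grid_ofP[k kL [<- <- <- <-]] /grid_ofP[l lL [ex et ey
    ez]].
  rewrite -ey -ez; apply: contrapT => /not_orP[ne ne'].
  apply/nv/(@vanishing_Vqr _ R[i]).
  apply: (orthogonal_vanishing kL lL _ (gcdn_diff_p2 (esym ex) (esym et))
    (gcdn_diff_q1 ne) (gcdn_diff_r1 ne')); last by ring.
  by move=> e; apply: ne; rewrite e.
- have [v|nv] := lem (Vp2q (grid_of S)); [by left|right].
  move=> x x' t t' y y' z /grid_ofP[k kL [<- _ <- <-]] /grid_ofP[l lL [ex et
    ey ez]].
  rewrite -ex -ey; apply: contrapT => /not_orP[ne ne'].
  apply/nv/(@vanishing_Vp2q _ R[i]).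
  apply: (orthogonal_vanishing kL lL _ (gcdn_diff_p1 ne)
    (gcdn_diff_q1 ne') (gcdn_diff_r (esym ez))); last by ring.
  by move=> e; apply: ne; rewrite e.
- have [v|nv] := lem (Vp2r (grid_of S)); [by left|right].
  move=> x x' t t' y z z' /grid_ofP[k kL [<- _ <- <-]] /grid_ofP[l lL [ex et
    ey ez]].
  rewrite -ex -ez; apply: contrapT => /not_orP[ne ne'].
  apply/nv/(@vanishing_Vp2r _ R[i]).
  apply: (orthogonal_vanishing kL lL _ (gcdn_diff_p1 ne)
    (gcdn_diff_q (esym ey)) (gcdn_diff_r1 ne')); last by ring.
  by move=> e; apply: ne; rewrite e.
- have [v|nv] := lem (Vpqr (grid_of S)); [by left|right].
  move=> x t t' y y' z z' /grid_ofP[k kL [<- <- <- <-]] /grid_ofP[l lL [ex et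
    ey ez]].
  rewrite -et -ey -ez; apply: contrapT => H.
  have ne : ct k <> ct l by move=> e; apply/H/Or31.
  have ne' : cy k <> cy l by move=> e; apply/H/Or32.
  have ne'' : cz k <> cz l by move=> e; apply/H/Or33.
  apply/nv/(@vanishing_Vpqr _ R[i]).
  apply: (orthogonal_vanishing kL lL _ (gcdn_diff_p (esym ex) ne)
    (gcdn_diff_q1 ne') (gcdn_diff_r1 ne'')); last by ring.
  by move=> e; apply: ne; rewrite e.
- have [v|nv] := lem (Vp2qr (grid_of S)); [by left|right].
  move=> x x' t t' y y' z z' /grid_ofP[k kL [<- _ <- <-]] /grid_ofP[l lL [ex
    et ey ez]].
  rewrite -ex -ey -ez; apply: contrapT => H.
  have ne : cx k <> cx l by move=> e; apply/H/Or31.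
  have ne' : cy k <> cy l by move=> e; apply/H/Or32.
  have ne'' : cz k <> cz l by move=> e; apply/H/Or33.
  apply/nv/(@vanishing_Vp2qr _ R[i]).
  apply: (orthogonal_vanishing kL lL _ (gcdn_diff_p1 ne)
    (gcdn_diff_q1 ne') (gcdn_diff_r1 ne'')); last by ring.
  by move=> e; apply: ne; rewrite e.
Qed.

End Dual.

(** * The tiling complement in Z_n *)

Lemma card_ord_cond m (c : bool) (i : 'I_m) :
  #|[set j | c || (j == i)]| = m ^ c.
Proof.
case: c => /=; last by rewrite expn0 -(cards1 i); apply: eq_card => j;
  rewrite !inE.
by rewrite expn1 -[RHS]card_ord -cardsT; apply: eq_card => j; rewrite !inE.
Qed.

Lemma Zn_addE (s u : 'Z_n) : (s + u)%R = (s + u) %% n :> nat.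
Proof. exact: (congr1 (modn (s + u)) Zn). Qed.

Lemma mod_add_cancel d (s s' u u' : 'Z_n) : d %| n ->
  (s + u = s' + u')%R -> u = u' %[mod d] -> s = s' %[mod d].
Proof.
move=> d_n /(congr1 (fun x : 'Z_n => x %% d));
  rewrite !Zn_addE !modn_dvdm // => e eu.
by apply/eqP; rewrite -(eqn_modDr u) e -modnDmr -eu modnDmr.
Qed.

Lemma mod_add_cancel_l d (s s' u u' : 'Z_n) : d %| n ->
  (s + u = s' + u')%R -> s = s' %[mod d] -> u = u' %[mod d].
Proof. by rewrite ![(_ + u)%R]GRing.addrC ![(_ + u')%R]GRing.addrC;
  apply: mod_add_cancel. Qed.

(** Since |S| |T| = n, injectivity of addition on S x T suffices. It is tested modulo p, p^2, q and
    r, because the digits x and t do not add separately: there are carries. *)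
Lemma std_tile_tile (S : {set 'Z_n}) : std_tile (grid_of S) -> tile S.
Proof.
case=> c1 [c2 [c3 [c4 []]]]; rewrite size_grid_of => E H.
have [p2_n q_n r_n] : [/\ p ^ 2 %| n, q %| n & r %| n].
  by rewrite En; split;
    [rewrite -mulnA dvdn_mulr|rewrite dvdn_mulr // dvdn_mull|rewrite dvdn_mull].
have p_n : p %| n by apply: dvdn_trans p2_n; rewrite -mulnn dvdn_mulr.
pose T := [set u : 'Z_n | [&& c1 || (cx u == x0), c2 || (ct u == x0),
  c3 || (cy u == y0) & c4 || (cz u == z0)]].
have cT : #|T| = p ^ (c1 + c2) * q ^ c3 * r ^ c4.
  pose B := setX (setX (setX [set x | c1 || (x == x0)] [set t | c2 || (t ==
    x0)])
    [set y | c3 || (y == y0)]) [set z | c4 || (z == z0)].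
  have -> : T = coords @^-1: B.
    by apply/setP => u; rewrite !inE /= -!andbA.
  rewrite on_card_preimset; last exact: onW_bij coords_bij.
  by rewrite !cardsX !card_ord_cond expnD.
have cST : #|S| * #|T| = n by rewrite cT E En.
have cZ : #|[set: 'Z_n]| = n by rewrite cardsT card_ord Zn.
exists T; split=> //; apply/eqP; rewrite eqEcard subsetT cZ.
apply: (@leq_trans (#|S| * #|T|)); first by rewrite cST.
rewrite -cardsX; apply: eq_leq.
rewrite curry_imset2X card_in_imset //.
move=> [s u] [s' u']; rewrite !inE /= => /andP[sS uT] /andP[sS' uT'] e.
have mem w : w \in S -> grid_of S (cx w) (ct w) (cy w) (cz w).
  by move=> wS; apply/grid_ofP; exists w.
case/and4P: uT => u1 u2 u3 u4; case/and4P: uT' => u1' u2' u3' u4'.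
have [|||ex et ey ez] := H _ _ _ _ _ _ _ _ (mem s sS) (mem s' sS').
- have pu : ~~ c1 -> cx u = cx u'.
    by move=> n1; move: u1 u1'; rewrite (negPf n1) => /eqP-> /eqP->.
  have tu : ~~ c2 -> ct u = ct u'.
    by move=> n2; move: u2 u2'; rewrite (negPf n2) => /eqP-> /eqP->.
  case: (c1) (c2) pu tu => [] [] //= pu tu.
  (* T runs through x with t fixed. Equal x for s and s' gives equal x for u and u', whose t agree
     too; only then can u be cancelled modulo p^2. *)
  + have [ex|//] := eqVneq (cx s) (cx s'); rewrite /=.
    have eu : cx u = cx u'.
      by apply/eqP; rewrite cx_eq; apply/eqP/(mod_add_cancel_l p_n e)/cx_mod.
    have : s = s' %[mod p ^ 2].
      by apply: (mod_add_cancel p2_n e); apply: cxt_mod => //; apply: tu.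
    by move/eqP; rewrite -cxt_eq => /andP[].
  + by rewrite cx_eq; apply/eqP/(mod_add_cancel p_n e)/cx_mod/pu.
  + rewrite cxt_eq; apply/eqP/(mod_add_cancel p2_n e)/cxt_mod; first exact: pu.
    exact: tu.
- move: u3 u3'; case: (c3) => //= /eqP e1 /eqP e2.
  by rewrite cy_eq; apply/eqP/(mod_add_cancel q_n e)/cy_mod; rewrite e1 e2.
- move: u4 u4'; case: (c4) => //= /eqP e1 /eqP e2.
  by rewrite cz_eq; apply/eqP/(mod_add_cancel r_n e)/cz_mod; rewrite e1 e2.
have es : s = s' by apply: coords_inj; rewrite /coords ex et ey ez.
by move: e; rewrite es => /GRing.addrI->.
Qed.
End Coordinates.

Theorem theorem1p1 (R : realType) (p q r n : nat) (S : {set 'Z_n}) :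
  prime p -> prime q -> prime r ->
  p <> q -> p <> r -> q <> r ->
  n = (p ^ 2 * q * r)%N ->
  spectral R S -> tile S.
Proof.
move=> p_pr q_pr r_pr /eqP pq /eqP pr /eqP qr En spS.
have n1 : 1 < n := n_gt1 p_pr q_pr r_pr En.
have [S0 [L [cLS oSL oLS]]] := Spectrum.spectral_orthogonal n1 spS.
refine (std_tile_tile (p_pr := p_pr) (q_pr := q_pr) (r_pr :=
  r_pr) pq pr qr En _).
apply: (@spectral_grid_tile _ _ _ _ (grid_of p_pr q_pr r_pr L)) => //.
- exact: (grid_dual p_pr q_pr r_pr pq pr qr En oLS).
- exact: (grid_dual p_pr q_pr r_pr pq pr qr En oSL).
- by rewrite !size_grid_of.
- by rewrite size_grid_of // card_gt0.
Qed.
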